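(* Let $\mathcal C,\mathcal D$ be unitary fusion categories, ${}_{\mathcal C}\mathcal M_{\mathcal D}$ an indecomposable finitely semisimple unitary bimodule category with $d^L_m=d^R_m=d_m$ for all $m\in\mathrm{Irr}(\mathcal M)$, and $W=\mathbf{Tube}({}_{\mathcal C}\mathcal M_{\mathcal D})$. Let $\mathfrak f,\mathfrak g\in\mathrm{Fun}_{\mathcal C|\mathcal D}(\mathcal M,\mathcal M)$ be simple, and let $\chi_{\mathfrak f},\chi_{\mathfrak g}\in\hat W=\mathrm{Hom}(W,\mathbb C)$ be the characters of the $W$-modules $V^{\mathfrak f},V^{\mathfrak g}$. Then $$(\chi_{\mathfrak f},\chi_{\mathfrak g})=\delta_{\mathfrak f,\mathfrak g},$$ i.e. it equals $1$ if $\mathfrak f\cong\mathfrak g$ and $0$ otherwise.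
   Context: $\mathrm{Fun}_{\mathcal C|\mathcal D}(\mathcal M,\mathcal M)$: bimodule endofunctors $\mathfrak f$, with structure isomorphisms $\mathfrak f(a\otimes m\otimes b)\cong a\otimes\mathfrak f(m)\otimes b$ (suppressed). Associators are suppressed. $\mathrm{Irr}$: representatives of simple objects; $d_a$: quantum dimension; $\bar a$: dual; $R_a:\mathbb 1\to\bar a\otimes a$, $\bar R_a:\mathbb 1\to a\otimes\bar a$: standard balanced solutions of the conjugate equations ($(\bar R_a^\dagger\otimes \mathrm{id}_a)(\mathrm{id}_a\otimes R_a)=\mathrm{id}_a$, $(R_a^\dagger\otimes \mathrm{id}_{\bar a})(\mathrm{id}_{\bar a}\otimes\bar R_a)=\mathrm{id}_{\bar a}$, $R_a^\dagger R_a=\bar R_a^\dagger\bar R_a=d_a$). $d^L_m>0$ satisfy $d_ad^L_m=\sum_n\dim\mathrm{Hom}(a\otimes m,n)d^L_n$ for $a\in \mathrm{Irr}(\mathcal C)$; $d^R_m>0$ satisfy $d^R_md_b=\sum_n\dim\mathrm{Hom}(m\otimes b,n)d^R_n$ for $b\in \mathrm{Irr}(\mathcal D)$ (only ratios matter). Dual bases $\tau,\tau^*$ of $\mathrm{Hom}(k,Y)$, $\mathrm{Hom}(Y,k)$ ($k$ simple): $\tau_i^*\tau_j=\delta_{ij}\mathrm{id}_k$. Domain wall tube algebra (a $C^*$ weak Hopf algebra): $W=\bigoplus_{a,b}\bigoplus_{x,z,u,w\in\mathrm{Irr}(\mathcal M)}\mathrm{Hom}(x,a\otimes z\otimes b)\otimes\mathrm{Hom}(a\otimes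 u\otimes b,w)$ ($a\in\mathrm{Irr}(\mathcal C),b\in\mathrm{Irr}(\mathcal D)$), with - $1=\sum_{x,u}\mathrm{id}_x\otimes\mathrm{id}_u$ ($a=b=\mathbb 1$); - $(f\otimes g)(f'\otimes g')=\delta_{u,w'}\delta_{z,x'}\sum_{k,s,\tau,\sigma}[(\tau^*\otimes\mathrm{id}_{z'}\otimes\sigma^* )(\mathrm{id}_a\otimes f'\otimes\mathrm{id}_b)f]\otimes[g(\mathrm{id}_a\otimes g'\otimes\mathrm{id}_b)(\tau\otimes\mathrm{id}_{u'}\otimes\sigma)]$, $\tau,\sigma$ over bases of $\mathrm{Hom}(k,a\otimes a')$, $\mathrm{Hom}(s,b'\otimes b)$; - $\varepsilon(f\otimes g)=0$ unless $z=u,x=w$, and then $gf=\varepsilon(f\otimes g)\mathrm{id}_x$; - $\Delta(f\otimes g)=\sum_{i,k,e}(e\otimes g)\otimes(f\otimes e^* )$, $e,e^*$ dual bases of $\mathrm{Hom}(k,a\otimes i\otimes b)$, $\mathrm{Hom}(a\otimes i\otimes b,k)$; - $S(f\otimes g)=\frac{d_u}{d_w}\hat g\otimes\hat f$, $\hat g=(\mathrm{id}_{\bar a}\otimes g\otimes\mathrm{id}_{\bar b})(R_a\otimes\mathrm{id}_u\otimes\bar R_b)$, $\hat f=(R_a^\dagger\otimes\mathrm{id}_z\otimes\bar R_b^\dagger)(\mathrm{id}_{\bar a}\otimes f\otimes\mathrm{id}_{\bar b})$; - $(f\otimes g)^*=\frac{d_z}{d_x}\check f\otimes\check g$ (antilinear),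 $\check f=(\mathrm{id}_{\bar a}\otimes f^\dagger\otimes\mathrm{id}_{\bar b})(R_a\otimes\mathrm{id}_z\otimes\bar R_b)$, $\check g=(R_a^\dagger\otimes\mathrm{id}_u\otimes\bar R_b^\dagger)(\mathrm{id}_{\bar a}\otimes g^\dagger\otimes\mathrm{id}_{\bar b})$. Module $V^{\mathfrak f}=\bigoplus_{x,y\in\mathrm{Irr}(\mathcal M)}\mathrm{Hom}(x,\mathfrak f(y))$ with action, for $\alpha\in\mathrm{Hom}(s,\mathfrak f(t))$: $(f\otimes g)\triangleright\alpha=\delta_{z,s}\delta_{u,t}\,\mathfrak f(g)\circ(\mathrm{id}_a\otimes\alpha\otimes\mathrm{id}_b)\circ f$. Inner product on $\hat W$: $(\phi,\psi)=\langle\phi^*\psi,\mathfrak I\rangle$, where $\hat W$ has the convolution product $(\phi\psi)(w)=\sum\phi(w^{(1)})\psi(w^{(2)})$, $\phi^*(w)=\overline{\phi(S(w)^* )}$, and $\mathfrak I\in W$ is the Haar integral: the unique element with $w\mathfrak I=\varepsilon_L(w)\mathfrak I$, $\mathfrak Iw=\mathfrak I\varepsilon_R(w)$ for all $w\in W$ and $\varepsilon_L(\mathfrak I)=\varepsilon_R(\mathfrak I)=1$, with $\varepsilon_L(w)=\sum\varepsilon(1^{(1)}w)1^{(2)}$, $\varepsilon_R(w)=\sum1^{(1)}\varepsilon(w1^{(2)})$. *)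

(* Defs.v *)
From mathcomp Require Import all_boot all_order all_algebra.
From mathcomp Require Import reals.
From mathcomp Require Import complex.

Set Implicit Arguments.
Unset Strict Implicit.
Unset Printing Implicit Defensive.

Import GRing.Theory.
Local Open Scope ring_scope.
Local Open Scope complex_scope.

Declare Scope cat_scope.
Delimit Scope cat_scope with cat.
Local Open Scope cat_scope.

(* A C*-category with finite-dimensional hom spaces.  As the hom spaces are
   finite-dimensional, the C*-norms exist and are determined by the
   *-structure, so that being C* is the following property of [dag]: every
   [dag f ∘ f] is positive in the *-algebra End(x) and vanishes only when f
   does. *)
Record cstar_category (R : realType) := CStarCategory {
  obj :> Type;
  hom : obj -> obj -> vectType R[i];
  idm : forall x, hom x x;
  comp : forall x y z, hom y z -> hom x y -> hom x z;
  dag : forall x y, hom x y -> hom y x;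
  compA : forall x y z t (h : hom z t) (g : hom y z) (f : hom x y),
    comp h (comp g f) = comp (comp h g) f;
  comp1m : forall x y (f : hom x y), comp (idm y) f = f;
  compm1 : forall x y (f : hom x y), comp f (idm x) = f;
  comp_linearl : forall x y z (k : R[i]) (g g' : hom y z) (f : hom x y),
    comp (k *: g + g') f = k *: comp g f + comp g' f;
  comp_linearr : forall x y z (k : R[i]) (g : hom y z) (f f' : hom x y),
    comp g (k *: f + f') = k *: comp g f + comp g f';
  dagK : forall x y (f : hom x y), dag (dag f) = f;
  dag_comp : forall x y z (g : hom y z) (f : hom x y),
    dag (comp g f) = comp (dag f) (dag g);
  dag_antilinear : forall x y (k : R[i]) (f f' : hom x y),
    dag (k *: f + f') = conjc k *: dag f + dag f';
  dag_pos : forall x y (f : hom x y),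
    exists g : hom x x, comp (dag f) f = comp (dag g) g;
  dag_definite : forall x y (f : hom x y), comp (dag f) f = 0 -> f = 0
}.

Arguments idm {R c} x.
Arguments comp {R c x y z} g f.
Arguments dag {R c x y} f.

Notation "g ∘ f" := (comp g f) (at level 40, left associativity) : cat_scope.
Notation "f ^†" := (dag f) (at level 2, format "f ^†") : cat_scope.

Section Categories.
Variable R : realType.
Implicit Type X : cstar_category R.

Definition is_iso X (x y : X) (f : hom x y) : Prop :=
  exists g : hom y x, g ∘ f = idm x /\ f ∘ g = idm y.

Definition isomorphic X (x y : X) : Prop := exists f : hom x y, is_iso f.

Definition unitary X (x y : X) (f : hom x y) : Prop :=
  f^† ∘ f = idm x /\ f ∘ f^† = idm y.

Definition is_zero_obj X (x : X) : Prop := idm x = 0.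

Definition simple X (x : X) : Prop :=
  ~ is_zero_obj x /\ forall f : hom x x, exists c : R[i], f = c *: idm x.

(* [s] is the (orthogonal) direct sum of the family [x]; the empty family
   gives the zero object. *)
Definition is_dsum X (I : finType) (x : I -> X) (s : X) : Prop :=
  exists v : forall i, hom (x i) s,
    [/\ forall i, (v i)^† ∘ v i = idm (x i),
        forall i j, i != j -> (v i)^† ∘ v j = 0 &
        \sum_i v i ∘ (v i)^† = idm s].

Definition finitely_semisimple X : Prop :=
  [/\ forall n (x : 'I_n -> X), exists s, is_dsum x s,
      forall s : X, exists n (x : 'I_n -> X),
        (forall i, simple (x i)) /\ is_dsum x s &
      exists n (r : 'I_n -> X), forall x : X, simple x ->
        exists i, isomorphic x (r i)].

Definition irr_representatives X (I : finType) (r : I -> X) : Prop :=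
  [/\ forall i, simple (r i),
      forall i j, isomorphic (r i) (r j) -> i = j &
      forall x : X, simple x -> exists i, isomorphic x (r i)].

Record dual_bases X (k y : X) := DualBases {
  mult : nat;
  dbas : mult.-tuple (hom k y);
  dbas' : mult.-tuple (hom y k);
  dbas_basis : basis_of fullv dbas;
  dbas'_basis : basis_of fullv dbas';
  dbas_dual : forall i j, tnth dbas' i ∘ tnth dbas j = (i == j)%:R *: idm k
}.

(* [scalar h] is the c with h = c *: idm x; meant for x simple. *)
Definition scalar X (x : X) (h : hom x x) : R[i] :=
  coord [tuple idm x] ord0 h.

Record dagger_bifunctor (X Y Z : cstar_category R) (F : X -> Y -> Z)
  (Fm : forall x x' y y', hom x x' -> hom y y' -> hom (F x y) (F x' y')) : Prop :=
 DaggerBifunctor {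
  bif_id : forall x y, Fm x x y y (idm x) (idm y) = idm (F x y);
  bif_comp : forall x x' x'' y y' y'' (f' : hom x' x'') (f : hom x x')
    (g' : hom y' y'') (g : hom y y'),
    Fm _ _ _ _ (f' ∘ f) (g' ∘ g) = Fm _ _ _ _ f' g' ∘ Fm _ _ _ _ f g;
  bif_linearl : forall x x' y y' (k : R[i]) (f f' : hom x x') (g : hom y y'),
    Fm _ _ _ _ (k *: f + f') g = k *: Fm _ _ _ _ f g + Fm _ _ _ _ f' g;
  bif_linearr : forall x x' y y' (k : R[i]) (f : hom x x') (g g' : hom y y'),
    Fm _ _ _ _ f (k *: g + g') = k *: Fm _ _ _ _ f g + Fm _ _ _ _ f g';
  bif_dag : forall x x' y y' (f : hom x x') (g : hom y y'),
    (Fm _ _ _ _ f g)^† = Fm _ _ _ _ f^† g^†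
 }.

End Categories.

(* Unitary monoidal category; all inverses of coherence isomorphisms are
   daggers. *)
Record monoidal_category (R : realType) := MonoidalCategory {
  mcat :> cstar_category R;
  tens : mcat -> mcat -> mcat;
  tensm : forall x x' y y', hom x x' -> hom y y' -> hom (tens x y) (tens x' y');
  munit : mcat;
  massoc : forall x y z, hom (tens (tens x y) z) (tens x (tens y z));
  mlunit : forall x, hom (tens munit x) x;
  mrunit : forall x, hom (tens x munit) x;
  tens_bif : dagger_bifunctor tensm;
  massoc_unitary : forall x y z, unitary (massoc x y z);
  mlunit_unitary : forall x, unitary (mlunit x);
  mrunit_unitary : forall x, unitary (mrunit x);
  massoc_nat : forall x x' y y' z z' (f : hom x x') (g : hom y y') (h : hom z z'),
    massoc x' y' z' ∘ tensm (tensm f g) h = tensm f (tensm g h) ∘ massoc x y z;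
  mlunit_nat : forall x x' (f : hom x x'),
    mlunit x' ∘ tensm (idm munit) f = f ∘ mlunit x;
  mrunit_nat : forall x x' (f : hom x x'),
    mrunit x' ∘ tensm f (idm munit) = f ∘ mrunit x;
  mpentagon : forall x y z t,
    tensm (idm x) (massoc y z t) ∘ massoc x (tens y z) t
      ∘ tensm (massoc x y z) (idm t)
    = massoc x y (tens z t) ∘ massoc (tens x y) z t;
  mtriangle : forall x y,
    tensm (idm x) (mlunit y) ∘ massoc x munit y = tensm (mrunit x) (idm y)
}.

Arguments tens {R m} x y.
Arguments tensm {R m x x' y y'} f g.
Arguments munit {R} m.
Arguments massoc {R m} x y z.
Arguments mlunit {R m} x.
Arguments mrunit {R m} x.

Notation "x ⊗ y" := (tens x y) (at level 35, right associativity) : cat_scope.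
Notation "f ⊗m g" := (tensm f g) (at level 35, right associativity) : cat_scope.

Section Fusion.
Variable R : realType.
Implicit Type C : monoidal_category R.

Definition conjugate_equations C (a a' : C) (r : hom (munit C) (a' ⊗ a))
    (r' : hom (munit C) (a ⊗ a')) : Prop :=
  mlunit a ∘ (r'^† ⊗m idm a) ∘ (massoc a a' a)^† ∘ (idm a ⊗m r) ∘ (mrunit a)^†
    = idm a
  /\
  mlunit a' ∘ (r^† ⊗m idm a') ∘ (massoc a' a a')^† ∘ (idm a' ⊗m r')
    ∘ (mrunit a')^† = idm a'.

Definition rigid C : Prop := forall a : C, exists (a' : C)
  (r : hom (munit C) (a' ⊗ a)) (r' : hom (munit C) (a ⊗ a')),
  conjugate_equations r r'.

Definition unitary_fusion C : Prop :=
  [/\ finitely_semisimple C, rigid C & simple (munit C)].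

(* Choices in a fusion category entering the tube algebra.  The set of
   representatives of simple objects is indexed by [option fc_nontriv], with
   the unit object itself as the representative of its class. *)
Record fusion_choices C := FusionChoices {
  fc_nontriv : finType;
  fc_obj : fc_nontriv -> C;
  fc_rep := oapp fc_obj (munit C) : option fc_nontriv -> C;
  fc_irr : irr_representatives fc_rep;
  fc_dual : option fc_nontriv -> option fc_nontriv;
  fc_R : forall a, hom (munit C) (fc_rep (fc_dual a) ⊗ fc_rep a);
  fc_R' : forall a, hom (munit C) (fc_rep a ⊗ fc_rep (fc_dual a));
  fc_dim : option fc_nontriv -> R;
  fc_conj : forall a, conjugate_equations (fc_R a) (fc_R' a);
  fc_dimR : forall a, (fc_R a)^† ∘ fc_R a = (fc_dim a)%:C *: idm (munit C);
  fc_dimR' : forall a, (fc_R' a)^† ∘ fc_R' a = (fc_dim a)%:C *: idm (munit C);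
  fc_bases : forall k (y : C), dual_bases (fc_rep k) y
}.

Definition fc_Irr C (cC : fusion_choices C) : finType := option (fc_nontriv cC).

End Fusion.

(* Unitary C-D-bimodule category: left action [lact], right action [ract],
   and the middle associator [bassoc]. *)
Record bimodule_category (R : realType) (C D : monoidal_category R) :=
 BimoduleCategory {
  bcat :> cstar_category R;
  lact : C -> bcat -> bcat;
  lactm : forall a a' m m', hom a a' -> hom m m' -> hom (lact a m) (lact a' m');
  lassoc : forall a a' m, hom (lact (a ⊗ a') m) (lact a (lact a' m));
  lunit : forall m, hom (lact (munit C) m) m;
  ract : bcat -> D -> bcat;
  ractm : forall m m' b b', hom m m' -> hom b b' -> hom (ract m b) (ract m' b');
  rassoc : forall m b b', hom (ract (ract m b) b') (ract m (b ⊗ b'));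
  runit : forall m, hom (ract m (munit D)) m;
  bassoc : forall a m b, hom (ract (lact a m) b) (lact a (ract m b));
  lact_bif : dagger_bifunctor lactm;
  ract_bif : dagger_bifunctor ractm;
  lassoc_unitary : forall a a' m, unitary (lassoc a a' m);
  lunit_unitary : forall m, unitary (lunit m);
  rassoc_unitary : forall m b b', unitary (rassoc m b b');
  runit_unitary : forall m, unitary (runit m);
  bassoc_unitary : forall a m b, unitary (bassoc a m b);
  lassoc_nat : forall a1 a2 a1' a2' m1 m2
    (f : hom a1 a2) (f' : hom a1' a2') (h : hom m1 m2),
    lassoc a2 a2' m2 ∘ lactm (f ⊗m f') h
      = lactm f (lactm f' h) ∘ lassoc a1 a1' m1;
  lunit_nat : forall m1 m2 (h : hom m1 m2),
    lunit m2 ∘ lactm (idm (munit C)) h = h ∘ lunit m1;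
  rassoc_nat : forall m1 m2 b1 b2 b1' b2'
    (h : hom m1 m2) (g : hom b1 b2) (g' : hom b1' b2'),
    rassoc m2 b2 b2' ∘ ractm (ractm h g) g'
      = ractm h (g ⊗m g') ∘ rassoc m1 b1 b1';
  runit_nat : forall m1 m2 (h : hom m1 m2),
    runit m2 ∘ ractm h (idm (munit D)) = h ∘ runit m1;
  bassoc_nat : forall a1 a2 m1 m2 b1 b2
    (f : hom a1 a2) (h : hom m1 m2) (g : hom b1 b2),
    bassoc a2 m2 b2 ∘ ractm (lactm f h) g
      = lactm f (ractm h g) ∘ bassoc a1 m1 b1;
  lpentagon : forall a a' a'' m,
    lactm (idm a) (lassoc a' a'' m) ∘ lassoc a (a' ⊗ a'') m
      ∘ lactm (massoc a a' a'') (idm m)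
    = lassoc a a' (lact a'' m) ∘ lassoc (a ⊗ a') a'' m;
  ltriangle : forall a m,
    lactm (idm a) (lunit m) ∘ lassoc a (munit C) m
    = lactm (mrunit a) (idm m);
  rpentagon : forall m b b' b'',
    ractm (idm m) (massoc b b' b'') ∘ rassoc m (b ⊗ b') b''
      ∘ ractm (rassoc m b b') (idm b'')
    = rassoc m b (b' ⊗ b'') ∘ rassoc (ract m b) b' b'';
  rtriangle : forall m b,
    ractm (idm m) (mlunit b) ∘ rassoc m (munit D) b
    = ractm (runit m) (idm b);
  bpentagonl : forall a a' m b,
    lactm (idm a) (bassoc a' m b) ∘ bassoc a (lact a' m) b
      ∘ ractm (lassoc a a' m) (idm b)
    = lassoc a a' (ract m b) ∘ bassoc (a ⊗ a') m b;
  bpentagonr : forall a m b b',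
    lactm (idm a) (rassoc m b b') ∘ bassoc a (ract m b) b'
      ∘ ractm (bassoc a m b) (idm b')
    = bassoc a m (b ⊗ b') ∘ rassoc (lact a m) b b';
  btrianglel : forall m b,
    lunit (ract m b) ∘ bassoc (munit C) m b = ractm (lunit m) (idm b);
  btriangler : forall a m,
    lactm (idm a) (runit m) ∘ bassoc a m (munit D) = runit (lact a m)
 }.

Arguments lact {R C D b} a m : rename.
Arguments lactm {R C D b a a' m m'} f h : rename.
Arguments lassoc {R C D b} a a' m : rename.
Arguments lunit {R C D b} m : rename.
Arguments ract {R C D b0} m b : rename.
Arguments ractm {R C D b0 m m' b b'} h g : rename.
Arguments rassoc {R C D b0} m b b' : rename.
Arguments runit {R C D b} m : rename.
Arguments bassoc {R C D b0} a m b : rename.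

Section Bimodules.
Variables (R : realType) (C D : monoidal_category R).
Implicit Type M : bimodule_category C D.

(* M is nonzero, and is not the direct sum of two nonzero full
   sub-bimodule categories P and Q. *)
Definition indecomposable M : Prop :=
  (exists m : M, ~ is_zero_obj m) /\
  forall P Q : M -> Prop,
    (forall (a : C) m (b : D), P m -> P (lact a m) /\ P (ract m b)) ->
    (forall (a : C) m (b : D), Q m -> Q (lact a m) /\ Q (ract m b)) ->
    (forall p q, P p -> Q q -> forall h : hom p q, h = 0) ->
    (forall m, exists p q, [/\ P p, Q q &
       is_dsum (fun i : bool => if i then p else q) m]) ->
    (forall p, P p -> is_zero_obj p) \/ (forall q, Q q -> is_zero_obj q).

(* a ⊗ m ⊗ b *)
Definition act M (a : C) (m : M) (b : D) : M := ract (lact a m) b.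

Definition actm M (a a' : C) (m m' : M) (b b' : D)
  (f : hom a a') (h : hom m m') (g : hom b b') : hom (act a m b) (act a' m' b') :=
  ractm (lactm f h) g.

Definition act_assoc M (a a' : C) (m : M) (b' b : D) :
  hom (act (a ⊗ a') m (b' ⊗ b)) (act a (act a' m b') b) :=
  ractm (bassoc a (lact a' m) b') (idm b)
    ∘ (rassoc (lact a (lact a' m)) b' b)^†
    ∘ ractm (lassoc a a' m) (idm (b' ⊗ b)).

Definition act_unit M (m : M) : hom (act (munit C) m (munit D)) m :=
  lunit m ∘ runit (lact (munit C) m).

(* C-linear bimodule endofunctor.  It is required neither to preserve the
   dagger nor to have unitary structure isomorphisms. *)
Record bimodule_functor M := BimoduleFunctor {
  bf_obj :> M -> M;
  bf_mor : forall x y, hom x y -> hom (bf_obj x) (bf_obj y);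
  bf_l : forall a m, hom (lact a (bf_obj m)) (bf_obj (lact a m));
  bf_r : forall m b, hom (ract (bf_obj m) b) (bf_obj (ract m b));
  bf_mor_id : forall x, bf_mor (idm x) = idm (bf_obj x);
  bf_mor_comp : forall x y z (g : hom y z) (f : hom x y),
    bf_mor (g ∘ f) = bf_mor g ∘ bf_mor f;
  bf_mor_linear : forall x y (k : R[i]) (f f' : hom x y),
    bf_mor (k *: f + f') = k *: bf_mor f + bf_mor f';
  bf_l_iso : forall a m, is_iso (bf_l a m);
  bf_r_iso : forall m b, is_iso (bf_r m b);
  bf_l_nat : forall a a' m m' (f : hom a a') (h : hom m m'),
    bf_l a' m' ∘ lactm f (bf_mor h) = bf_mor (lactm f h) ∘ bf_l a m;
  bf_r_nat : forall m m' b b' (h : hom m m') (g : hom b b'),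
    bf_r m' b' ∘ ractm (bf_mor h) g = bf_mor (ractm h g) ∘ bf_r m b;
  bf_l_assoc : forall a a' m,
    bf_mor (lassoc a a' m) ∘ bf_l (a ⊗ a') m
    = bf_l a (lact a' m) ∘ lactm (idm a) (bf_l a' m) ∘ lassoc a a' (bf_obj m);
  bf_l_unit : forall m, bf_mor (lunit m) ∘ bf_l (munit C) m = lunit (bf_obj m);
  bf_r_assoc : forall m b b',
    bf_mor (rassoc m b b') ∘ bf_r (ract m b) b' ∘ ractm (bf_r m b) (idm b')
    = bf_r m (b ⊗ b') ∘ rassoc (bf_obj m) b b';
  bf_r_unit : forall m, bf_mor (runit m) ∘ bf_r m (munit D) = runit (bf_obj m);
  bf_hexagon : forall a m b,
    bf_mor (bassoc a m b) ∘ bf_r (lact a m) b ∘ ractm (bf_l a m) (idm b)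
    = bf_l a (ract m b) ∘ lactm (idm a) (bf_r m b) ∘ bassoc a (bf_obj m) b
}.

Arguments bf_mor {M} F {x y} f : rename.
Arguments bf_l {M} F a m : rename.
Arguments bf_r {M} F m b : rename.

Definition bf_str M (F : bimodule_functor M) (a : C) (m : M) (b : D) :
  hom (act a (F m) b) (F (act a m b)) :=
  bf_r F (lact a m) b ∘ ractm (bf_l F a m) (idm b).

Definition bimodule_nat M (F G : bimodule_functor M)
    (eta : forall m, hom (F m) (G m)) : Prop :=
  [/\ forall m m' (h : hom m m'), eta m' ∘ bf_mor F h = bf_mor G h ∘ eta m,
      forall a m, eta (lact a m) ∘ bf_l F a m
        = bf_l G a m ∘ lactm (idm a) (eta m) &
      forall m b, eta (ract m b) ∘ bf_r F m b
        = bf_r G m b ∘ ractm (eta m) (idm b)].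

Definition bimodule_functor_iso M (F G : bimodule_functor M) : Prop :=
  exists eta : forall m, hom (F m) (G m),
    bimodule_nat eta /\ forall m, is_iso (eta m).

Definition simple_functor M (F : bimodule_functor M) : Prop :=
  (exists m, ~ is_zero_obj (F m)) /\
  forall eta : forall m, hom (F m) (F m), bimodule_nat eta ->
    exists c : R[i], forall m, eta m = c *: idm (F m).

Record module_choices M := ModuleChoices {
  mc_Irr : finType;
  mc_rep : mc_Irr -> M;
  mc_irr : irr_representatives mc_rep;
  mc_bases : forall k (y : M), dual_bases (mc_rep k) y
}.

End Bimodules.

Arguments bf_mor {R C D M} F {x y} f : rename.

Section Tube.
Variables (R : realType) (C D : monoidal_category R) (M : bimodule_category C D).
Variables (cC : fusion_choices C) (cD : fusion_choices D) (cM : module_choices M).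

Local Notation IC := (fc_Irr cC).
Local Notation ID := (fc_Irr cD).
Local Notation IM := (mc_Irr cM).
Local Notation rC := (fc_rep (f := cC)).
Local Notation rD := (fc_rep (f := cD)).
Local Notation rM := (mc_rep (m := cM)).

Definition left_dimension (d : IM -> R) : Prop :=
  forall (a : IC) (m : IM),
    fc_dim a * d m
    = \sum_(n : IM) (\dim {: hom (lact (rC a) (rM m)) (rM n)})%:R * d n.

Definition right_dimension (d : IM -> R) : Prop :=
  forall (m : IM) (b : ID),
    d m * fc_dim b
    = \sum_(n : IM) (\dim {: hom (ract (rM m) (rD b)) (rM n)})%:R * d n.

(* The representative a ⊗ y ⊗ b and the chosen dual bases of
   Hom(k, a ⊗ y ⊗ b) and Hom(a ⊗ y ⊗ b, k). *)
Definition ract3 (a : IC) (y : IM) (b : ID) : M := act (rC a) (rM y) (rD b).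
Definition bas3 (k : IM) (a : IC) (y : IM) (b : ID) :
  dual_bases (rM k) (ract3 a y b) := mc_bases k (ract3 a y b).

(* W is realized as the space of coordinate vectors in the basis
   e_i ⊗ e'_j of ⊕ Hom(x, a ⊗ z ⊗ b) ⊗ Hom(a ⊗ u ⊗ b, w); the summands are
   labelled by (a, b, x, z, u, w). *)
Definition tube_label : finType := (IC * ID * IM * IM * IM * IM)%type.

Definition tube_mult (t : tube_label) : finType :=
  let: (a, b, x, z, u, w) := t in
  ('I_(mult (bas3 x a z b)) * 'I_(mult (bas3 w a u b)))%type.

Definition tube_basis : finType := {t : tube_label & tube_mult t}.

Definition W := {ffun tube_basis -> R[i]^o}.

Definition Wbas (beta : tube_basis) : W := [ffun beta' => (beta' == beta)%:R].

Definition pure (a : IC) (b : ID) (x z u w : IM)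
    (f : hom (rM x) (ract3 a z b)) (g : hom (ract3 a u b) (rM w)) : W :=
  \sum_i \sum_j
    (coord (dbas (bas3 x a z b)) i f * coord (dbas' (bas3 w a u b)) j g)
    *: Wbas (existT tube_mult (a, b, x, z, u, w) (i, j)).

(* On f ⊗ g = e_i ⊗ e'_j, returns F a b x z u w f g. *)
Definition tube_case (T : Type)
    (F : forall (a : IC) (b : ID) (x z u w : IM),
       hom (rM x) (ract3 a z b) -> hom (ract3 a u b) (rM w) -> T)
    (beta : tube_basis) : T :=
  let: existT t p := beta in
  (let: (a, b, x, z, u, w) as t0 := t return tube_mult t0 -> T in
   fun p => F a b x z u w (tnth (dbas (bas3 x a z b)) p.1)
                          (tnth (dbas' (bas3 w a u b)) p.2)) p.

Definition Wlin (V : lmodType R[i])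
    (F : forall (a : IC) (b : ID) (x z u w : IM),
       hom (rM x) (ract3 a z b) -> hom (ract3 a u b) (rM w) -> V) (v : W) : V :=
  \sum_beta v beta *: tube_case F beta.

(* δ_{x,y} id_x, through which the Kronecker deltas of the structure maps
   are expressed: δ_{x,y} f is f composed with it. *)
Definition kron (x y : IM) : hom (rM x) (rM y) :=
  match x =P y with
  | ReflectT e => eq_rect x (fun y => hom (rM x) (rM y)) (idm (rM x)) y e
  | ReflectF _ => 0
  end.

Definition act1 (a : IC) (b : ID) (x y : M) (h : hom x y) :
  hom (act (rC a) x (rD b)) (act (rC a) y (rD b)) :=
  actm (idm (rC a)) h (idm (rD b)).

Definition Wone : W :=
  \sum_(x : IM) \sum_(u : IM)
    @pure None None x x u u (act_unit (rM x))^† (act_unit (rM u)).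

Definition pure_mul (a : IC) (b : ID) (x z u w : IM)
    (f : hom (rM x) (ract3 a z b)) (g : hom (ract3 a u b) (rM w))
    (a' : IC) (b' : ID) (x' z' u' w' : IM)
    (f' : hom (rM x') (ract3 a' z' b')) (g' : hom (ract3 a' u' b') (rM w')) : W :=
  \sum_(k : IC) \sum_(s : ID)
    let tau := fc_bases k (rC a ⊗ rC a') in
    let sigma := fc_bases s (rD b' ⊗ rD b) in
    \sum_i \sum_j
      @pure k s x z' u' w
        (actm (tnth (dbas' tau) i) (idm (rM z')) (tnth (dbas' sigma) j)
          ∘ (act_assoc (rC a) (rC a') (rM z') (rD b') (rD b))^†
          ∘ act1 a b (f' ∘ kron z x') ∘ f)
        (g ∘ act1 a b (kron w' u ∘ g')
          ∘ act_assoc (rC a) (rC a') (rM u') (rD b') (rD b)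
          ∘ actm (tnth (dbas tau) i) (idm (rM u')) (tnth (dbas sigma) j)).

Definition Wmul (v v' : W) : W :=
  Wlin (fun a b x z u w f g =>
    Wlin (fun a' b' x' z' u' w' f' g' => pure_mul f g f' g') v') v.

Definition Weps (v : W) : R[i] :=
  Wlin (V := R[i]^o) (fun a b x z u w f g =>
    scalar (kron w x ∘ g ∘ act1 a b (kron z u) ∘ f)) v.

(* W ⊗ W *)
Definition WW := {ffun tube_basis * tube_basis -> R[i]^o}.

Definition Wtens (v v' : W) : WW := [ffun p => v p.1 * v' p.2].

Definition Wcomul (v : W) : WW :=
  Wlin (fun a b x z u w f g =>
    \sum_(i : IM) \sum_(k : IM) \sum_e
      Wtens (pure (tnth (dbas (bas3 k a i b)) e) g)
            (pure f (tnth (dbas' (bas3 k a i b)) e))) v.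

(* The linear map W ⊗ W -> V induced by a bilinear B, applied to Δ(v), i.e.
   ∑ B v^(1) v^(2). *)
Definition sweedler (V : lmodType R[i]) (B : W -> W -> V) (v : W) : V :=
  \sum_p Wcomul v p *: B (Wbas p.1) (Wbas p.2).

Definition hat_in (a : IC) (b : ID) (u w : IM) (g : hom (ract3 a u b) (rM w)) :
  hom (rM u) (ract3 (fc_dual a) w (fc_dual b)) :=
  act1 (fc_dual a) (fc_dual b) g
  ∘ act_assoc (rC (fc_dual a)) (rC a) (rM u) (rD b) (rD (fc_dual b))
  ∘ actm (fc_R a) (idm (rM u)) (fc_R' b)
  ∘ (act_unit (rM u))^†.

Definition hat_out (a : IC) (b : ID) (x z : IM) (f : hom (rM x) (ract3 a z b)) :
  hom (ract3 (fc_dual a) x (fc_dual b)) (rM z) :=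
  act_unit (rM z)
  ∘ actm (fc_R a)^† (idm (rM z)) (fc_R' b)^†
  ∘ (act_assoc (rC (fc_dual a)) (rC a) (rM z) (rD b) (rD (fc_dual b)))^†
  ∘ act1 (fc_dual a) (fc_dual b) f.

Section Weights.
Variable d : IM -> R.

Definition Wantip (v : W) : W :=
  Wlin (fun a b x z u w f g =>
    (d u / d w)%:C *: pure (hat_in g) (hat_out f)) v.

Definition Wstar (v : W) : W :=
  \sum_beta conjc (v beta) *: tube_case (fun a b x z u w f g =>
    (d z / d x)%:C *: pure (hat_in f^†) (hat_out g^†)) beta.

End Weights.

Definition Weps_L (v : W) : W :=
  sweedler (fun v1 v2 => Weps (Wmul v1 v) *: v2) Wone.

Definition Weps_R (v : W) : W :=
  sweedler (fun v1 v2 => Weps (Wmul v v2) *: v1) Wone.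

Definition haar_integral (J : W) : Prop :=
  [/\ forall v, Wmul v J = Wmul (Weps_L v) J,
      forall v, Wmul J v = Wmul J (Weps_R v),
      Weps_L J = Wone & Weps_R J = Wone].

Definition dual_mul (phi psi : W -> R[i]) (v : W) : R[i] :=
  sweedler (V := R[i]^o) (fun v1 v2 => phi v1 * psi v2) v.

Definition dual_star (d : IM -> R) (phi : W -> R[i]) (v : W) : R[i] :=
  conjc (phi (Wstar d (Wantip d v))).

Definition dual_inner (d : IM -> R) (J : W) (phi psi : W -> R[i]) : R[i] :=
  dual_mul (dual_star d phi) psi J.

(* The W-module V^F = ⊕_{s,t} Hom(s, F t), again in coordinates. *)
Section TubeModule.
Variable F : bimodule_functor M.

Definition mod_basis : finType :=
  {st : IM * IM & 'I_(mult (mc_bases st.1 (F (rM st.2))))}.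

Definition tube_module := {ffun mod_basis -> R[i]^o}.

Definition mod_bas (gamma : mod_basis) : tube_module :=
  [ffun gamma' => (gamma' == gamma)%:R].

Definition mod_elt (s t : IM) (alpha : hom (rM s) (F (rM t))) : tube_module :=
  \sum_i coord (dbas (mc_bases s (F (rM t)))) i alpha
    *: mod_bas (existT (fun st => 'I_(mult (mc_bases st.1 (F (rM st.2)))))
                       (s, t) i).

Definition pure_act (a : IC) (b : ID) (x z u w : IM)
    (f : hom (rM x) (ract3 a z b)) (g : hom (ract3 a u b) (rM w))
    (s t : IM) (alpha : hom (rM s) (F (rM t))) : tube_module :=
  @mod_elt x w
    (bf_mor F g ∘ bf_str F (rC a) (rM u) (rD b)
      ∘ act1 a b (bf_mor F (kron t u) ∘ alpha ∘ kron z s) ∘ f).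

Definition Wact (v : W) (m : tube_module) : tube_module :=
  Wlin (fun a b x z u w f g =>
    \sum_(gamma : mod_basis) m gamma *:
      pure_act f g
        (tnth (dbas (mc_bases (tag gamma).1 (F (rM (tag gamma).2))))
              (tagged gamma))) v.

Definition tube_character (v : W) : R[i] :=
  \sum_(gamma : mod_basis) Wact v (mod_bas gamma) gamma.

End TubeModule.
End Tube.

(* Main.v *)
(** By sphericality of d (a Cauchy-Schwarz argument comparing the two partial traces
    on Hom(x, a ⊗ z ⊗ b)), the Haar integral is
    J = Σ j_z d_a d_b (d_z / d_x) Σ_j e_j ⊗ e'_j over dual bases of the
    Hom(x, a ⊗ z ⊗ b), with scalars j_z that are nonzero.  Left invariance of J says
    that averaging an arbitrary family of maps F(k) -> G(k), k simple, over J gives a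
    bimodule natural transformation.  As a functor F need not preserve daggers, its
    dagger conjugate F' (f |-> F(f^†)^†) enters: the function χ_F^* is computed
    by F', and (χ_F, χ_G) is a sum of matrix coefficients
    j_x <α' A(α β') β> of averages A of rank one maps F' -> G.  Averaging the identity
    gives a positive invertible map F -> F', so by Schur's lemma the space of natural
    transformations F' -> G is zero or a line spanned by an invertible t.  In the first
    case the averages vanish; in the second, the sum is the coefficient along t of
    A(t w), where w acts by j_x on the isotypic component of x, and A(t w) = t A(w) = t
    because rotating the bases in A(w) turns it into the normalization of J. *)

Require Import Defs.
From HB Require Import structures.
From mathcomp Require Import all_boot all_order all_algebra.
From mathcomp Require Import reals.
From mathcomp Require Import complex.
From mathcomp Require Import ring.
Import Defs.

Set Implicit Arguments.
Unset Strict Implicit.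
Unset Printing Implicit Defensive.

Import Order.TTheory GRing.Theory Num.Theory.
Local Open Scope ring_scope.
Local Open Scope complex_scope.
Local Open Scope cat_scope.

(** The hypotheses on d are eigenvector equations for fusion multiplicities; that partial traces
    over Hom(x, a ⊗ z ⊗ b) are governed by d_x / d_z has to be derived. Bending strands identifies
    this space antilinearly with Hom(z, a' ⊗ x ⊗ b') for the duals a', b'. In orthonormal bases the
    two bendings have matrices c and e, and the sum of all |d_z c - d_x e|^2 vanishes.

    J is given only by its defining properties. A coordinate of J is isolated by multiplying on the
    left with a suitable f ⊗ g in the component of the dual pair and reading off the component a = b
    = 1, which sees the product only through cups and caps. The scalars j_z are never evaluated:
    ε_R(J) = 1 makes them nonzero, and ε_L(J) = 1 supplies the one identity between them that is
    used.

    Dual bases need not be orthonormal, and indices in a Kronecker delta label objects of different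
    types. So sums over bases are treated as the canonical element Σ e_j ⊗ e'_j ([can]), which does
    not depend on the bases, and deltas as morphisms ([kron]), which linearity and Schur's lemma
    handle. *)

Definition lin (K : pzRingType) (U V : lmodType K) (f : U -> V) : Prop :=
  forall k u v, f (k *: u + v) = k *: f u + f v.

(** * Linearity as a predicate on plain functions *)

Section Lin.
Variables (K : pzRingType) (U V : lmodType K) (f : U -> V).
Hypothesis fl : lin f.

Lemma linD u v : f (u + v) = f u + f v.
Proof. by have := fl 1 u v; rewrite !scale1r. Qed.

Lemma lin0 : f 0 = 0.
Proof. by apply: (addIr (f 0)); rewrite -linD addr0 add0r. Qed.

Lemma linZ k u : f (k *: u) = k *: f u.
Proof. by have := fl k u 0; rewrite lin0 !addr0. Qed.

Lemma lin_sum (I : Type) (s : seq I) (P : pred I) (F : I -> U) :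
  f (\sum_(i <- s | P i) F i) = \sum_(i <- s | P i) f (F i).
Proof. by elim/big_rec2: _ => [|i a b _ <-]; rewrite ?lin0 ?linD. Qed.

End Lin.

Section LinClosure.
Variables (K : comPzRingType) (U V W : lmodType K).

Lemma lin_id : lin (@id U).
Proof. by []. Qed.

Lemma lin_comp (f : V -> W) (g : U -> V) : lin f -> lin g -> lin (fun u => f (g u)).
Proof. by move=> hf hg k u v; rewrite hg hf. Qed.

Lemma lin_bigsum (I : Type) (s : seq I) (P : pred I) (F : I -> U -> V) :
  (forall i, P i -> lin (F i)) -> lin (fun u => \sum_(i <- s | P i) F i u).
Proof.
move=> h k u v; rewrite scaler_sumr -big_split; apply: eq_bigr => i Pi.
exact: h.
Qed.

Lemma lin_scale (c : K) (f : U -> V) : lin f -> lin (fun u => c *: f u).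
Proof. by move=> h k u v; rewrite h scalerDr !scalerA mulrC. Qed.

Lemma lin_scalel (f : U -> K^o) (w : V) : lin f -> lin (fun u => f u *: w).
Proof. by move=> h k u v; rewrite h scalerDl scalerA. Qed.

Lemma lin_mull (c : K) (f : U -> K^o) : lin f -> lin (fun u => (c * f u : K^o)).
Proof. by move=> h k u v; rewrite h mulrDr /GRing.scale /= mulrCA. Qed.

Lemma lin_mulr (c : K) (f : U -> K^o) : lin f -> lin (fun u => (f u * c : K^o)).
Proof. by move=> h k u v; rewrite h mulrDl /GRing.scale /= mulrA. Qed.

Lemma lin_zero : lin (fun _ : U => (0 : V)).
Proof. by move=> k u v; rewrite scaler0 addr0. Qed.

End LinClosure.

Section Regroup.
Variables (K : comPzRingType) (U V : lmodType K) (I J : finType).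

Lemma lin_sum2 (L : U -> V) (p : I -> J -> U) : lin L ->
  L (\sum_i \sum_j p i j) = \sum_i \sum_j L (p i j).
Proof. by move=> hL; rewrite (lin_sum hL); apply: eq_bigr => i _; rewrite (lin_sum hL). Qed.

Lemma lin_sumZ (L : U -> V) (c : I -> K) (p : I -> J -> U) : lin L ->
  L (\sum_i c i *: \sum_j p i j) = \sum_i c i *: \sum_j L (p i j).
Proof.
by move=> hL; rewrite (lin_sum hL); apply: eq_bigr => i _; rewrite (linZ hL) (lin_sum hL).
Qed.

Lemma sum_regroup (S : finType) (c : J -> S -> K) (p : I -> J -> U) :
  \sum_i \sum_s \sum_j c j s *: p i j = \sum_j (\sum_s c j s) *: \sum_i p i j.
Proof.
under eq_bigr => i _ do rewrite exchange_big /=.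
rewrite exchange_big; apply: eq_bigr => j _ /=.
by rewrite scaler_sumr; apply: eq_bigr => i _; rewrite scaler_suml.
Qed.

End Regroup.

Section FfunSpace.
Variables (K : comPzRingType) (T : finType).
Local Notation space := {ffun T -> K^o}.

Lemma lin_ffun (V : lmodType K) (b : T -> V) : lin (fun v : space => \sum_t v t *: b t).
Proof.
move=> c v v'; rewrite scaler_sumr -big_split; apply: eq_bigr => t _ /=.
by rewrite !ffunE scalerDl scalerA.
Qed.

Lemma ffun_expand (v : space) : v = \sum_t v t *: ([ffun s => (s == t)%:R] : space).
Proof.
apply/ffunP => t; rewrite sum_ffunE (bigD1 t) //= big1 => [|s st].
  by rewrite !ffunE eqxx /GRing.scale /= mulr1 addr0.
by rewrite !ffunE eq_sym (negPf st) /GRing.scale /= mulr0.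
Qed.

End FfunSpace.

(** * Dagger categories *)

Section Comp.
Variables (R : realType) (X : cstar_category R).
Implicit Types x y z : X.

Lemma lin_compl x y z (f : hom x y) : lin (fun g : hom y z => g ∘ f).
Proof. by move=> k g g'; exact: comp_linearl. Qed.

Lemma lin_compr x y z (g : hom y z) : lin (fun f : hom x y => g ∘ f).
Proof. by move=> k f f'; exact: comp_linearr. Qed.

Lemma comp0m x y z (f : hom x y) : (0 : hom y z) ∘ f = 0.
Proof. exact: (lin0 (lin_compl f)). Qed.

Lemma compm0 x y z (g : hom y z) : g ∘ (0 : hom x y) = 0.
Proof. exact: (lin0 (lin_compr g)). Qed.

Lemma compZl x y z (k : R[i]) (g : hom y z) (f : hom x y) :
  (k *: g) ∘ f = k *: (g ∘ f).
Proof. exact: (linZ (lin_compl f)). Qed.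

Lemma compZr x y z (k : R[i]) (g : hom y z) (f : hom x y) :
  g ∘ (k *: f) = k *: (g ∘ f).
Proof. exact: (linZ (lin_compr g)). Qed.

Lemma compDl x y z (g g' : hom y z) (f : hom x y) : (g + g') ∘ f = g ∘ f + g' ∘ f.
Proof. exact: (linD (lin_compl f)). Qed.

Lemma compDr x y z (g : hom y z) (f f' : hom x y) : g ∘ (f + f') = g ∘ f + g ∘ f'.
Proof. exact: (linD (lin_compr g)). Qed.

Lemma comp_suml (I : Type) (s : seq I) (P : pred I) x y z (G : I -> hom y z)
  (f : hom x y) :
  (\sum_(i <- s | P i) G i) ∘ f = \sum_(i <- s | P i) G i ∘ f.
Proof. exact: (lin_sum (lin_compl f)). Qed.

Lemma comp_sumr (I : Type) (s : seq I) (P : pred I) x y z (g : hom y z)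
  (F : I -> hom x y) :
  g ∘ (\sum_(i <- s | P i) F i) = \sum_(i <- s | P i) g ∘ F i.
Proof. exact: (lin_sum (lin_compr g)). Qed.

Lemma dagD x y (f g : hom x y) : (f + g)^† = f^† + g^†.
Proof. by have := dag_antilinear 1 f g; rewrite conjc1 !scale1r. Qed.

Lemma dag0 x y : (0 : hom x y)^† = 0.
Proof. by apply: (addIr (0 : hom x y)^†); rewrite -dagD addr0 add0r. Qed.

Lemma dagZ x y (k : R[i]) (f : hom x y) : (k *: f)^† = conjc k *: f^†.
Proof. by have := dag_antilinear k f 0; rewrite dag0 !addr0. Qed.

Lemma dag_sum (I : Type) (s : seq I) (P : pred I) x y (F : I -> hom x y) :
  (\sum_(i <- s | P i) F i)^† = \sum_(i <- s | P i) (F i)^†.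
Proof. by elim/big_rec2: _ => [|i a b _ <-]; rewrite ?dag0 ?dagD. Qed.

Lemma dag1 x : (idm x)^† = idm x.
Proof. by have := dag_comp (idm x)^† (idm x); rewrite compm1 dagK compm1. Qed.

Lemma dag_inj x y (f g : hom x y) : f^† = g^† -> f = g.
Proof. by move=> h; rewrite -(dagK f) h dagK. Qed.

Lemma compKl x y z (g : hom y z) (g' : hom z y) (f : hom x y) :
  g' ∘ g = idm y -> g' ∘ (g ∘ f) = f.
Proof. by move=> h; rewrite compA h comp1m. Qed.

Lemma compK0l x y z t (g : hom y z) (g' : hom z t) (f : hom x y) :
  g' ∘ g = 0 -> g' ∘ (g ∘ f) = 0.
Proof. by move=> h; rewrite compA h comp0m. Qed.

Lemma compKr x y z (g : hom y z) (f : hom x y) (f' : hom y x) :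
  f ∘ f' = idm y -> g ∘ f ∘ f' = g.
Proof. by move=> h; rewrite -compA h compm1. Qed.

Lemma dsum2 x y (hX : finitely_semisimple X) : exists s (a : hom x s) (b : hom y s),
  [/\ a^† ∘ a = idm x, b^† ∘ b = idm y, a^† ∘ b = 0 & b^† ∘ a = 0].
Proof.
case: hX => [ds _ _].
pose F := fun i : 'I_2 => if i == ord0 then x else y.
have [s [v [v1 v0 _]]] := ds 2%N F.
exists s, (v ord0), (v (lift ord0 ord0)); split.
- exact: (v1 ord0).
- exact: (v1 (lift ord0 ord0)).
- exact: (v0 ord0 (lift ord0 ord0) isT).
- exact: (v0 (lift ord0 ord0) ord0 isT).
Qed.

(** Stacking f and g into a column with values in y ⊕ z merges two terms h^† h into one. This is
    where direct sums enter positivity. *)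
Lemma dag_sum2 x y z (hX : finitely_semisimple X) (f : hom x y) (g : hom x z) :
  exists s (a : hom y s) (b : hom z s), [/\ a^† ∘ (a ∘ f + b ∘ g) = f,
    b^† ∘ (a ∘ f + b ∘ g) = g &
    (a ∘ f + b ∘ g)^† ∘ (a ∘ f + b ∘ g) = f^† ∘ f + g^† ∘ g].
Proof.
have [s [a [b [aa bb ab ba]]]] := dsum2 y z hX; exists s, a, b; split.
- by rewrite compDr !compA aa ab comp0m comp1m addr0.
- by rewrite compDr !compA bb ba comp0m comp1m add0r.
- rewrite dagD !dag_comp compDl !compDr.
  rewrite -!compA (compKl _ aa) (compKl _ bb) (compK0l _ ab) (compK0l _ ba).
  by rewrite !compm0 addr0 add0r.
Qed.

Lemma dag_definite_sum2 x y z (f : hom x y) (g : hom x z)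
  (hX : finitely_semisimple X) : f^† ∘ f + g^† ∘ g = 0 -> f = 0 /\ g = 0.
Proof.
have [s [a [b [af bg e]]]] := dag_sum2 hX f g; rewrite -e => /dag_definite z0.
by split; [rewrite -af z0 compm0 | rewrite -bg z0 compm0].
Qed.

End Comp.

(** * Schur's lemma for simple objects *)

Section Simple.
Variables (R : realType) (X : cstar_category R).
Implicit Types x y z : X.

Lemma simple_idm_neq0 x : simple x -> idm x != 0.
Proof. by case=> h _; apply/eqP. Qed.

Lemma scalar_idZ x (c : R[i]) : simple x -> scalar (c *: idm x) = c.
Proof.
move=> hx; rewrite /scalar linearZ /=.
have fr : free [tuple idm x] by rewrite seq1_free simple_idm_neq0.
by have := coord_free ord0 ord0 fr; rewrite /= => ->; rewrite mulr1.
Qed.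

Lemma scalar1 x : simple x -> scalar (idm x) = 1.
Proof. by move=> hx; rewrite -(scalar_idZ 1 hx) scale1r. Qed.

Lemma scalarE x (h : hom x x) : simple x -> h = scalar h *: idm x.
Proof. by move=> hx; have [_ /(_ h)[c ->]] := hx; rewrite scalar_idZ. Qed.

Lemma lin_scalar x : lin (fun h : hom x x => (scalar h : R[i]^o)).
Proof. by move=> k u v; rewrite /scalar linearP. Qed.

Lemma scalar0 x : scalar (0 : hom x x) = 0.
Proof. exact: (lin0 (@lin_scalar x)). Qed.

Lemma scalarZl x k (h : hom x x) : scalar (k *: h) = k * scalar h.
Proof. exact: (linZ (@lin_scalar x)). Qed.

Lemma scalar_sum (I : Type) (s : seq I) (P : pred I) x (F : I -> hom x x) :
  scalar (\sum_(i <- s | P i) F i) = \sum_(i <- s | P i) scalar (F i).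
Proof. exact: (lin_sum (@lin_scalar x)). Qed.

Lemma scalar_comp x (h h' : hom x x) : simple x ->
  scalar (h ∘ h') = scalar h * scalar h'.
Proof.
move=> hx; rewrite {1}(scalarE h hx) {1}(scalarE h' hx).
by rewrite compZl comp1m scalerA scalar_idZ.
Qed.

Lemma scalar_dag x (h : hom x x) : simple x -> scalar h^† = conjc (scalar h).
Proof. by move=> hx; rewrite {1}(scalarE h hx) dagZ dag1 scalar_idZ. Qed.

Lemma scalar_ge0 x y (f : hom x y) : simple x -> 0 <= scalar (f^† ∘ f).
Proof.
move=> hx; have [g ->] := dag_pos f.
by rewrite scalar_comp // scalar_dag // mulrC mulcJ_ge0.
Qed.

Lemma scalar_gt0 x y (f : hom x y) : simple x -> f != 0 -> 0 < scalar (f^† ∘ f).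
Proof.
move=> hx f0; rewrite lt_def scalar_ge0 // andbT; apply: contra f0 => /eqP h.
by apply/eqP/dag_definite; rewrite (scalarE (f^† ∘ f) hx) h scale0r.
Qed.

(** Both f^† f and f f^† are scalars, and comparing the two bracketings of f f^† f shows that they
    are the same one. *)
Lemma simple_hom_iso x y (f : hom x y) : simple x -> simple y -> f != 0 ->
  exists2 c : R[i], 0 < c & f^† ∘ f = c *: idm x /\ f ∘ f^† = c *: idm y.
Proof.
move=> hx hy f0; exists (scalar (f^† ∘ f)); first exact: scalar_gt0.
rewrite -scalarE //; split=> //.
have h1 := scalarE (f^† ∘ f) hx; have h2 := scalarE (f ∘ f^†) hy.
rewrite h2; congr (_ *: _).
have e1 : scalar (f ∘ f^†) *: f = f ∘ (f^† ∘ f).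
  by rewrite compA [in RHS]h2 compZl comp1m.
have e2 : f ∘ (f^† ∘ f) = scalar (f^† ∘ f) *: f.
  by rewrite [in LHS]h1 compZr compm1.
have : (scalar (f ∘ f^†) - scalar (f^† ∘ f)) *: f = 0.
  by rewrite scalerBl e1 e2 subrr.
by move/eqP; rewrite scaler_eq0 (negPf f0) orbF subr_eq0 => /eqP.
Qed.

Lemma simple_hom_isomorphic x y (f : hom x y) : simple x -> simple y -> f != 0 ->
  isomorphic x y.
Proof.
move=> hx hy f0; have [c c0 [h1 h2]] := simple_hom_iso hx hy f0.
have cn : c != 0 by rewrite gt_eqF.
exists f; exists (c^-1 *: f^†); rewrite compZl compZr h1 h2.
by rewrite !scalerA mulVf // !scale1r.
Qed.

(** By [dag_pos], f^† f = g'^† g' with g' an endomorphism of the simple object x, hence a scalar l.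
    Dividing f by l normalizes it without taking a square root. *)
Lemma simple_unitary x y : simple x -> simple y -> isomorphic x y ->
  exists u : hom x y, unitary u.
Proof.
move=> hx hy [f [g [gf fg]]].
have f0 : f != 0.
  by apply: contraNneq (simple_idm_neq0 hx) => f0; rewrite -gf f0 compm0.
have [g' hg'] := dag_pos f.
have [l eg] : exists l, g' = l *: idm x by case: hx => _; apply.
have hl : f^† ∘ f = (conjc l * l) *: idm x.
  by rewrite hg' eg dagZ dag1 compZl compZr comp1m scalerA.
have [c c0 [h1 h2]] := simple_hom_iso hx hy f0.
have cl : c = conjc l * l by rewrite -(scalar_idZ c hx) -h1 hl scalar_idZ.
have ln : l != 0 by apply: contraTneq c0 => l0; rewrite cl l0 mulr0 ltxx.
have ln' : conjc l != 0 by rewrite conjc_eq0.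
exists (l^-1 *: f); rewrite /unitary dagZ conjc_inv. 
rewrite !compZl !compZr h1 h2 cl !scalerA.
have e1 : (conjc l)^-1 * l^-1 * (conjc l * l) = 1.
  by rewrite mulrACA mulVf // mulVf // mulr1.
have e2 : l^-1 * (conjc l)^-1 * (conjc l * l) = 1 by rewrite [l^-1 * _]mulrC e1.
by rewrite e1 e2 !scale1r.
Qed.

End Simple.

(** * Coordinates in dual bases *)

Section DualBases.
Variables (R : realType) (X : cstar_category R) (k y : X) (hk : simple k).
Variable b : dual_bases k y.

Lemma dbas_coordE j (f : hom k y) :
  coord (dbas b) j f = scalar (tnth (dbas' b) j ∘ f).
Proof.
rewrite [in RHS](coord_basis (dbas_basis b) (memvf f)) comp_sumr.
rewrite (bigD1 j) //= big1 => [|i ij]; last first.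
  rewrite -tnth_nth compZr dbas_dual eq_sym (negPf ij).
  by rewrite scale0r scaler0.
by rewrite addr0 -tnth_nth compZr dbas_dual eqxx scale1r scalar_idZ.
Qed.

Lemma dbas'_coordE j (g : hom y k) :
  coord (dbas' b) j g = scalar (g ∘ tnth (dbas b) j).
Proof.
rewrite [in RHS](coord_basis (dbas'_basis b) (memvf g)) comp_suml.
rewrite (bigD1 j) //= big1 => [|i ij]; last first.
  by rewrite -tnth_nth compZl dbas_dual (negPf ij) scale0r scaler0.
by rewrite addr0 -tnth_nth compZl dbas_dual eqxx scale1r scalar_idZ.
Qed.

Lemma dbas_expand (f : hom k y) :
  f = \sum_j scalar (tnth (dbas' b) j ∘ f) *: tnth (dbas b) j.
Proof.
rewrite {1}(coord_basis (dbas_basis b) (memvf f)); apply: eq_bigr => j _.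
by rewrite dbas_coordE -tnth_nth.
Qed.

Lemma dbas'_expand (g : hom y k) :
  g = \sum_j scalar (g ∘ tnth (dbas b) j) *: tnth (dbas' b) j.
Proof.
rewrite {1}(coord_basis (dbas'_basis b) (memvf g)); apply: eq_bigr => j _.
by rewrite dbas'_coordE -tnth_nth.
Qed.

End DualBases.

Definition bilin (R : realType) (X : cstar_category R) (k y : X)
    (V : lmodType R[i]) (B : hom k y -> hom y k -> V) : Prop :=
  (forall g, lin (B^~ g)) /\ (forall f, lin (B f)).

(** * Semisimple categories *)

Section Irr.
Variables (R : realType) (X : cstar_category R) (hX : finitely_semisimple X).
Variables (I : finType) (r : I -> X) (hr : irr_representatives r).
Variable bas : forall k y, dual_bases (r k) y.

Local Notation e k y j := (tnth (dbas (bas k y)) j).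
Local Notation e' k y j := (tnth (dbas' (bas k y)) j).

Lemma irr_simple k : simple (r k).
Proof. by case: hr. Qed.
Hint Resolve irr_simple : core.

Lemma irr_hom0 k l (f : hom (r k) (r l)) : k != l -> f = 0.
Proof.
case: hr => [_ hi _] kl; apply/eqP; apply: contraNT kl => f0.
by apply/eqP/hi; exact: (simple_hom_isomorphic _ _ f0).
Qed.

Lemma irr_decomp (y : X) : exists n (kap : 'I_n -> I)
  (u : forall i, hom (r (kap i)) y),
  [/\ forall i, (u i)^† ∘ u i = idm (r (kap i)),
      forall i j, i != j -> (u i)^† ∘ u j = 0 &
      \sum_i u i ∘ (u i)^† = idm y].
Proof.
case: hX => [_ dec _]; have [n [s [hs [v [v1 v0 vs]]]]] := dec y.
have hk i : exists k, exists w : hom (r k) (s i), unitary w.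
  case: hr => [_ _ /(_ _ (hs i))[k hk]]; exists k.
  have [w [w1 w2]] := simple_unitary (hs i) (irr_simple k) hk.
  by exists w^†; rewrite /unitary dagK.
have [kap hkap] := fin_all_exists hk.
have [w hw] := fin_all_exists hkap.
exists n, kap, (fun i => v i ∘ w i); split.
- move=> i; have [w1 w2] := hw i.
  by rewrite dag_comp -compA (compKl _ (v1 i)).
- move=> i j ij.
  by rewrite dag_comp -compA (compK0l _ (v0 i j ij)) compm0.
- rewrite -vs; apply: eq_bigr => i _; have [w1 w2] := hw i.
  by rewrite dag_comp -compA (compKl _ w2).
Qed.

(** Duality of the bases shows that the sum E fixes every basis element, hence every map from a
    simple object into y, hence the isometries of an orthogonal decomposition of y, whose ranges
    exhaust y. *)
Lemma irr_complete y : \sum_k \sum_j e k y j ∘ e' k y j = idm y.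
Proof.
have [n [kap [u [_ _ us]]]] := irr_decomp y.
set E := LHS.
have Ee k j : E ∘ e k y j = e k y j.
  rewrite /E comp_suml (bigD1 k) //= [X in _ + X]big1 => [|l lk]; last first.
    rewrite comp_suml big1 // => i _.
    by rewrite -compA (irr_hom0 (e' l y i ∘ _)) ?compm0 // eq_sym.
  rewrite addr0 comp_suml (bigD1 j) //= big1 => [|i ij].
    by rewrite -compA dbas_dual eqxx scale1r compm1 addr0.
  by rewrite -compA dbas_dual (negPf ij) scale0r compm0.
rewrite -(compm1 E) -us comp_sumr; apply: eq_bigr => i _.
rewrite compA; congr (_ ∘ _).
rewrite (dbas_expand (irr_simple _) (bas (kap i) y) (u i)) comp_sumr.
by apply: eq_bigr => j _; rewrite compZr Ee.
Qed.

Section Canonical.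
Variable V : lmodType R[i].

(* The canonical element of ⊕_k Hom(k, y) ⊗ Hom(y, k), evaluated on a bilinear
   family. *)
Definition can (y : X) (B : forall k, hom (r k) y -> hom y (r k) -> V) : V :=
  \sum_k \sum_j B k (e k y j) (e' k y j).

Lemma eq_can y (B B' : forall k, hom (r k) y -> hom y (r k) -> V) :
  (forall k f g, B k f g = B' k f g) -> can B = can B'.
Proof. by move=> h; do 2!apply: eq_bigr => ? _. Qed.

(** A map between representatives is zero or a scalar, so it slides from one argument to the other.
    This is the relation of the tensor product over the category of simple objects. *)
Lemma bilin_balanced y (B : forall k, hom (r k) y -> hom y (r k) -> V) k l
  (f : hom (r k) y) (h : hom (r l) (r k)) (g : hom y (r l)) :
  (forall k, bilin (B k)) -> B k f (h ∘ g) = B l (f ∘ h) g.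
Proof.
move=> hB; have [lk | lk] := eqVneq l k; last first.
  rewrite (irr_hom0 h lk) comp0m compm0.
  by rewrite (lin0 ((hB k).2 f)) (lin0 ((hB l).1 g)).
subst l; rewrite (scalarE h (irr_simple k)) compZl compZr comp1m compm1.
by rewrite (linZ ((hB k).2 f)) (linZ ((hB k).1 g)).
Qed.

(** Inserting Σ a_s a'_s and then the completeness relation of each z_s into the second argument
    gives a fivefold sum; balancing moves the middle factor to the first argument, where
    completeness of y removes the original bases. *)
Lemma can_change (S : finType) y (z : S -> X) (a : forall s, hom (z s) y)
  (a' : forall s, hom y (z s)) (B : forall k, hom (r k) y -> hom y (r k) -> V) :
  (forall k, bilin (B k)) -> \sum_s a s ∘ a' s = idm y ->
  can B = \sum_s can (fun k f g => B k (a s ∘ f) (g ∘ a' s)).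
Proof.
move=> hB ha.
transitivity (\sum_s \sum_l \sum_i \sum_k \sum_j
   B k (e k y j) (e' k y j ∘ a s ∘ e l (z s) i ∘ (e' l (z s) i ∘ a' s))).
  transitivity (\sum_k \sum_j \sum_s \sum_l \sum_i
     B k (e k y j) (e' k y j ∘ a s ∘ e l (z s) i ∘ (e' l (z s) i ∘ a' s))).
    apply: eq_bigr => k _; apply: eq_bigr => j _.
    rewrite -{1}(compm1 (e' k y j)) -ha comp_sumr (lin_sum ((hB k).2 _)).
    apply: eq_bigr => s _.
    rewrite compA -{1}(compm1 (e' k y j ∘ a s)) -(irr_complete (z s)).
    rewrite comp_sumr comp_suml (lin_sum ((hB k).2 _)); apply: eq_bigr => l _.
    rewrite comp_sumr comp_suml (lin_sum ((hB k).2 _)); apply: eq_bigr => i _.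
    by rewrite !compA.
  transitivity (\sum_k \sum_s \sum_j \sum_l \sum_i
     B k (e k y j) (e' k y j ∘ a s ∘ e l (z s) i ∘ (e' l (z s) i ∘ a' s))).
    by apply: eq_bigr => k _; rewrite exchange_big.
  rewrite exchange_big /=; apply: eq_bigr => s _.
  transitivity (\sum_k \sum_l \sum_j \sum_i
     B k (e k y j) (e' k y j ∘ a s ∘ e l (z s) i ∘ (e' l (z s) i ∘ a' s))).
    by apply: eq_bigr => k _; rewrite exchange_big.
  rewrite exchange_big /=; apply: eq_bigr => l _.
  transitivity (\sum_k \sum_i \sum_j
     B k (e k y j) (e' k y j ∘ a s ∘ e l (z s) i ∘ (e' l (z s) i ∘ a' s))).
    by apply: eq_bigr => k _; rewrite exchange_big.
  by rewrite exchange_big.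
apply: eq_bigr => s _; apply: eq_bigr => l _; apply: eq_bigr => i _.
rewrite -[in RHS](comp1m (a s)) -[in RHS](irr_complete y) -[in RHS]compA [in RHS]comp_suml.
rewrite (lin_sum ((hB l).1 _)); apply: eq_bigr => k _.
rewrite comp_suml (lin_sum ((hB l).1 _)); apply: eq_bigr => j _.
by rewrite bilin_balanced // -!compA.
Qed.

Lemma can_rep k (B : forall l, hom (r l) (r k) -> hom (r k) (r l) -> V) :
  (forall l, bilin (B l)) -> can B = B k (idm _) (idm _).
Proof.
move=> hB; rewrite -{1}(irr_complete (r k)) (lin_sum ((hB k).1 _)).
apply: eq_bigr => l _; rewrite (lin_sum ((hB k).1 _)); apply: eq_bigr => j _.
by rewrite -bilin_balanced // compm1.
Qed.

Lemma can_iso y y' (a : hom y' y) (a' : hom y y')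
  (B : forall k, hom (r k) y -> hom y (r k) -> V) :
  (forall k, bilin (B k)) -> a ∘ a' = idm y ->
  can B = can (fun k f g => B k (a ∘ f) (g ∘ a')).
Proof.
move=> hB h.
have := @can_change unit y (fun _ => y') (fun _ => a) (fun _ => a') B hB.
by rewrite !big_const !card_unit /= !addr0 => ->.
Qed.

(** Basis independence: the chosen dual bases may be traded for any resolution of the identity
    through simple objects, in particular an orthonormal one. *)
Lemma can_family (S : finType) y (kap : S -> I) (a : forall s, hom (r (kap s)) y)
  (a' : forall s, hom y (r (kap s))) (B : forall k, hom (r k) y -> hom y (r k) -> V) :
  (forall k, bilin (B k)) -> \sum_s a s ∘ a' s = idm y ->
  can B = \sum_s B (kap s) (a s) (a' s).
Proof.
move=> hB ha; rewrite (can_change hB ha); apply: eq_bigr => s _.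
rewrite (can_rep (k := kap s)) ?compm1 ?comp1m // => l; split.
  by move=> g; apply: lin_comp ((hB l).1 _) (lin_compr _).
by move=> f; apply: lin_comp ((hB l).2 _) (lin_compl _).
Qed.

End Canonical.

Lemma can_lin (V W : lmodType R[i]) (F : V -> W) y
  (B : forall k, hom (r k) y -> hom y (r k) -> V) :
  lin F -> F (can B) = can (fun k f g => F (B k f g)).
Proof.
move=> hF; rewrite /can (lin_sum hF); apply: eq_bigr => k _.
by rewrite (lin_sum hF).
Qed.

Definition homdim k y : nat := mult (bas k y).

(* Orthonormal bases of the Hom(k, y), each padded with zeros to length n. *)
Lemma irr_orthonormal (y : X) : exists n (E : forall k, 'I_n -> hom (r k) y),
  [/\ forall k i j, i != j -> (E k i)^† ∘ E k j = 0,
      \sum_k \sum_i E k i ∘ (E k i)^† = idm y &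
      forall k, \sum_i scalar ((E k i)^† ∘ E k i) = (homdim k y)%:R].
Proof.
have [n [kap [u [u1 u0 us]]]] := irr_decomp y.
have [E hE] : exists E : forall k, 'I_n -> hom (r k) y,
    forall k i, (kap i != k -> E k i = 0) /\
      (forall ek : kap i = k, E k i = eq_rect _ (fun k => hom (r k) y) (u i) k ek).
  exists (fun k i => match kap i =P k with
    | ReflectT ek => eq_rect _ (fun k => hom (r k) y) (u i) k ek
    | ReflectF _ => 0 end) => k i.
  case: eqP => [ek|nk]; last by split=> // ek; case: nk.
  split=> [/eqP //|ek']; by rewrite (eq_irrelevance ek' ek).
have Ek i : E (kap i) i = u i by have [_ /(_ erefl)] := hE (kap i) i.
have Es : \sum_k \sum_i E k i ∘ (E k i)^† = idm y.
  rewrite exchange_big -us; apply: eq_bigr => i _.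
  rewrite (bigD1 (kap i)) //= big1 ?addr0 ?Ek // => k kk.
  by rewrite (hE k i).1 ?comp0m // eq_sym.
exists n, E; split=> //.
- move=> k i j ij.
  have [ik|ik] := eqVneq (kap i) k; last by rewrite (hE k i).1 // dag0 comp0m.
  subst k; rewrite Ek.
  have [jk|jk] := eqVneq (kap j) (kap i); last by rewrite (hE _ j).1 // compm0.
  rewrite ((hE _ j).2 jk).
  have u0ij := u0 i j ij; move: {u0 Ek} (u i)^† u0ij => f.
  by move: f; case: _ / jk.
- move=> k.
  (* The trace form on the component of k: the dual bases evaluate it to their number, the
     orthonormal family to the sum of its squared norms. *)
  pose B l (f : hom (r l) y) (g : hom y (r l)) : R[i]^o :=
    if l == k then scalar (g ∘ f) else 0.
  have hB l : bilin (B l).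
    split=> [g|f]; rewrite /B; case: (l == k); try exact: lin_zero.
      exact: lin_comp (@lin_scalar _ _ _) (lin_compr _).
    exact: lin_comp (@lin_scalar _ _ _) (lin_compl _).
  transitivity (can B); last first.
    rewrite /can (bigD1 k) //= [X in _ + X]big1 ?addr0 => [|l lk]; last first.
      by rewrite big1 // /B (negPf lk).
    rewrite (eq_bigr (fun _ => 1)); last first.
      by move=> j _; rewrite /B eqxx dbas_dual eqxx scalar_idZ.
    by rewrite sumr_const card_ord.
  rewrite (can_family (S := 'I_n) hB (a := u) (a' := fun i => (u i)^†)) //.
  apply: eq_bigr => i _; rewrite /B u1.
  have [ik|ik] := eqVneq (kap i) k; first by subst k; rewrite Ek u1.
  by rewrite (hE k i).1 // compm0 scalar0.
Qed.

Lemma scalar_sum_insert k y (g : hom y (r k)) (f : hom (r k) y) :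
  scalar (g ∘ f) = \sum_j scalar (g ∘ e k y j) * scalar (e' k y j ∘ f).
Proof.
rewrite [in LHS](dbas_expand (irr_simple k) (bas k y) f) comp_sumr scalar_sum.
by apply: eq_bigr => j _; rewrite compZr scalarZl mulrC.
Qed.

End Irr.

(** Lets an equation between short composites be rewritten inside a longer chain that is bracketed
    to the right. *)
Lemma comp_tail (R : realType) (X : cstar_category R) (x y z : X)
  (g : hom y z) (f : hom x y) (k : hom x z) :
  g ∘ f = k -> forall w (u : hom w x), g ∘ (f ∘ u) = k ∘ u.
Proof. by move=> <- w u; rewrite compA. Qed.

Lemma comp_tail2 (R : realType) (X : cstar_category R) (x y z t : X)
  (h : hom z t) (g : hom y z) (f : hom x y) (k : hom x t) :
  h ∘ g ∘ f = k -> forall w (u : hom w x), h ∘ (g ∘ (f ∘ u)) = k ∘ u.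
Proof. by move=> <- w u; rewrite !compA. Qed.

Section Monoidal.
Variables (R : realType) (C : monoidal_category R).
Implicit Types x y z : C.

Lemma tensm1 x y : idm x ⊗m idm y = idm (x ⊗ y).
Proof. exact: bif_id (tens_bif C) _ _. Qed.

Lemma tensm_dag x x' y y' (f : hom x x') (g : hom y y') :
  (f ⊗m g)^† = f^† ⊗m g^†.
Proof. exact: bif_dag (tens_bif C) _ _ _ _ _ _. Qed.

End Monoidal.

(** * Coherence in bimodule categories *)

Section Coherence.
Variables (R : realType) (C D : monoidal_category R) (M : bimodule_category C D).
Implicit Types (a : C) (b : D) (m n : M).

Lemma lactm1 a m : lactm (idm a) (idm m) = idm (lact a m).
Proof. exact: bif_id (lact_bif M) _ _. Qed.

Lemma lactmE a a' a'' m m' m'' (f' : hom a' a'') (f : hom a a')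
  (h' : hom m' m'') (h : hom m m') :
  lactm f' h' ∘ lactm f h = lactm (f' ∘ f) (h' ∘ h).
Proof. by rewrite (bif_comp (lact_bif M)). Qed.

Lemma lactm_dag a a' m m' (f : hom a a') (h : hom m m') :
  (lactm f h)^† = lactm f^† h^†.
Proof. exact: bif_dag (lact_bif M) _ _ _ _ _ _. Qed.

Lemma ractm1 m b : ractm (idm m) (idm b) = idm (ract m b).
Proof. exact: bif_id (ract_bif M) _ _. Qed.

Lemma ractmE m m' m'' b b' b'' (h' : hom m' m'') (h : hom m m')
  (g' : hom b' b'') (g : hom b b') :
  ractm h' g' ∘ ractm h g = ractm (h' ∘ h) (g' ∘ g).
Proof. by rewrite (bif_comp (ract_bif M)). Qed.

Lemma ractm_dag m m' b b' (h : hom m m') (g : hom b b') :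
  (ractm h g)^† = ractm h^† g^†.
Proof. exact: bif_dag (ract_bif M) _ _ _ _ _ _. Qed.

Lemma actmE a a' a'' m m' m'' b b' b'' (f' : hom a' a'') (f : hom a a')
  (h' : hom m' m'') (h : hom m m') (g' : hom b' b'') (g : hom b b') :
  actm f' h' g' ∘ actm f h g = actm (f' ∘ f) (h' ∘ h) (g' ∘ g).
Proof. by rewrite /actm ractmE lactmE. Qed.

Lemma actm1 a m b : actm (idm a) (idm m) (idm b) = idm (act a m b).
Proof. by rewrite /actm lactm1 ractm1. Qed.

Lemma actm_dag a a' m m' b b' (f : hom a a') (h : hom m m') (g : hom b b') :
  (actm f h g)^† = actm f^† h^† g^†.
Proof. by rewrite /actm ractm_dag lactm_dag. Qed.

Lemma lin_actm1 a a' m m' b b' (h : hom m m') (g : hom b b') :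
  lin (fun f : hom a a' => actm f h g).
Proof. by move=> k f f'; rewrite /actm (bif_linearl (lact_bif M)) (bif_linearl (ract_bif M)). Qed.

Lemma lin_actm2 a a' m m' b b' (f : hom a a') (g : hom b b') :
  lin (fun h : hom m m' => actm f h g).
Proof. by move=> k h h'; rewrite /actm (bif_linearr (lact_bif M)) (bif_linearl (ract_bif M)). Qed.

Lemma lin_actm3 a a' m m' b b' (f : hom a a') (h : hom m m') :
  lin (fun g : hom b b' => actm f h g).
Proof. by move=> k g g'; rewrite /actm (bif_linearr (ract_bif M)). Qed.

Lemma unitary1 (X : cstar_category R) (x : X) : unitary (idm x).
Proof. by split; rewrite dag1 comp1m. Qed.

Lemma unitary_comp (X : cstar_category R) (x y z : X) (g : hom y z) (f : hom x y) :
  unitary g -> unitary f -> unitary (g ∘ f).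
Proof.
move=> [g1 g2] [f1 f2]; split; rewrite dag_comp -compA.
  by rewrite (compKl _ g1).
by rewrite (compKl _ f2).
Qed.

Lemma unitary_dag (X : cstar_category R) (x y : X) (f : hom x y) :
  unitary f -> unitary f^†.
Proof. by case=> f1 f2; split; rewrite dagK. Qed.

Lemma unitary_lactm a a' m m' (f : hom a a') (h : hom m m') :
  unitary f -> unitary h -> unitary (lactm f h).
Proof. by move=> [f1 f2] [h1 h2]; split; rewrite lactm_dag lactmE ?f1 ?h1 ?f2 ?h2 lactm1. Qed.

Lemma unitary_ractm m m' b b' (h : hom m m') (g : hom b b') :
  unitary h -> unitary g -> unitary (ractm h g).
Proof. by move=> [f1 f2] [h1 h2]; split; rewrite ractm_dag ractmE ?f1 ?h1 ?f2 ?h2 ractm1. Qed.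

Lemma act_assoc_unitary a a' m b' b : unitary (act_assoc a a' m b' b).
Proof.
apply: unitary_comp; last first.
  by apply: unitary_ractm; [exact: lassoc_unitary|exact: unitary1].
apply: unitary_comp; last by apply: unitary_dag; exact: rassoc_unitary.
by apply: unitary_ractm; [exact: bassoc_unitary|exact: unitary1].
Qed.

Lemma act_unit_unitary m : unitary (act_unit m).
Proof. by apply: unitary_comp; [exact: lunit_unitary|exact: runit_unitary]. Qed.

Lemma unitary_nat_dag (X : cstar_category R) (x x' y y' : X) (u : hom x y) (u' : hom x' y')
  (f : hom x x') (g : hom y y') :
  unitary u -> unitary u' -> u' ∘ f = g ∘ u -> u'^† ∘ g = f ∘ u^†.
Proof.
move=> [u1 u2] [v1 v2] h.
by rewrite -[LHS](compKr _ u2) -!compA (compA g u) -h -!compA (compKl _ v1).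
Qed.

Lemma act_unit_nat m1 m2 (h : hom m1 m2) :
  act_unit m2 ∘ actm (idm _) h (idm _) = h ∘ act_unit m1.
Proof. by rewrite /act_unit /actm -compA runit_nat compA lunit_nat compA. Qed.

Lemma act_unit_nat_dag m1 m2 (h : hom m1 m2) :
  (act_unit m2)^† ∘ h = actm (idm _) h (idm _) ∘ (act_unit m1)^†.
Proof.
apply: unitary_nat_dag; try exact: act_unit_unitary.
exact: act_unit_nat.
Qed.

Lemma rassoc_nat_dag m1 m2 b1 b2 b1' b2'
    (h : hom m1 m2) (g : hom b1 b2) (g' : hom b1' b2') :
  (rassoc m2 b2 b2')^† ∘ ractm h (g ⊗m g')
    = ractm (ractm h g) g' ∘ (rassoc m1 b1 b1')^†.
Proof.
apply: unitary_nat_dag; try exact: rassoc_unitary.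
exact: rassoc_nat.
Qed.

Lemma act_assoc_nat a1 a2 a1' a2' m1 m2 b1 b2 b1' b2' (f : hom a1 a2)
  (f' : hom a1' a2') (h : hom m1 m2) (g' : hom b1' b2') (g : hom b1 b2) :
  act_assoc a2 a2' m2 b2' b2 ∘ actm (f ⊗m f') h (g' ⊗m g)
  = actm f (actm f' h g') g ∘ act_assoc a1 a1' m1 b1' b1.
Proof.
rewrite /act_assoc /actm -!compA ractmE comp1m lassoc_nat.
rewrite -(compm1 (g' ⊗m g)) -ractmE.
rewrite (comp_tail (rassoc_nat_dag _ _ _)) -!compA.
rewrite (comp_tail (ractmE _ _ _ _)) comp1m bassoc_nat.
rewrite -[X in ractm _ X ∘ _](compm1 g) -ractmE -!compA.
by [].
Qed.

Lemma act_assoc_nat_dag a1 a2 a1' a2' m1 m2 b1 b2 b1' b2' (f : hom a1 a2)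
  (f' : hom a1' a2') (h : hom m1 m2) (g' : hom b1' b2') (g : hom b1 b2) :
  (act_assoc a2 a2' m2 b2' b2)^† ∘ actm f (actm f' h g') g
  = actm (f ⊗m f') h (g' ⊗m g) ∘ (act_assoc a1 a1' m1 b1' b1)^†.
Proof.
apply: unitary_nat_dag; try exact: act_assoc_unitary.
exact: act_assoc_nat.
Qed.

Lemma ractm_split m m' b b' (h : hom m m') (g : hom b b') :
  ractm h g = ractm h (idm b') ∘ ractm (idm m) g.
Proof. by rewrite ractmE compm1 comp1m. Qed.

(** The share of the right strands in the pentagon below: [bpentagonr] carries the left factor past
    b'' ⊗ b', and the dagger of [rpentagon] rebrackets. Daggers appear because [act_assoc] splits
    the tensor product on the right-hand side. *)
Lemma act_pentagon_right a n b'' b' b :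
  ractm (lactm (idm a) (rassoc n b'' b')^†) (idm b)
    ∘ ractm (bassoc a n (b'' ⊗ b')) (idm b)
    ∘ (rassoc (lact a n) (b'' ⊗ b') b)^†
    ∘ ractm (idm (lact a n)) (massoc b'' b' b)^†
  = ractm (bassoc a (ract n b'') b') (idm b)
    ∘ (rassoc (lact a (ract n b'')) b' b)^†
    ∘ ractm (bassoc a n b'') (idm (b' ⊗ b))
    ∘ (rassoc (lact a n) b'' (b' ⊗ b))^†.
Proof.
have [r1 r2] := rassoc_unitary n b'' b'.
have [s1 s2] := rassoc_unitary (lact a n) b'' b'.
have [t1 t2] := rassoc_unitary (ract (lact a n) b'') b' b.
have [q1 q2] := rassoc_unitary (lact a n) b'' (b' ⊗ b).
have e1 : lactm (idm a) (rassoc n b'' b')^† ∘ bassoc a n (b'' ⊗ b')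
   = bassoc a (ract n b'') b' ∘ ractm (bassoc a n b'') (idm b')
     ∘ (rassoc (lact a n) b'' b')^†.
  rewrite -[RHS]comp1m -lactm1 -r1 -(comp1m (idm a)) -lactmE -!compA.
  by rewrite (comp_tail2 (bpentagonr a n b'' b')) -!compA s2 !compm1.
rewrite ractmE comp1m e1.
rewrite -(comp1m (idm b)) -ractmE -(comp1m (idm b)) -ractmE -!compA !comp1m.
congr (_ ∘ _).
rewrite -tensm1 (comp_tail (rassoc_nat_dag _ _ _)) -!compA.
congr (_ ∘ _).
have [u1 u2] := massoc_unitary b'' b' b.
have := congr1 (fun f => f^†) (rpentagon (lact a n) b'' b' b).
rewrite !dag_comp !ractm_dag !dag1 => <-.
by [].
Qed.

(** Right strands nest in the opposite order, hence the inverse associator of D. With [lpentagon]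
    and naturality both sides begin with the same left associators; once these are stripped,
    [act_pentagon_right] remains. *)
Lemma act_pentagon a a' a'' m b'' b' b :
  actm (idm a) (act_assoc a' a'' m b'' b') (idm b)
    ∘ act_assoc a (a' ⊗ a'') m (b'' ⊗ b') b
    ∘ actm (massoc a a' a'') (idm m) (massoc b'' b' b)^†
  = act_assoc a a' (act a'' m b'') b' b
    ∘ act_assoc (a ⊗ a') a'' m b'' (b' ⊗ b).
Proof.
pose X := lact a (lact a' (lact a'' m)).
have rhsE : act_assoc a a' (act a'' m b'') b' b ∘ act_assoc (a ⊗ a') a'' m b'' (b' ⊗ b)
  = ractm (bassoc a (lact a' (act a'' m b'')) b') (idm b)
    ∘ (rassoc (lact a (lact a' (act a'' m b''))) b' b)^†
    ∘ ractm (lactm (idm a) (bassoc a' (lact a'' m) b'')) (idm (b' ⊗ b))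
    ∘ ractm (bassoc a (lact a' (lact a'' m)) b'') (idm (b' ⊗ b))
    ∘ (rassoc X b'' (b' ⊗ b))^†
    ∘ ractm (lactm (idm a) (lassoc a' a'' m)) (idm (b'' ⊗ b' ⊗ b))
    ∘ ractm (lassoc a (a' ⊗ a'') m ∘ lactm (massoc a a' a'') (idm m))
        (idm (b'' ⊗ b' ⊗ b)).
  rewrite /act_assoc -!compA.
  rewrite (comp_tail (ractmE _ (bassoc (a ⊗ a') (lact a'' m) b'') _ _)) comp1m.
  rewrite -(bpentagonl a a' (lact a'' m) b'').
  do 2![rewrite -(comp1m (idm (b' ⊗ b))) -ractmE comp1m] => //.
  rewrite -!compA.
  rewrite (comp_tail (esym (rassoc_nat_dag _ _ _))) -!compA tensm1 !ractmE.
  by rewrite -lpentagon !comp1m -!compA.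
rewrite rhsE {rhsE}.
have lhsE : act_assoc a (a' ⊗ a'') m (b'' ⊗ b') b
    ∘ actm (massoc a a' a'') (idm m) (massoc b'' b' b)^†
  = ractm (bassoc a (lact (a' ⊗ a'') m) (b'' ⊗ b')) (idm b)
    ∘ (rassoc (lact a (lact (a' ⊗ a'') m)) (b'' ⊗ b') b)^†
    ∘ ractm (idm _) (massoc b'' b' b)^†
    ∘ ractm (lassoc a (a' ⊗ a'') m ∘ lactm (massoc a a' a'') (idm m))
        (idm (b'' ⊗ b' ⊗ b)).
  by rewrite /act_assoc /actm -!compA !ractmE !comp1m !compm1.
rewrite -compA lhsE {lhsE} compA; congr (_ ∘ _).
pose n := lact a' (lact a'' m).
transitivity (ractm (lactm (idm a) (ractm (bassoc a' (lact a'' m) b'') (idm b'))) (idm b)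
  ∘ (ractm (lactm (idm a) (rassoc n b'' b')^†) (idm b)
    ∘ ractm (bassoc a n (b'' ⊗ b')) (idm b)
    ∘ (rassoc (lact a n) (b'' ⊗ b') b)^†
    ∘ ractm (idm (lact a n)) (massoc b'' b' b)^†)
  ∘ ractm (lactm (idm a) (lassoc a' a'' m)) (idm (b'' ⊗ b' ⊗ b))).
  rewrite /actm /act_assoc -!compA.
  rewrite ractmE comp1m compm1 [in RHS](ractm_split _ (massoc _ _ _)^†) -(tensm1 (b'' ⊗ b') b).
  rewrite (comp_tail (rassoc_nat_dag (lactm _ _) _ _)) -!compA.
  rewrite !(comp_tail (ractmE _ _ _ _)) !comp1m bassoc_nat.
  by rewrite [in RHS](compA _ _ (bassoc _ _ _)) !lactmE !comp1m -!compA.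
rewrite act_pentagon_right -!compA.
rewrite (comp_tail (ractmE _ _ _ _)) comp1m -bassoc_nat.
rewrite -{1}(comp1m (idm b)) -ractmE -!compA.
by rewrite (comp_tail (esym (rassoc_nat_dag _ _ _))) tensm1 -!compA.
Qed.

Lemma unitary_cancel_l (X : cstar_category R) (x y z : X) (u : hom y z) (f g : hom x y) :
  unitary u -> u ∘ f = u ∘ g -> f = g.
Proof. by case=> u1 _ h; rewrite -(compKl f u1) h (compKl _ u1). Qed.

Lemma unitary_cancel_r (X : cstar_category R) (x y z : X) (u : hom x y) (f g : hom y z) :
  unitary u -> f ∘ u = g ∘ u -> f = g.
Proof. by case=> _ u2 h; rewrite -(compKr f u2) h (compKr _ u2). Qed.

(* Kelly's unit laws, which the axioms of a bimodule category leave implicit. *)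
Lemma lunit_lassoc a m :
  lunit (lact a m) ∘ lassoc (munit C) a m = lactm (mlunit a) (idm m).
Proof.
set f := LHS; set g := RHS.
suff h : lactm (idm (munit C)) f = lactm (idm (munit C)) g.
  apply: (unitary_cancel_r (lunit_unitary _)); by rewrite -!lunit_nat h.
apply: (@unitary_cancel_r _ _ _ _ (lassoc (munit C) (munit C ⊗ a) m
  ∘ lactm (massoc (munit C) (munit C) a) (idm m))).
  apply: unitary_comp; first exact: lassoc_unitary.
  by apply: unitary_lactm; [exact: massoc_unitary|exact: unitary1].
rewrite {}/f {}/g -{1}(comp1m (idm (munit C))) -lactmE -!compA.
rewrite (compA (lactm _ (lassoc _ _ _))) lpentagon compA ltriangle.
rewrite -lactm1 -lassoc_nat -mtriangle compA -lassoc_nat -!compA.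
by rewrite lactmE comp1m.
Qed.

Lemma runit_ract m b :
  runit (ract m b) = ractm (idm m) (mrunit b) ∘ rassoc m b (munit D).
Proof.
set f := LHS; set g := RHS.
suff h : ractm f (idm (munit D)) = ractm g (idm (munit D)).
  apply: (unitary_cancel_r (runit_unitary _)); by rewrite -!runit_nat h.
apply: (unitary_cancel_l (rassoc_unitary m b (munit D))).
rewrite {}/f {}/g -rtriangle -(comp1m (idm (munit D))) -ractmE !compA.
rewrite -ractm1 !rassoc_nat -mtriangle -{2}(comp1m (idm m)) -ractmE -!compA.
by rewrite (compA (ractm (idm m) (massoc _ _ _))) rpentagon.
Qed.

Lemma act_assoc_unit a m b :
  actm (idm a) (act_unit m) (idm b) ∘ act_assoc a (munit C) m (munit D) b
  = actm (mrunit a) (idm m) (mlunit b).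
Proof.
rewrite /actm /act_assoc /act_unit -!compA (comp_tail (ractmE _ _ _ _)) comp1m.
rewrite -{1}(comp1m (idm a)) -lactmE -compA btriangler.
rewrite -(comp1m (idm b)) -ractmE -rtriangle -!compA.
have [_ r2] := rassoc_unitary (lact a (lact (munit C) m)) (munit D) b.
rewrite (compKl _ r2) !ractmE. by rewrite compm1 !comp1m ltriangle.
Qed.

Lemma act_unit_assoc a m b :
  act_unit (act a m b) ∘ act_assoc (munit C) a m b (munit D)
  = actm (mlunit a) (idm m) (mrunit b).
Proof.
rewrite /actm /act_assoc /act_unit -!compA (comp_tail (runit_nat _)) -!compA.
rewrite (comp_tail (btrianglel _ _)) runit_ract -!compA.
have [_ r2] := rassoc_unitary (lact (munit C) (lact a m)) b (munit D).
by rewrite (compKl _ r2) !ractmE !comp1m compm1 lunit_lassoc.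
Qed.

(* Locked copies: unification would otherwise unfold these composites when
   reassociating. *)
Definition assoc3 a a' m b' b := locked (act_assoc a a' m b' b).
Definition unit3 m := locked (act_unit m).

Lemma assoc3E a a' m b' b : act_assoc a a' m b' b = assoc3 a a' m b' b.
Proof. by rewrite /assoc3 -lock. Qed.

Lemma unit3E m : act_unit m = unit3 m.
Proof. by rewrite /unit3 -lock. Qed.

Lemma assoc3_unitary a a' m b' b : unitary (assoc3 a a' m b' b).
Proof. rewrite -assoc3E; exact: act_assoc_unitary. Qed.

Lemma unit3_unitary m : unitary (unit3 m).
Proof. rewrite -unit3E; exact: act_unit_unitary. Qed.

Lemma unit3_nat m1 m2 (h : hom m1 m2) :
  unit3 m2 ∘ actm (idm _) h (idm _) = h ∘ unit3 m1.
Proof. by rewrite -!unit3E act_unit_nat. Qed.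

Lemma unit3_nat_dag m1 m2 (h : hom m1 m2) :
  (unit3 m2)^† ∘ h = actm (idm _) h (idm _) ∘ (unit3 m1)^†.
Proof. by rewrite -!unit3E act_unit_nat_dag. Qed.

Lemma assoc3_nat a1 a2 a1' a2' m1 m2 b1 b2 b1' b2' (f : hom a1 a2)
  (f' : hom a1' a2') (h : hom m1 m2) (g' : hom b1' b2') (g : hom b1 b2) :
  assoc3 a2 a2' m2 b2' b2 ∘ actm (f ⊗m f') h (g' ⊗m g)
  = actm f (actm f' h g') g ∘ assoc3 a1 a1' m1 b1' b1.
Proof. by rewrite -!assoc3E act_assoc_nat. Qed.

Lemma assoc3_nat_dag a1 a2 a1' a2' m1 m2 b1 b2 b1' b2' (f : hom a1 a2)
  (f' : hom a1' a2') (h : hom m1 m2) (g' : hom b1' b2') (g : hom b1 b2) :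
  (assoc3 a2 a2' m2 b2' b2)^† ∘ actm f (actm f' h g') g
  = actm (f ⊗m f') h (g' ⊗m g) ∘ (assoc3 a1 a1' m1 b1' b1)^†.
Proof. by rewrite -!assoc3E act_assoc_nat_dag. Qed.

(* The unit of the adjunction between a ⊗ - ⊗ b and a' ⊗ - ⊗ b'. *)
Definition coev a a' b b' (r : hom (munit C) (a' ⊗ a)) (s : hom (munit D) (b ⊗ b')) m :
    hom m (act a' (act a m b) b') :=
  assoc3 a' a m b b' ∘ actm r (idm m) s ∘ (unit3 m)^†.

Lemma coev_nat a a' b b' (r : hom (munit C) (a' ⊗ a)) (s : hom (munit D) (b ⊗ b'))
  m n (h : hom m n) :
  actm (idm a') (actm (idm a) h (idm b)) (idm b') ∘ coev r s m = coev r s n ∘ h.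
Proof.
rewrite /coev -!compA unit3_nat_dag !compA -assoc3_nat -!compA.
by congr (_ ∘ _); rewrite !compA !actmE !tensm1 ?compm1 ?comp1m.
Qed.

Lemma coev_norm a a' b b' (r : hom (munit C) (a' ⊗ a)) (s : hom (munit D) (b ⊗ b'))
  m (c c' : R[i]) : r^† ∘ r = c *: idm _ -> s^† ∘ s = c' *: idm _ ->
  (coev r s m)^† ∘ coev r s m = (c * c') *: idm m.
Proof.
move=> hr hs; rewrite /coev !dag_comp dagK actm_dag dag1 -!compA.
have [a1 _] := assoc3_unitary a' a m b b'.
rewrite (compKl _ a1) (comp_tail (actmE _ _ _ _ _ _)) hr hs comp1m.
rewrite (linZ (lin_actm1 _ _)) (linZ (lin_actm3 _ _)) actm1 scalerA.
have [_ u2] := unit3_unitary m.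
by rewrite compZl comp1m compZr u2.
Qed.

(** The pentagon and the unit laws gather both sides of m into single maps a → a2 and b → b2, each a
    snake. Allowing a2 and b2 to differ from a and b is what later shows that cups pair a simple
    object only with its dual. *)
Lemma coev_rot a a' a2 b b' b2 (r : hom (munit C) (a' ⊗ a2)) (s : hom (munit D) (b2 ⊗ b'))
  (r' : hom (munit C) (a ⊗ a')) (s' : hom (munit D) (b' ⊗ b)) m :
  (coev r' s' (act a2 m b2))^† ∘ actm (idm a) (coev r s m) (idm b)
  = actm (mlunit a2 ∘ (r'^† ⊗m idm a2) ∘ (massoc a a' a2)^† ∘ (idm a ⊗m r) ∘ (mrunit a)^†)
      (idm m)
      (mrunit b2 ∘ (idm b2 ⊗m s'^†) ∘ massoc b2 b' b ∘ (s ⊗m idm b) ∘ (mlunit b)^†).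
Proof.
rewrite /coev !dag_comp dagK actm_dag dag1.
have pent0 := act_pentagon a a' a2 m b2 b' b.
have unit0 := act_assoc_unit a m b.
have unit1 := act_unit_assoc a2 m b2.
rewrite !assoc3E ?unit3E in pent0 unit0 unit1.
have pent : (assoc3 a a' (act a2 m b2) b' b)^†
    ∘ actm (idm a) (assoc3 a' a2 m b2 b') (idm b)
  = assoc3 (a ⊗ a') a2 m b2 (b' ⊗ b)
    ∘ actm (massoc a a' a2)^† (idm m) (massoc b2 b' b)
    ∘ (assoc3 a (a' ⊗ a2) m (b2 ⊗ b') b)^†.
  have [a1 _] := assoc3_unitary a a' (act a2 m b2) b' b.
  have [_ u2] := assoc3_unitary a (a' ⊗ a2) m (b2 ⊗ b') b.
  have [_ m2] := massoc_unitary a a' a2.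
  have [m1 m3] := massoc_unitary b2 b' b.
  rewrite -[RHS](compKl _ a1) -!compA.
  rewrite (comp_tail (esym pent0)) -!compA.
  by rewrite (comp_tail (actmE _ _ _ _ _ _)) m2 m1 comp1m actm1 comp1m u2 compm1.
have e0 : actm (idm a) (assoc3 a' a2 m b2 b' ∘ actm r (idm m) s ∘ (unit3 m)^†) (idm b)
  = actm (idm a) (assoc3 a' a2 m b2 b') (idm b)
    ∘ (actm (idm a) (actm r (idm m) s) (idm b) ∘ actm (idm a) (unit3 m)^† (idm b)).
  by rewrite !actmE !comp1m compA.
rewrite e0 -!compA (comp_tail pent) -!compA.
rewrite (comp_tail (assoc3_nat_dag _ _ _ _ _)) -!compA.
have e1 := congr1 (fun f => f^†) unit0.
rewrite dag_comp !actm_dag !dag1 in e1; rewrite e1.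
rewrite -{1}(actm1 a2 m b2) (comp_tail (esym (assoc3_nat _ _ _ _ _))) -!compA.
by rewrite (comp_tail unit1) !actmE !comp1m -?compA.
Qed.

Lemma coev_zigzag a a' b b' (r : hom (munit C) (a' ⊗ a)) (s : hom (munit D) (b ⊗ b'))
  (r' : hom (munit C) (a ⊗ a')) (s' : hom (munit D) (b' ⊗ b)) m :
  mlunit a ∘ (r'^† ⊗m idm a) ∘ (massoc a a' a)^† ∘ (idm a ⊗m r) ∘ (mrunit a)^† = idm a ->
  mrunit b ∘ (idm b ⊗m s'^†) ∘ massoc b b' b ∘ (s ⊗m idm b) ∘ (mlunit b)^† = idm b ->
  (coev r' s' (act a m b))^† ∘ actm (idm a) (coev r s m) (idm b) = idm (act a m b).
Proof. by move=> hr hs; rewrite coev_rot hr hs actm1. Qed.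

Definition lift3 k s a a' b' b (t : hom k (a ⊗ a')) (v : hom s (b' ⊗ b)) m :
    hom (act k m s) (act a (act a' m b') b) :=
  locked (assoc3 a a' m b' b ∘ actm t (idm m) v).

Lemma lift3E k s a a' b' b (t : hom k (a ⊗ a')) (v : hom s (b' ⊗ b)) m :
  assoc3 a a' m b' b ∘ actm t (idm m) v = lift3 t v m.
Proof. by rewrite /lift3 -lock. Qed.

Lemma lift3_nat k s a a' b' b (t : hom k (a ⊗ a')) (v : hom s (b' ⊗ b)) m n (h : hom m n) :
  actm (idm a) (actm (idm a') h (idm b')) (idm b) ∘ lift3 t v m
  = lift3 t v n ∘ actm (idm k) h (idm s).
Proof.
rewrite -!lift3E compA -assoc3_nat -!compA !actmE !tensm1.
by rewrite !comp1m !compm1.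
Qed.

Lemma lift3_dag_comp k k' s s' a a' b' b (t : hom k (a ⊗ a')) (v : hom s (b' ⊗ b))
  (t' : hom k' (a ⊗ a')) (v' : hom s' (b' ⊗ b)) m :
  (lift3 t' v' m)^† ∘ lift3 t v m = actm (t'^† ∘ t) (idm m) (v'^† ∘ v).
Proof.
have [u1 _] := assoc3_unitary a a' m b' b.
rewrite -!lift3E dag_comp -compA (compKl _ u1) actm_dag actmE.
by rewrite dag1 comp1m.
Qed.

Lemma lin_lift3l k s a a' b' b (v : hom s (b' ⊗ b)) m :
  lin (fun t : hom k (a ⊗ a') => lift3 t v m).
Proof.
move=> c t t'; rewrite -!lift3E.
exact: (lin_comp (lin_compr _) (lin_actm1 _ _)).
Qed.

Lemma lin_lift3r k s a a' b' b (t : hom k (a ⊗ a')) m :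
  lin (fun v : hom s (b' ⊗ b) => lift3 t v m).
Proof.
move=> c v v'; rewrite -!lift3E.
exact: (lin_comp (lin_compr _) (lin_actm3 _ _)).
Qed.

Lemma lift3_coev a a' b b' (r : hom (munit C) (a' ⊗ a)) (s : hom (munit D) (b ⊗ b')) m :
  coev r s m = lift3 r s m ∘ (unit3 m)^†.
Proof. by rewrite /coev lift3E. Qed.

Lemma unit3_lift3 k s a b (t : hom k (munit C ⊗ a)) (v : hom s (b ⊗ munit D)) m :
  unit3 (act a m b) ∘ lift3 t v m = actm (mlunit a ∘ t) (idm m) (mrunit b ∘ v).
Proof.
have u1 := act_unit_assoc a m b; rewrite assoc3E unit3E in u1.
by rewrite -lift3E compA u1 actmE comp1m.
Qed.

End Coherence.

(** * Inverses of isomorphisms *)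

Section IsoInverse.
Variables (R : realType) (X : cstar_category R).

Lemma is_iso_exists (x y : X) (f : hom x y) : is_iso f ->
  exists g : hom y x, (g ∘ f == idm x) && (f ∘ g == idm y).
Proof. by case=> g [h1 h2]; exists g; rewrite h1 h2 !eqxx. Qed.

(** Being inverse is a boolean condition on an element of a choice type, so an inverse can be
    selected although [is_iso] is a proposition. *)
Definition isoinv (x y : X) (f : hom x y) (h : is_iso f) : hom y x :=
  xchoose (is_iso_exists h).

Lemma isoinvK (x y : X) (f : hom x y) (h : is_iso f) : isoinv h ∘ f = idm x.
Proof. by have /andP[/eqP] := xchooseP (is_iso_exists h). Qed.

Lemma isoinvVK (x y : X) (f : hom x y) (h : is_iso f) : f ∘ isoinv h = idm y.
Proof. by have /andP[_ /eqP] := xchooseP (is_iso_exists h). Qed.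

Lemma inverse_unique (x y : X) (p q : hom x y) (p' q' : hom y x) :
  p = q -> p' ∘ p = idm x -> q ∘ q' = idm y -> p' = q'.
Proof. by move=> -> h1 h2; rewrite -(compm1 p') -h2 compA h1 comp1m. Qed.

Lemma is_iso_comp (x y z : X) (g : hom y z) (f : hom x y) :
  is_iso g -> is_iso f -> is_iso (g ∘ f).
Proof.
move=> [g' [g1 g2]] [f' [f1 f2]]; exists (f' ∘ g'); rewrite -!compA.
by rewrite (compKl _ g1) f1 (compKl _ f2) g2.
Qed.

Lemma inverse_nat (x x' y y' : X) (u : hom x y) (u' : hom x' y')
  (v : hom y x) (v' : hom y' x') (f : hom x x') (g : hom y y') :
  u ∘ v = idm y -> v' ∘ u' = idm x' -> u' ∘ f = g ∘ u -> v' ∘ g = f ∘ v.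
Proof.
move=> u2 v1 h.
by rewrite -[LHS](compKr _ u2) -!compA (compA g u) -h -!compA (compKl _ v1).
Qed.

End IsoInverse.

(** * Bimodule functors and their dagger conjugates *)

Section FunctorCoherence.
Variables (R : realType) (C D : monoidal_category R) (M : bimodule_category C D).
Variable F : bimodule_functor M.
Implicit Types (a : C) (b : D) (m n : M).

Lemma lin_bf_mor m n : lin (fun h : hom m n => bf_mor F h).
Proof. by move=> k h h'; exact: bf_mor_linear. Qed.

Lemma ractm_compl m m' m'' b (h' : hom m' m'') (h : hom m m') :
  ractm (h' ∘ h) (idm b) = ractm h' (idm b) ∘ ractm h (idm b).
Proof. by rewrite ractmE comp1m. Qed.

Lemma lactm_compr m m' m'' a (h' : hom m' m'') (h : hom m m') :
  lactm (idm a) (h' ∘ h) = lactm (idm a) h' ∘ lactm (idm a) h.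
Proof. by rewrite lactmE comp1m. Qed.

Lemma bf_str_nat a a' m m' b b' (f : hom a a') (h : hom m m') (g : hom b b') :
  bf_str F a' m' b' ∘ actm f (bf_mor F h) g = bf_mor F (actm f h g) ∘ bf_str F a m b.
Proof.
rewrite /bf_str /actm -!compA ractmE comp1m bf_l_nat.
by rewrite -(compm1 g) -ractmE compA bf_r_nat compm1 -!compA.
Qed.

Lemma bf_mor_unitary m n (u : hom m n) : unitary u ->
  bf_mor F u^† ∘ bf_mor F u = idm _ /\ bf_mor F u ∘ bf_mor F u^† = idm _.
Proof. by case=> u1 u2; rewrite -!bf_mor_comp u1 u2 !bf_mor_id. Qed.

Lemma bf_str_unit m :
  bf_mor F (act_unit m) ∘ bf_str F (munit C) m (munit D) = act_unit (F m).
Proof.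
rewrite /act_unit /bf_str bf_mor_comp -!compA (comp_tail (bf_r_unit _ _)).
by rewrite runit_nat compA bf_l_unit.
Qed.

(** The three laws for the left action, the right action and their interchange combine:
    [bf_l_assoc], then [bf_r_assoc] in the inverted form [e1], then [bf_hexagon]. *)
Lemma bf_str_assoc a a' m b' b :
  bf_mor F (act_assoc a a' m b' b) ∘ bf_str F (a ⊗ a') m (b' ⊗ b)
  = bf_str F a (act a' m b') b ∘ actm (idm a) (bf_str F a' m b') (idm b)
    ∘ act_assoc a a' (F m) b' b.
Proof.
pose X := lact a (lact a' m).
have [r1 r2] := bf_mor_unitary (rassoc_unitary X b' b).
have [s1 s2] := rassoc_unitary (F X) b' b.
have e1 : bf_mor F (rassoc X b' b)^† ∘ bf_r F X (b' ⊗ b)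
  = bf_r F (ract X b') b ∘ ractm (bf_r F X b') (idm b) ∘ (rassoc (F X) b' b)^†.
  apply: (inverse_nat (u' := bf_mor F (rassoc X b' b)) s2 r1).
  by rewrite -bf_r_assoc compA.
rewrite /act_assoc /bf_str !bf_mor_comp -!compA.
rewrite (comp_tail (esym (bf_r_nat _ _ _))) -!compA ractmE comp1m bf_l_assoc.
rewrite (comp_tail e1) -!compA (comp_tail (esym (bf_r_nat _ _ _))) -!compA.
congr (_ ∘ _).
rewrite !ractm_compl -?compA -tensm1.
rewrite (comp_tail (rassoc_nat_dag (bf_l F a _) _ _)) -!compA.
rewrite (comp_tail (rassoc_nat_dag (lactm _ (bf_l F a' m)) _ _)) -!compA.
rewrite !compA -!ractm_compl bf_hexagon /actm !lactm_compr !ractm_compl -!compA.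
congr (_ ∘ (_ ∘ _)).
by rewrite (comp_tail (esym (ractm_compl _ _ _))) bassoc_nat ractm_compl -!compA.
Qed.

Definition str3 a m b := locked (bf_str F a m b).

Lemma str3E a m b : bf_str F a m b = str3 a m b.
Proof. by rewrite /str3 -lock. Qed.

Lemma str3_nat a a' m m' b b' (f : hom a a') (h : hom m m') (g : hom b b') :
  str3 a' m' b' ∘ actm f (bf_mor F h) g = bf_mor F (actm f h g) ∘ str3 a m b.
Proof. by rewrite -!str3E bf_str_nat. Qed.

Lemma str3_iso a m b : is_iso (str3 a m b).
Proof.
rewrite -str3E; apply: is_iso_comp; first exact: bf_r_iso.
have [l' [l1 l2]] := bf_l_iso F a m; exists (ractm l' (idm b)).
by rewrite -!ractm_compl l1 l2 !ractm1.
Qed.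

Lemma str3_unit m :
  bf_mor F (unit3 m) ∘ str3 (munit C) m (munit D) = unit3 (F m).
Proof. by rewrite -str3E -!unit3E bf_str_unit. Qed.

Lemma str3_unit_dag m :
  str3 (munit C) m (munit D) ∘ (unit3 (F m))^† = bf_mor F (unit3 m)^†.
Proof.
have [u1 _] := bf_mor_unitary (unit3_unitary m).
have [_ v2] := unit3_unitary (F m).
by rewrite -[LHS](compKl _ u1) -?compA (comp_tail (str3_unit m)) v2 compm1.
Qed.

Lemma str3_assoc a a' m b' b :
  bf_mor F (assoc3 a a' m b' b) ∘ str3 (a ⊗ a') m (b' ⊗ b)
  = str3 a (act a' m b') b ∘ actm (idm a) (str3 a' m b') (idm b)
    ∘ assoc3 a a' (F m) b' b.
Proof. by rewrite -!str3E -!assoc3E bf_str_assoc. Qed.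

Lemma str3_coev a a' b b' (r : hom (munit C) (a' ⊗ a)) (s : hom (munit D) (b ⊗ b')) m :
  bf_mor F (coev r s m)
  = str3 a' (act a m b) b' ∘ actm (idm a') (str3 a m b) (idm b') ∘ coev r s (F m).
Proof.
rewrite /coev !bf_mor_comp -str3_unit_dag -!compA.
rewrite (comp_tail (esym (str3_nat r (idm m) s))) -!compA bf_mor_id.
by rewrite (comp_tail (str3_assoc _ _ _ _ _)) -!compA.
Qed.

Lemma str3_lift3 k s a a' b' b (t : hom k (a ⊗ a')) (v : hom s (b' ⊗ b)) m :
  bf_mor F (lift3 t v m) ∘ str3 k m s
  = str3 a (act a' m b') b ∘ actm (idm a) (str3 a' m b') (idm b) ∘ lift3 t v (F m).
Proof.
rewrite -!lift3E bf_mor_comp -compA -(str3_nat t (idm m) v) compA str3_assoc.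
by rewrite bf_mor_id -!compA.
Qed.

End FunctorCoherence.

Section DaggerConjugate.
Variables (R : realType) (C D : monoidal_category R) (M : bimodule_category C D).
Variable F : bimodule_functor M.
Implicit Types (a : C) (b : D) (m n : M).

(** The structure maps are the inverse adjoints of those of F. Each axiom then arises from the same
    axiom for F by inverting both sides ([inverse_unique], [inverse_nat]) and taking the dagger. *)
Let mor m n (h : hom m n) : hom (F m) (F n) := (bf_mor F h^†)^†.
Let l a m : hom (lact a (F m)) (F (lact a m)) := (isoinv (bf_l_iso F a m))^†.
Let r m b : hom (ract (F m) b) (F (ract m b)) := (isoinv (bf_r_iso F m b))^†.

Let mor_id m : mor (idm m) = idm (F m).
Proof. by rewrite /mor dag1 bf_mor_id dag1. Qed.

Let mor_comp m n p (g : hom n p) (f : hom m n) : mor (g ∘ f) = mor g ∘ mor f.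
Proof. by rewrite /mor dag_comp bf_mor_comp dag_comp. Qed.

Let mor_linear m n (k : R[i]) (f f' : hom m n) :
  mor (k *: f + f') = k *: mor f + mor f'.
Proof. by rewrite /mor dag_antilinear bf_mor_linear dag_antilinear conjcK. Qed.

Let dag_iso (X : cstar_category R) (x y : X) (f : hom x y) (h : is_iso f) :
  is_iso (isoinv h)^†.
Proof.
by exists f^†; rewrite -!dag_comp isoinvK isoinvVK !dag1.
Qed.

Let l_iso a m : is_iso (l a m).
Proof. exact: dag_iso. Qed.

Let r_iso m b : is_iso (r m b).
Proof. exact: dag_iso. Qed.

Let l_nat a a' m m' (f : hom a a') (h : hom m m') :
  l a' m' ∘ lactm f (mor h) = mor (lactm f h) ∘ l a m.
Proof.
apply: dag_inj; rewrite !dag_comp !dagK lactm_dag dagK lactm_dag.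
apply: esym; apply: (inverse_nat (isoinvVK _) (isoinvK _)); exact: bf_l_nat.
Qed.

Let r_nat m m' b b' (h : hom m m') (g : hom b b') :
  r m' b' ∘ ractm (mor h) g = mor (ractm h g) ∘ r m b.
Proof.
apply: dag_inj; rewrite !dag_comp !dagK ractm_dag dagK ractm_dag.
apply: esym; apply: (inverse_nat (isoinvVK _) (isoinvK _)); exact: bf_r_nat.
Qed.

Let lVK a a' m : lactm (idm a) (bf_l F a' m) ∘ lactm (idm a) (isoinv (bf_l_iso F a' m)) = idm _.
Proof. by rewrite -lactm_compr isoinvVK lactm1. Qed.

Let rK m b b' : ractm (isoinv (bf_r_iso F m b)) (idm b') ∘ ractm (bf_r F m b) (idm b') = idm _.
Proof. by rewrite -ractm_compl isoinvK ractm1. Qed.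

Let l_assoc a a' m :
  mor (lassoc a a' m) ∘ l (a ⊗ a') m
  = l a (lact a' m) ∘ lactm (idm a) (l a' m) ∘ lassoc a a' (F m).
Proof.
apply: dag_inj; rewrite /mor !dag_comp !dagK lactm_dag dag1 dagK.
have [u1 u2] := bf_mor_unitary F (lassoc_unitary a a' m).
have [v1 v2] := lassoc_unitary a a' (F m).
apply: (inverse_unique (bf_l_assoc F a a' m)); rewrite -!compA.
  by rewrite (compKl _ u1) isoinvK.
by rewrite (compKl _ v2) (compKl _ (lVK _ _ _)) isoinvVK.
Qed.

Let l_unit m : mor (lunit m) ∘ l (munit C) m = lunit (F m).
Proof.
apply: dag_inj; rewrite /mor !dag_comp !dagK.
have [u1 u2] := bf_mor_unitary F (lunit_unitary m).
have [v1 v2] := lunit_unitary (F m).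
apply: (inverse_unique (bf_l_unit F m)) => //.
by rewrite -!compA (compKl _ u1) isoinvK.
Qed.

Let r_assoc m b b' :
  mor (rassoc m b b') ∘ r (ract m b) b' ∘ ractm (r m b) (idm b')
  = r m (b ⊗ b') ∘ rassoc (F m) b b'.
Proof.
apply: dag_inj; rewrite /mor !dag_comp !dagK ractm_dag dag1 dagK.
have [u1 u2] := bf_mor_unitary F (rassoc_unitary m b b').
have [v1 v2] := rassoc_unitary (F m) b b'.
apply: (inverse_unique (bf_r_assoc F m b b')); rewrite -!compA.
  by rewrite (compKl _ u1) (compKl _ (isoinvK _)) rK.
by rewrite (compKl _ v2) isoinvVK.
Qed.

Let r_unit m : mor (runit m) ∘ r m (munit D) = runit (F m).
Proof.
apply: dag_inj; rewrite /mor !dag_comp !dagK.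
have [u1 u2] := bf_mor_unitary F (runit_unitary m).
have [v1 v2] := runit_unitary (F m).
apply: (inverse_unique (bf_r_unit F m)) => //.
by rewrite -!compA (compKl _ u1) isoinvK.
Qed.

Let rVK' a m b : lactm (idm a) (bf_r F m b) ∘ lactm (idm a) (isoinv (bf_r_iso F m b)) = idm _.
Proof. by rewrite -lactm_compr isoinvVK lactm1. Qed.

Let lK' a m b : ractm (isoinv (bf_l_iso F a m)) (idm b) ∘ ractm (bf_l F a m) (idm b) = idm _.
Proof. by rewrite -ractm_compl isoinvK ractm1. Qed.

Let lVK' a m b : ractm (bf_l F a m) (idm b) ∘ ractm (isoinv (bf_l_iso F a m)) (idm b) = idm _.
Proof. by rewrite -ractm_compl isoinvVK ractm1. Qed.

Let hexagon a m b :
  mor (bassoc a m b) ∘ r (lact a m) b ∘ ractm (l a m) (idm b)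
  = l a (ract m b) ∘ lactm (idm a) (r m b) ∘ bassoc a (F m) b.
Proof.
apply: dag_inj; rewrite /mor !dag_comp !dagK ractm_dag lactm_dag !dag1 !dagK.
have [u1 u2] := bf_mor_unitary F (bassoc_unitary a m b).
have [v1 v2] := bassoc_unitary a (F m) b.
apply: (inverse_unique (bf_hexagon F a m b)); rewrite -!compA.
  by rewrite (compKl _ u1) (compKl _ (isoinvK _)) lK'.
by rewrite (compKl _ v2) (compKl _ (rVK' _ _ _)) isoinvVK.
Qed.

Definition dconj : bimodule_functor M :=
  BimoduleFunctor mor_id mor_comp mor_linear l_iso r_iso l_nat r_nat
    l_assoc l_unit r_assoc r_unit hexagon.

Lemma dconj_mor m n (h : hom m n) : bf_mor dconj h = (bf_mor F h^†)^†.
Proof. by []. Qed.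

Lemma dconj_str a m b :
  (str3 dconj a m b)^† ∘ str3 F a m b = idm _ /\ str3 F a m b ∘ (str3 dconj a m b)^† = idm _.
Proof.
rewrite -!str3E /bf_str /= dag_comp dagK ractm_dag dagK dag1 -!compA.
rewrite (compKl _ (isoinvK _)) lK' (compKl _ (lVK' _ _ _)) isoinvVK.
by [].
Qed.

End DaggerConjugate.

Lemma conjc_realC (R : realType) (x : R) : conjc x%:C = x%:C.
Proof. exact: conjc_real. Qed.

Lemma conjcM (R : realType) (x y : R[i]) : conjc (x * y) = conjc x * conjc y.
Proof. exact: (rmorphM (@conjc R)). Qed.

Lemma conjcB (R : realType) (x y : R[i]) : conjc (x - y) = conjc x - conjc y.
Proof. exact: (rmorphB (@conjc R)). Qed.

Lemma conjc_sum (R : realType) (J : finType) (F : J -> R[i]) :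
  conjc (\sum_j F j) = \sum_j conjc (F j).
Proof. exact: (rmorph_sum (@conjc R)). Qed.

Lemma sum_ge0_eq0 (K : numDomainType) (J : finType) (F : J -> K) :
  (forall j, 0 <= F j) -> \sum_j F j = 0 -> forall j, F j = 0.
Proof. by move=> h0 h j; apply: (psumr_eq0P _ h). Qed.

(** * Sphericality *)

Section Spherical.
Variables (R : realType) (X : cstar_category R) (hX : finitely_semisimple X).
Variables (I : finType) (r : I -> X) (hr : irr_representatives r).
Variable bas : forall k y, dual_bases (r k) y.
Variables (T T' : X -> X).
Variable Tm : forall x y, hom x y -> hom (T x) (T y).
Variable Tm' : forall x y, hom x y -> hom (T' x) (T' y).
Hypothesis Tm_id : forall x, Tm (idm x) = idm (T x).
Hypothesis Tm'_id : forall x, Tm' (idm x) = idm (T' x).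
Hypothesis Tm_comp : forall x y z (g : hom y z) (f : hom x y), Tm (g ∘ f) = Tm g ∘ Tm f.
Hypothesis Tm'_comp : forall x y z (g : hom y z) (f : hom x y), Tm' (g ∘ f) = Tm' g ∘ Tm' f.
Hypothesis Tm_lin : forall x y, lin (@Tm x y).
Hypothesis Tm'_lin : forall x y, lin (@Tm' x y).
Hypothesis Tm_dag : forall x y (f : hom x y), (Tm f)^† = Tm f^†.
Hypothesis Tm'_dag : forall x y (f : hom x y), (Tm' f)^† = Tm' f^†.
Variable u : forall x, hom x (T' (T x)).
Variable u' : forall x, hom x (T (T' x)).
Hypothesis u_nat : forall x y (h : hom x y), Tm' (Tm h) ∘ u x = u y ∘ h.
Hypothesis u'_nat : forall x y (h : hom x y), Tm (Tm' h) ∘ u' x = u' y ∘ h.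
Hypothesis zig : forall x, (u' (T x))^† ∘ Tm (u x) = idm (T x).
Hypothesis zig' : forall x, (u (T' x))^† ∘ Tm' (u' x) = idm (T' x).
Variable delta : R.
Hypothesis u_norm : forall x, (u x)^† ∘ u x = delta%:C *: idm x.
Hypothesis u'_norm : forall x, (u' x)^† ∘ u' x = delta%:C *: idm x.
Variable d : I -> R.
Hypothesis hd : forall i, 0 < d i.
Hypothesis dims : forall z,
  \sum_x (homdim bas x (T (r z)))%:R * d x = delta * d z.

Let rs := irr_simple hr.

(** Antilinear Frobenius reciprocity for the adjunction between T and T'; the zigzag identities make
    [rot] and [rot'] mutually inverse. *)
Definition rot x z (f : hom x (T z)) : hom z (T' x) := Tm' f^† ∘ u z.
Definition rot' x z (h : hom z (T' x)) : hom x (T z) := Tm h^† ∘ u' x.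

Lemma rotK x z (f : hom x (T z)) : rot' (rot f) = f.
Proof.
rewrite /rot /rot' dag_comp Tm_comp Tm'_dag dagK -compA u'_nat.
have := congr1 (fun f => f^†) (zig z).
by rewrite dag_comp dagK Tm_dag dag1 compA => ->; rewrite comp1m.
Qed.

Lemma rot'K x z (h : hom z (T' x)) : rot (rot' h) = h.
Proof.
rewrite /rot /rot' dag_comp Tm'_comp Tm_dag dagK -compA u_nat.
have := congr1 (fun f => f^†) (zig' x).
by rewrite dag_comp dagK Tm'_dag dag1 compA => ->; rewrite comp1m.
Qed.

Lemma rot_sumZ x z (J : finType) (c : J -> R[i]) (f : J -> hom x (T z)) :
  rot (\sum_j c j *: f j) = \sum_j conjc (c j) *: rot (f j).
Proof.
rewrite /rot dag_sum (lin_sum (@Tm'_lin _ _)) comp_suml; apply: eq_bigr => j _.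
by rewrite dagZ (linZ (@Tm'_lin _ _)) compZl.
Qed.

Lemma rot'_sumZ x z (J : finType) (c : J -> R[i]) (f : J -> hom z (T' x)) :
  rot' (\sum_j c j *: f j) = \sum_j conjc (c j) *: rot' (f j).
Proof.
rewrite /rot' dag_sum (lin_sum (@Tm_lin _ _)) comp_suml; apply: eq_bigr => j _.
by rewrite dagZ (linZ (@Tm_lin _ _)) compZl.
Qed.

Lemma on_expand k y n (E : forall l, 'I_n -> hom (r l) y) (f : hom (r k) y) :
  \sum_l \sum_i E l i ∘ (E l i)^† = idm y ->
  f = \sum_i scalar ((E k i)^† ∘ f) *: E k i.
Proof.
move=> Es; rewrite -{1}(comp1m f) -Es comp_suml (bigD1 k) //= [X in _ + X]big1.
  rewrite addr0 comp_suml; apply: eq_bigr => i _; rewrite -compA.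
  by rewrite {1}(scalarE ((E k i)^† ∘ f) (rs k)) compZr compm1.
move=> l lk; rewrite comp_suml big1 // => i _.
by rewrite -compA (irr_hom0 hr ((E l i)^† ∘ f)) ?compm0 // eq_sym.
Qed.

Lemma on_norm k y n (E : forall l, 'I_n -> hom (r l) y) (f g : hom (r k) y) :
  \sum_l \sum_i E l i ∘ (E l i)^† = idm y ->
  scalar (g^† ∘ f) = \sum_i conjc (scalar ((E k i)^† ∘ g)) * scalar ((E k i)^† ∘ f).
Proof.
move=> Es; rewrite {1}(on_expand f Es) comp_sumr scalar_sum; apply: eq_bigr => i _.
rewrite compZr scalarZl mulrC -(scalar_dag _ (rs k)) dag_comp dagK.
by [].
Qed.

(** Let c and e be the matrices of [rot] and [rot'] in orthonormal bases. The norms of the cups give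
    Σ |c|^2 = δ for fixed z and Σ |e|^2 = δ for fixed x; invertibility of the bending makes Σ
    conj(c) e the dimension of Hom(x, T z). With the eigenvector equation for d this forces d_z c =
    d_x e, and both trace formulas are this identity in coordinates. *)
Theorem spherical_pair x z :
  (forall (f : hom (r x) (T (r z))) (g : hom (T (r z)) (r x)),
    (u (r z))^† ∘ Tm' (f ∘ g) ∘ u (r z) = ((d x / d z)%:C * scalar (g ∘ f)) *: idm _) /\
  (forall (f : hom (r z) (T' (r x))) (g : hom (T' (r x)) (r z)),
    (u' (r x))^† ∘ Tm (f ∘ g) ∘ u' (r x) = ((d z / d x)%:C * scalar (g ∘ f)) *: idm _).
Proof.
have [n hn] := fin_all_exists (fun z => irr_orthonormal hX hr bas (T (r z))).
have [E hE] := fin_all_exists hn.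
have [m hm] := fin_all_exists (fun x => irr_orthonormal hX hr bas (T' (r x))).
have [H hH] := fin_all_exists hm.
have Es z0 : \sum_l \sum_i E z0 l i ∘ (E z0 l i)^† = idm _ by have [] := hE z0.
have Hs x0 : \sum_l \sum_i H x0 l i ∘ (H x0 l i)^† = idm _ by have [] := hH x0.
pose c z x i k := scalar ((H x z k)^† ∘ rot (E z x i)).
pose e z x i k := scalar ((E z x i)^† ∘ rot' (H x z k)).
have rotE z0 x0 i : rot (E z0 x0 i) = \sum_k c z0 x0 i k *: H x0 z0 k.
  exact: on_expand.
have rotH z0 x0 k : rot' (H x0 z0 k) = \sum_i e z0 x0 i k *: E z0 x0 i.
  exact: on_expand.
have sum_c z0 : \sum_x0 \sum_i \sum_k conjc (c z0 x0 i k) * c z0 x0 i k = delta%:C.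
  transitivity (scalar ((u (r z0))^† ∘ Tm' (\sum_x0 \sum_i E z0 x0 i ∘ (E z0 x0 i)^†) ∘ u (r z0))).
    rewrite (lin_sum (@Tm'_lin _ _)) comp_sumr comp_suml scalar_sum.
    apply: eq_bigr => x0 _; rewrite (lin_sum (@Tm'_lin _ _)) comp_sumr comp_suml scalar_sum.
    apply: eq_bigr => i _; rewrite -(on_norm _ _ (Hs x0)) /rot dag_comp.
    by rewrite Tm'_dag dagK Tm'_comp !compA.
  by rewrite Es Tm'_id compm1 u_norm scalar_idZ.
have sum_e x0 : \sum_z0 \sum_k \sum_i conjc (e z0 x0 i k) * e z0 x0 i k = delta%:C.
  transitivity (scalar ((u' (r x0))^† ∘ Tm (\sum_z0 \sum_k H x0 z0 k ∘ (H x0 z0 k)^†) ∘ u' (r x0))).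
    rewrite (lin_sum (@Tm_lin _ _)) comp_sumr comp_suml scalar_sum.
    apply: eq_bigr => z0 _; rewrite (lin_sum (@Tm_lin _ _)) comp_sumr comp_suml scalar_sum.
    apply: eq_bigr => k _; rewrite -(on_norm _ _ (Es z0)) /rot' dag_comp.
    by rewrite Tm_dag dagK Tm_comp !compA.
  by rewrite Hs Tm_id compm1 u'_norm scalar_idZ.
(* Bending back undoes bending, so pairing c with e returns the Gram matrix of E. It is diagonal,
   with zeros for the padding. *)
have ce z0 x0 i l : \sum_k conjc (c z0 x0 i k) * e z0 x0 l k
    = scalar ((E z0 x0 l)^† ∘ E z0 x0 i).
  rewrite -[in RHS](rotK (E z0 x0 i)) rotE rot'_sumZ comp_sumr scalar_sum.
  by apply: eq_bigr => k _; rewrite compZr scalarZl.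
have ec z0 x0 k l : \sum_i conjc (e z0 x0 i k) * c z0 x0 i l
    = scalar ((H x0 z0 l)^† ∘ H x0 z0 k).
  rewrite -[in RHS](rot'K (H x0 z0 k)) rotH rot_sumZ comp_sumr scalar_sum.
  by apply: eq_bigr => i _; rewrite compZr scalarZl.
pose D (x : I) : R[i] := (d x)%:C.
have Dn x0 : D x0 != 0.
  by rewrite /D; apply/eqP; case=> h; have := hd x0; rewrite h ltxx.
have Dr x0 : conjc (D x0) = D x0 by exact: conjc_realC.
(* Equality holds throughout the AM-GM inequality [2 d_z d_x N_zx <= d_z^2 |c|^2 + d_x^2 |e|^2]
   once it is summed over all z and x. *)
have key z0 x0 i k : D z0 * c z0 x0 i k = D x0 * e z0 x0 i k.
  pose t z0 x0 i k := D z0 * c z0 x0 i k - D x0 * e z0 x0 i k.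
  have tot : \sum_z0 \sum_x0 \sum_i \sum_k t z0 x0 i k * conjc (t z0 x0 i k) = 0.
    pose S (G : forall z x, 'I_(n z) -> 'I_(m x) -> R[i]) : R[i] :=
      \sum_z0 \sum_x0 \sum_i \sum_k G z0 x0 i k.
    have SD G G' : S (fun z x i k => G z x i k + G' z x i k) = S G + S G'.
      by rewrite /S; do 4![rewrite -big_split; apply: eq_bigr => ? _ /=].
    have N z1 x1 : \sum_i \sum_k conjc (c z1 x1 i k) * e z1 x1 i k
        = (homdim bas x1 (T (r z1)))%:R.
      have [_ _ <-] := hE z1; by apply: eq_bigr => i1 _; rewrite ce.
    pose A z1 := delta%:C * D z1 ^+ 2 : R[i].
    have S1 : S (fun z x i k => D z ^+ 2 * (conjc (c z x i k) * c z x i k)) = \sum_z0 A z0.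
      apply: eq_bigr => z1 _; rewrite /A -(sum_c z1) mulrC mulr_sumr.
      apply: eq_bigr => x1 _; rewrite mulr_sumr; apply: eq_bigr => i1 _.
      by rewrite mulr_sumr.
    have S2 : S (fun z x i k => D x ^+ 2 * (conjc (e z x i k) * e z x i k)) = \sum_z0 A z0.
      rewrite /S exchange_big; apply: eq_bigr => x1 _; rewrite /A -(sum_e x1) mulrC mulr_sumr.
      apply: eq_bigr => z1 _; rewrite exchange_big mulr_sumr; apply: eq_bigr => i1 _.
      by rewrite mulr_sumr.
    (* The eigenvector equation for d enters here: it evaluates the mixed term to the same total as
       the two squares. *)
    have S3 : S (fun z x i k => (D z * D x) * (conjc (c z x i k) * e z x i k)) = \sum_z0 A z0.
      apply: eq_bigr => z1 _; rewrite /A.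
      have -> : delta%:C * D z1 ^+ 2 = D z1 * (delta * d z1)%:C.
        by rewrite rmorphM expr2 mulrCA.
      rewrite -dims rmorph_sum mulr_sumr; apply: eq_bigr => x1 _.
      rewrite rmorphM rmorph_nat -N mulr_suml mulr_sumr; apply: eq_bigr => i1 _.
      rewrite mulr_suml mulr_sumr; apply: eq_bigr => k1 _.
      by rewrite -mulrA [X in _ = _ * X]mulrC.
    have S4 : S (fun z x i k => (D z * D x) * (c z x i k * conjc (e z x i k))) = \sum_z0 A z0.
      have Ar : conjc (\sum_z0 A z0) = \sum_z0 A z0.
        have -> : \sum_z0 A z0 = (\sum_z0 delta * d z0 ^+ 2)%:C.
          by rewrite rmorph_sum; apply: eq_bigr => z1 _; rewrite rmorphM rmorphXn.
        exact: conjc_realC.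
      rewrite -Ar -S3 /S; do 4![rewrite conjc_sum; apply: eq_bigr => ? _].
      by rewrite !conjcM conjcK !Dr.
    have tE z1 x1 i1 k1 : t z1 x1 i1 k1 * conjc (t z1 x1 i1 k1)
      + (D z1 * D x1) * (conjc (c z1 x1 i1 k1) * e z1 x1 i1 k1)
      + (D z1 * D x1) * (c z1 x1 i1 k1 * conjc (e z1 x1 i1 k1))
      = D z1 ^+ 2 * (conjc (c z1 x1 i1 k1) * c z1 x1 i1 k1)
        + D x1 ^+ 2 * (conjc (e z1 x1 i1 k1) * e z1 x1 i1 k1).
      rewrite /t conjcB !conjcM !Dr.
      move: (D z1) (D x1) (c _ _ _ _) (conjc (c _ _ _ _)) (e _ _ _ _) (conjc (e _ _ _ _)).
      by move=> a b c1 c2 e1 e2; ring.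
    have : S (fun z x i k => t z x i k * conjc (t z x i k)
      + (D z * D x) * (conjc (c z x i k) * e z x i k)
      + (D z * D x) * (c z x i k * conjc (e z x i k))) = \sum_z0 A z0 + \sum_z0 A z0.
      rewrite -{1}S1 -S2 -SD; do 4![apply: eq_bigr => ? _]; exact: tE.
    rewrite !SD S3 S4 => /eqP; rewrite -addrA -subr_eq0 addrK => /eqP.
    by [].
  have tge z1 x1 i1 k1 : 0 <= t z1 x1 i1 k1 * conjc (t z1 x1 i1 k1) by exact: mulcJ_ge0.
  have h1 := sum_ge0_eq0 (fun z1 => sumr_ge0 _ (fun x1 _ => sumr_ge0 _ (fun i1 _ =>
     sumr_ge0 _ (fun k1 _ => tge z1 x1 i1 k1)))) tot z0.
  have h2 := sum_ge0_eq0 (fun x1 => sumr_ge0 _ (fun i1 _ =>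
     sumr_ge0 _ (fun k1 _ => tge z0 x1 i1 k1))) h1 x0.
  have h3 := sum_ge0_eq0 (fun i1 => sumr_ge0 _ (fun k1 _ => tge z0 x0 i1 k1)) h2 i.
  have h4 := sum_ge0_eq0 (fun k1 => tge z0 x0 i k1) h3 k.
  move/eqP: h4; rewrite mulf_eq0 conjc_eq0 orbb /t subr_eq0 => /eqP.
  by [].
split=> f g.
- rewrite [LHS](scalarE _ (rs _)); congr (_ *: _).
  rewrite {1}(on_expand f (Es z)) comp_suml (lin_sum (@Tm'_lin _ _)) comp_sumr comp_suml scalar_sum.
  rewrite [in RHS](on_expand f (Es z)) comp_sumr scalar_sum mulr_sumr.
  have gE : g = \sum_l scalar (g ∘ E z x l) *: (E z x l)^†.
    rewrite -{1}(dagK g) {1}(on_expand g^† (Es z)) dag_sum; apply: eq_bigr => l _.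
    by rewrite dagZ -(scalar_dag _ (rs _)) dag_comp !dagK.
  (* On basis elements the partial trace is the inner product of two bent maps. Expanding it gives
     conj(c) c, and [key] trades the second factor for e, after which [ce] applies. *)
  have EE i l : scalar ((u (r z))^† ∘ Tm' (E z x i ∘ (E z x l)^†) ∘ u (r z))
      = (d x / d z)%:C * scalar ((E z x l)^† ∘ E z x i).
    have -> : (u (r z))^† ∘ Tm' (E z x i ∘ (E z x l)^†) ∘ u (r z)
       = (rot (E z x i))^† ∘ rot (E z x l).
      by rewrite /rot dag_comp Tm'_dag dagK Tm'_comp !compA.
    rewrite (on_norm _ _ (Hs x)) -ce mulr_sumr; apply: eq_bigr => k _.
    have -> : scalar ((H x z k)^† ∘ rot (E z x l)) = (d x / d z)%:C * e z x l k.
      apply: (mulfI (Dn z)); rewrite -/(c z x l k) key mulrA; congr (_ * _).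
      by rewrite /D -rmorphM mulrCA divff ?mulr1 // gt_eqF.
    by rewrite mulrCA.
  apply: eq_bigr => i _; rewrite [in LHS]compZl (linZ (@Tm'_lin _ _)) [in LHS]compZr [in LHS]compZl scalarZl.
  rewrite [in RHS]compZr [in RHS]scalarZl mulrCA; congr (_ * _).
  rewrite [in RHS]gE comp_suml scalar_sum mulr_sumr.
  rewrite [in LHS]gE comp_sumr (lin_sum (@Tm'_lin _ _)) comp_sumr comp_suml scalar_sum.
  apply: eq_bigr => l _.
  rewrite [in LHS]compZr (linZ (@Tm'_lin _ _)) [in LHS]compZr [in LHS]compZl scalarZl EE.
  by rewrite compZl scalarZl mulrCA.
- rewrite [LHS](scalarE _ (rs _)); congr (_ *: _).
  rewrite {1}(on_expand f (Hs x)) comp_suml (lin_sum (@Tm_lin _ _)) comp_sumr comp_suml scalar_sum.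
  rewrite [in RHS](on_expand f (Hs x)) comp_sumr scalar_sum mulr_sumr.
  have gE : g = \sum_l scalar (g ∘ H x z l) *: (H x z l)^†.
    rewrite -{1}(dagK g) {1}(on_expand g^† (Hs x)) dag_sum; apply: eq_bigr => l _.
    by rewrite dagZ -(scalar_dag _ (rs _)) dag_comp !dagK.
  have EE i l : scalar ((u' (r x))^† ∘ Tm (H x z i ∘ (H x z l)^†) ∘ u' (r x))
      = (d z / d x)%:C * scalar ((H x z l)^† ∘ H x z i).
    have -> : (u' (r x))^† ∘ Tm (H x z i ∘ (H x z l)^†) ∘ u' (r x)
       = (rot' (H x z i))^† ∘ rot' (H x z l).
      by rewrite /rot' dag_comp Tm_dag dagK Tm_comp !compA.
    rewrite (on_norm _ _ (Es z)) -ec mulr_sumr; apply: eq_bigr => k _.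
    have -> : scalar ((E z x k)^† ∘ rot' (H x z l)) = (d z / d x)%:C * c z x k l.
      apply: (mulfI (Dn x)); rewrite -/(e z x k l) -key mulrA; congr (_ * _).
      by rewrite /D -rmorphM mulrCA divff ?mulr1 // gt_eqF.
    by rewrite mulrCA.
  apply: eq_bigr => i _; rewrite [in LHS]compZl (linZ (@Tm_lin _ _)) [in LHS]compZr [in LHS]compZl scalarZl.
  rewrite [in RHS]compZr [in RHS]scalarZl mulrCA; congr (_ * _).
  rewrite [in RHS]gE comp_suml scalar_sum mulr_sumr.
  rewrite [in LHS]gE comp_sumr (lin_sum (@Tm_lin _ _)) comp_sumr comp_suml scalar_sum.
  apply: eq_bigr => l _.
  rewrite [in LHS]compZr (linZ (@Tm_lin _ _)) [in LHS]compZr [in LHS]compZl scalarZl EE.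
  by rewrite compZl scalarZl mulrCA.
Qed.

End Spherical.

(** * The functors a ⊗ - ⊗ b and their adjunctions *)

Section TubeContext.
Variables (R : realType) (C D : monoidal_category R) (M : bimodule_category C D).
Hypothesis hM : finitely_semisimple M.
Variables (cC : fusion_choices C) (cD : fusion_choices D) (cM : module_choices M).
Local Notation IC := (fc_Irr cC).
Local Notation ID := (fc_Irr cD).
Local Notation IM := (mc_Irr cM).
Local Notation rC := (fc_rep (f := cC)).
Local Notation rD := (fc_rep (f := cD)).
Local Notation rM := (mc_rep (m := cM)).
Local Notation bM := (mc_bases (m := cM)).
Local Notation hr := (mc_irr cM).

Implicit Types (p q : IC * ID) (m n : M) (x z u w k i : IM).

Definition Tob (p : IC * ID) (m : M) : M := act (rC p.1) m (rD p.2).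
Definition Tm (p : IC * ID) (m n : M) (h : hom m n) : hom (Tob p m) (Tob p n) :=
  act1 p.1 p.2 h.
Definition dl (p : IC * ID) : IC * ID := (fc_dual p.1, fc_dual p.2).
Definition dp (p : IC * ID) : R := fc_dim p.1 * fc_dim p.2.
(** Strands of D stand on the other side of m, which exchanges the roles of the two solutions [fc_R]
    and [fc_R'] there. *)
Definition Ru p m : hom m (Tob (dl p) (Tob p m)) :=
  locked (coev (fc_R p.1) (fc_R' p.2) m).
Definition Ru' p m : hom m (Tob p (Tob (dl p) m)) :=
  locked (coev (fc_R' p.1) (fc_R p.2) m).

Lemma Tm_id p m : Tm p (idm m) = idm (Tob p m).
Proof. exact: actm1. Qed.

Lemma Tm_comp p m n o (g : hom n o) (f : hom m n) : Tm p (g ∘ f) = Tm p g ∘ Tm p f.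
Proof. by rewrite /Tm /act1 actmE !comp1m. Qed.

Lemma Tm_lin p m n : lin (@Tm p m n).
Proof. exact: lin_actm2. Qed.

Lemma Tm_dag p m n (f : hom m n) : (Tm p f)^† = Tm p f^†.
Proof. by rewrite /Tm /act1 actm_dag !dag1. Qed.

Lemma Ru_nat p m n (h : hom m n) : Tm (dl p) (Tm p h) ∘ Ru p m = Ru p n ∘ h.
Proof. rewrite /Ru -!lock; exact: coev_nat. Qed.

Lemma Ru'_nat p m n (h : hom m n) : Tm p (Tm (dl p) h) ∘ Ru' p m = Ru' p n ∘ h.
Proof. rewrite /Ru' -!lock; exact: coev_nat. Qed.

Lemma Ru_norm p m : (Ru p m)^† ∘ Ru p m = (dp p)%:C *: idm m.
Proof.
rewrite /Ru -!lock /dp rmorphM; apply: coev_norm; first exact: fc_dimR.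
exact: fc_dimR'.
Qed.

Lemma Ru'_norm p m : (Ru' p m)^† ∘ Ru' p m = (dp p)%:C *: idm m.
Proof.
rewrite /Ru' -!lock /dp rmorphM; apply: coev_norm; first exact: fc_dimR'.
exact: fc_dimR.
Qed.

(** The dagger of a conjugate equation is the same snake read backwards, which is the bracketing
    needed on the right of m. *)
Lemma conj_dag (E : monoidal_category R) (b b' : E) (r : hom (munit E) (b' ⊗ b))
  (r' : hom (munit E) (b ⊗ b')) :
  mlunit b ∘ (r'^† ⊗m idm b) ∘ (massoc b b' b)^† ∘ (idm b ⊗m r) ∘ (mrunit b)^† = idm b ->
  mrunit b ∘ (idm b ⊗m r^†) ∘ massoc b b' b ∘ (r' ⊗m idm b) ∘ (mlunit b)^† = idm b.
Proof.
move=> h; have := congr1 (fun f => f^†) h.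
by rewrite !dag_comp !tensm_dag !dagK !dag1 -!compA.
Qed.

Lemma Ru_zig p m : (Ru' p (Tob p m))^† ∘ Tm p (Ru p m) = idm (Tob p m).
Proof.
rewrite /Ru /Ru' -!lock; apply: coev_zigzag; first by case: (fc_conj p.1).
by apply: conj_dag; case: (fc_conj p.2).
Qed.

Lemma Ru'_zig p m : (Ru p (Tob (dl p) m))^† ∘ Tm (dl p) (Ru' p m) = idm (Tob (dl p) m).
Proof.
rewrite /Ru /Ru' -!lock; apply: coev_zigzag; first by case: (fc_conj p.1).
by apply: conj_dag; case: (fc_conj p.2).
Qed.

Lemma fc_dim_gt0 (E : monoidal_category R) (c : fusion_choices E) (a : fc_Irr c) :
  0 < fc_dim a.
Proof.
have hs := irr_simple (fc_irr c); have h1 := hs None.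
have R0 : fc_R a != 0.
  apply/eqP => R0; have [h _] := fc_conj a.
  have := simple_idm_neq0 (hs a); rewrite -h R0.
  have -> : idm (fc_rep a) ⊗m (0 : hom (munit E) (fc_rep (fc_dual a) ⊗ fc_rep a)) = 0.
    apply: (lin0 (f := fun g => idm (fc_rep a) ⊗m g)) => k g g'.
    by rewrite (bif_linearr (tens_bif E)).
  by rewrite compm0 comp0m eqxx.
have := scalar_gt0 h1 R0; rewrite fc_dimR scalar_idZ //.
by rewrite ltcR.
Qed.

Lemma dp_gt0 p : 0 < dp p.
Proof. by rewrite mulr_gt0 ?fc_dim_gt0. Qed.

Lemma homdimE x y : \dim {: hom y (rM x)} = homdim bM x y.
Proof. exact: (size_basis (dbas'_basis (bM x y))). Qed.

Section Dims.
Variable d : IM -> R.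
Hypothesis hd : forall x, 0 < d x.
Hypothesis hdL : left_dimension cC d.
Hypothesis hdR : right_dimension cD d.

(** The additive extension of d to all objects. Written as a canonical element ([wtE]), it can be
    computed along any decomposition. *)
Let wt m : R := \sum_x (homdim bM x m)%:R * d x.

Let wtform m x (f : hom (rM x) m) (g : hom m (rM x)) : R[i]^o :=
  (d x)%:C * scalar (g ∘ f).

Lemma bilin_wtform m x : bilin (@wtform m x).
Proof.
split=> [g|f]; apply: lin_mull.
  exact: lin_comp (@lin_scalar _ _ _) (lin_compr _).
exact: lin_comp (@lin_scalar _ _ _) (lin_compl _).
Qed.

Let wtE m : (wt m)%:C = can bM (@wtform m).
Proof.
rewrite /wt rmorph_sum; apply: eq_bigr => x _; rewrite rmorphM rmorph_nat.
rewrite (eq_bigr (fun _ => (d x)%:C)); last first.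
  by move=> j _; rewrite /wtform dbas_dual eqxx scalar_idZ ?mulr1 //; exact: (irr_simple hr).
by rewrite sumr_const card_ord mulr_natl.
Qed.

(** The right eigenvector equation holds at simple objects and extends to m by additivity. It can
    then be applied to a ⊗ z, which is not simple, and so be combined with the left equation in
    [dims]. *)
Lemma wt_ract m b : wt (ract m (rD b)) = wt m * fc_dim b.
Proof.
suff h : (wt (ract m (rD b)))%:C = (wt m * fc_dim b)%:C by case: h.
pose S := {k : IM & 'I_(mult (bM k m))}.
pose a (s : S) := ractm (tnth (dbas (bM (tag s) m)) (tagged s)) (idm (rD b)).
pose a' (s : S) := ractm (tnth (dbas' (bM (tag s) m)) (tagged s)) (idm (rD b)).
have aa : \sum_s a s ∘ a' s = idm (ract m (rD b)).
  rewrite -ractm1 -(irr_complete hM hr bM m).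
  have hl : lin (fun h : hom m m => ractm h (idm (rD b))).
    by move=> k h h'; rewrite (bif_linearl (ract_bif M)).
  rewrite (lin_sum hl).
  rewrite (eq_bigr _ (fun k _ => lin_sum hl _ _ _)) sig_big_dep.
  by apply: eq_bigr => s _; rewrite /a /a' ractm_compl.
rewrite wtE (can_change hM hr bM (@bilin_wtform _) aa).
rewrite /wt mulr_suml rmorph_sum.
transitivity (\sum_(s : S) (d (tag s) * fc_dim b)%:C); last first.
  transitivity (\sum_k \sum_(j < mult (bM k m)) (d k * fc_dim b)%:C).
    by rewrite sig_big_dep.
  apply: eq_bigr => k _; rewrite sumr_const card_ord -mulrA [RHS]rmorphM rmorph_nat.
  by rewrite mulr_natl.
apply: eq_bigr => s _; rewrite hdR -[RHS]/((\sum_n _)%:C).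
transitivity ((wt (ract (rM (tag s)) (rD b)))%:C); last first.
  by congr (_%:C); apply: eq_bigr => n _; rewrite homdimE.
rewrite wtE; apply: eq_can => k f g; rewrite /wtform -compA (compA (a' s)).
rewrite /a /a' -ractm_compl dbas_dual eqxx scale1r ractm1.
by rewrite comp1m.
Qed.

Lemma dims p z : \sum_x (homdim bM x (Tob p (rM z)))%:R * d x = dp p * d z.
Proof.
rewrite -/(wt _) /Tob /act wt_ract /dp mulrAC hdL; congr (_ * _).
by apply: eq_bigr => n _; rewrite homdimE.
Qed.

Theorem sph p x z (f : hom (rM x) (Tob p (rM z))) (g : hom (Tob p (rM z)) (rM x)) :
  (Ru p (rM z))^† ∘ Tm (dl p) (f ∘ g) ∘ Ru p (rM z)
  = ((d x / d z)%:C * scalar (g ∘ f)) *: idm _.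
Proof.
by have [+ _] := spherical_pair hM hr (Tm_id p) (Tm_id (dl p)) (@Tm_comp p)
  (@Tm_comp (dl p)) (@Tm_lin p) (@Tm_lin (dl p)) (@Tm_dag p) (@Tm_dag (dl p))
  (@Ru_nat p) (@Ru'_nat p) (Ru_zig p) (Ru'_zig p) (Ru_norm p) (Ru'_norm p) hd (dims p) x z.
Qed.

Theorem sph' p x z (f : hom (rM z) (Tob (dl p) (rM x))) (g : hom (Tob (dl p) (rM x)) (rM z)) :
  (Ru' p (rM x))^† ∘ Tm p (f ∘ g) ∘ Ru' p (rM x)
  = ((d z / d x)%:C * scalar (g ∘ f)) *: idm _.
Proof.
by have [_ +] := spherical_pair hM hr (Tm_id p) (Tm_id (dl p)) (@Tm_comp p)
  (@Tm_comp (dl p)) (@Tm_lin p) (@Tm_lin (dl p)) (@Tm_dag p) (@Tm_dag (dl p))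
  (@Ru_nat p) (@Ru'_nat p) (Ru_zig p) (Ru'_zig p) (Ru_norm p) (Ru'_norm p) hd (dims p) x z.
Qed.

End Dims.
End TubeContext.

(** * The tube algebra *)

Section Channels.
Variables (R : realType) (C D : monoidal_category R) (M : bimodule_category C D).
Hypotheses (hC : finitely_semisimple C) (hD : finitely_semisimple D).
Variables (cC : fusion_choices C) (cD : fusion_choices D) (cM : module_choices M).
Local Notation IC := (fc_Irr cC).
Local Notation ID := (fc_Irr cD).
Local Notation IM := (mc_Irr cM).
Local Notation rC := (fc_rep (f := cC)).
Local Notation rD := (fc_rep (f := cD)).
Local Notation rM := (mc_rep (m := cM)).
Local Notation bC := (fc_bases (f := cC)).
Local Notation bD := (fc_bases (f := cD)).
Local Notation hr := (mc_irr cM).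

Implicit Types (p q : IC * ID) (m n : M) (x z u w : IM).

(** The maps τ and σ of the product of W, acting on m: [up] includes the fusion channel (k, s) into
    the iterated action, [low] projects onto it. Defining [low] by daggers transfers the coherence
    of [up]. *)
Definition up p q (k : IC) (s : ID) (t : hom (rC k) (rC p.1 ⊗ rC q.1))
  (v : hom (rD s) (rD q.2 ⊗ rD p.2)) m : hom (Tob (k, s) m) (Tob p (Tob q m)) :=
  lift3 t v m.

Definition low p q (k : IC) (s : ID) (t : hom (rC p.1 ⊗ rC q.1) (rC k))
  (v : hom (rD q.2 ⊗ rD p.2) (rD s)) m : hom (Tob p (Tob q m)) (Tob (k, s) m) :=
  (lift3 t^† v^† m)^†.

Section Props.
Variables p q : IC * ID.

Lemma lowE k s (t : hom (rC p.1 ⊗ rC q.1) (rC k)) (v : hom (rD q.2 ⊗ rD p.2) (rD s)) m :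
  actm t (idm m) v ∘ (assoc3 (rC p.1) (rC q.1) m (rD q.2) (rD p.2))^† = low t v m.
Proof. by rewrite /low -lift3E dag_comp actm_dag !dagK dag1. Qed.

Lemma up_nat k s (t : hom (rC k) (rC p.1 ⊗ rC q.1)) (v : hom (rD s) (rD q.2 ⊗ rD p.2))
  m n (h : hom m n) : Tm p (Tm q h) ∘ up t v m = up t v n ∘ Tm (k, s) h.
Proof. exact: lift3_nat. Qed.

Lemma lin_up1 k s (v : hom (rD s) (rD q.2 ⊗ rD p.2)) m :
  lin (fun t : hom (rC k) (rC p.1 ⊗ rC q.1) => up t v m).
Proof. exact: lin_lift3l. Qed.

Lemma lin_up2 k s (t : hom (rC k) (rC p.1 ⊗ rC q.1)) m :
  lin (fun v : hom (rD s) (rD q.2 ⊗ rD p.2) => up t v m).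
Proof. exact: lin_lift3r. Qed.

(** The sum over all fusion channels in the product of W, as nested canonical elements for C and
    D. *)
Definition tsum (V : lmodType R[i]) (B : forall (k : IC) (s : ID),
    hom (rC k) (rC p.1 ⊗ rC q.1) -> hom (rC p.1 ⊗ rC q.1) (rC k) ->
    hom (rD s) (rD q.2 ⊗ rD p.2) -> hom (rD q.2 ⊗ rD p.2) (rD s) -> V) : V :=
  can bC (fun k t t' => can bD (fun s v v' => B k s t t' v v')).

Lemma tsumE (V : lmodType R[i]) B : @tsum V B = \sum_k \sum_s \sum_i \sum_j
  B k s (tnth (dbas (bC k (rC p.1 ⊗ rC q.1))) i)
        (tnth (dbas' (bC k (rC p.1 ⊗ rC q.1))) i)
        (tnth (dbas (bD s (rD q.2 ⊗ rD p.2))) j)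
        (tnth (dbas' (bD s (rD q.2 ⊗ rD p.2))) j).
Proof. by apply: eq_bigr => k _; rewrite exchange_big. Qed.

Lemma eq_tsum (V : lmodType R[i]) B B' :
  (forall k s t t' v v', B k s t t' v v' = B' k s t t' v v') -> @tsum V B = tsum B'.
Proof. by move=> h; apply: eq_can => k t t'; apply: eq_can. Qed.

Lemma tsum_lin (V V' : lmodType R[i]) (L : V -> V') B : lin L ->
  L (tsum B) = tsum (fun k s t t' v v' => L (B k s t t' v v')).
Proof.
move=> hL; rewrite /tsum (can_lin _ _ hL); apply: eq_can => k t t'.
exact: can_lin.
Qed.

Lemma lin_tsum (U V : lmodType R[i])
  (B : U -> forall (k : IC) (s : ID),
    hom (rC k) (rC p.1 ⊗ rC q.1) -> hom (rC p.1 ⊗ rC q.1) (rC k) ->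
    hom (rD s) (rD q.2 ⊗ rD p.2) -> hom (rD q.2 ⊗ rD p.2) (rD s) -> V) :
  (forall k s t t' v v', lin (fun c => B c k s t t' v v')) -> lin (fun c => tsum (B c)).
Proof. by move=> h; do 4![apply: lin_bigsum => ? _]; exact: h. Qed.

Lemma tsum_complete m :
  tsum (fun k s t t' v v' => up t v m ∘ low t' v' m) = idm (Tob p (Tob q m)).
Proof.
pose aa := assoc3 (rC p.1) (rC q.1) m (rD q.2) (rD p.2).
have [_ a2] := assoc3_unitary (rC p.1) (rC q.1) m (rD q.2) (rD p.2).
transitivity (aa ∘ tsum (fun k s t t' v v' => actm (t ∘ t') (idm m) (v ∘ v')) ∘ aa^†).
  rewrite (tsum_lin _ (lin_compr aa)) (tsum_lin _ (lin_compl aa^†)).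
  apply: eq_tsum => k s t t' v v'; rewrite /up -lowE -lift3E -!compA; congr (_ ∘ _).
  by rewrite !compA actmE comp1m.
have -> : tsum (fun k s t t' v v' => actm (t ∘ t') (idm m) (v ∘ v'))
    = actm (idm (rC p.1 ⊗ rC q.1)) (idm m) (idm (rD q.2 ⊗ rD p.2)).
  rewrite -(irr_complete hC (fc_irr cC) bC) -(irr_complete hD (fc_irr cD) bD).
  rewrite (lin_sum (lin_actm1 _ _)); apply: eq_bigr => k _.
  rewrite (lin_sum (lin_actm1 _ _)); apply: eq_bigr => i _.
  rewrite (lin_sum (lin_actm3 _ _)); apply: eq_bigr => s _.
  by rewrite (lin_sum (lin_actm3 _ _)).
by rewrite actm1 compm1.
Qed.

End Props.

Section UnitComponent.
Variable q : IC * ID.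

Lemma Ru_rec q' m (c : hom m (Tob (dl q) (Tob q' m))) :
  Tm (dl q) ((Ru' q (Tob q' m))^† ∘ Tm q c) ∘ Ru q m = c.
Proof.
have zz := congr1 (fun f => f^†) (Ru'_zig q (Tob q' m)).
rewrite dag_comp dagK Tm_dag dag1 in zz.
by rewrite Tm_comp -compA Ru_nat compA zz comp1m.
Qed.

Section Unit1.
Variable q' : IC * ID.
Variables (t : hom (rC None) (rC (dl q).1 ⊗ rC q'.1)) (v : hom (rD None) (rD q'.2 ⊗ rD (dl q).2)).

Let rotC : hom (rC q.1) (rC q'.1) :=
  mlunit (rC q'.1) ∘ ((fc_R' q.1)^† ⊗m idm (rC q'.1))
  ∘ (massoc (rC q.1) (rC (dl q).1) (rC q'.1))^† ∘ (idm (rC q.1) ⊗m t) ∘ (mrunit (rC q.1))^†.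
Let rotD : hom (rD q.2) (rD q'.2) :=
  mrunit (rD q'.2) ∘ (idm (rD q'.2) ⊗m (fc_R q.2)^†)
  ∘ massoc (rD q'.2) (rD (dl q).2) (rD q.2) ∘ (v ⊗m idm (rD q.2)) ∘ (mlunit (rD q.2))^†.

Lemma up_unit_rot m :
  (Ru' q (Tob q' m))^† ∘ Tm q (up t v m ∘ (unit3 m)^†) = actm rotC (idm m) rotD.
Proof.
rewrite /Ru' -lock /up.
have -> : lift3 t v m ∘ (unit3 m)^† = coev t v m by rewrite lift3_coev.
exact: coev_rot.
Qed.

(** Bent around, a channel into the unit component becomes a pair of maps q.1 → q'.1 and q.2 → q'.2
    between simple objects, one of which is zero; [Ru_rec] recovers the channel from its bent
    form. *)
Lemma up_unit0 m : q != q' -> up t v m ∘ (unit3 m)^† = 0.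
Proof.
move=> qq; rewrite -(Ru_rec (q' := q') (up t v m ∘ (unit3 m)^†)) up_unit_rot.
have -> : actm rotC (idm m) rotD = 0; last by rewrite (lin0 (@Tm_lin _ _ _ _ _ _ _ _ _)) comp0m.
have [e1|n1] := eqVneq q.1 q'.1.
  rewrite (irr_hom0 (fc_irr cD) rotD) ?(lin0 (lin_actm3 _ _)) //.
  by apply: contraNneq qq => e2; rewrite [q]surjective_pairing e1 e2 -surjective_pairing.
by rewrite (irr_hom0 (fc_irr cC) rotC) ?(lin0 (lin_actm1 _ _)).
Qed.

End Unit1.

(** For q' = q the bent maps are scalars taken in C and D alone. Hence c does not depend on m, which
    lets the cap at z and the cup at w be treated together below. *)
Lemma up_unitZ (t : hom (rC None) (rC (dl q).1 ⊗ rC q.1))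
  (v : hom (rD None) (rD q.2 ⊗ rD (dl q).2)) :
  exists c : R[i], forall m, up t v m ∘ (unit3 m)^† = c *: Ru q m.
Proof.
have [_ /(_ _)hc] := irr_simple (fc_irr cC) q.1.
have [_ /(_ _)hd] := irr_simple (fc_irr cD) q.2.
have [c ec] := hc (mlunit (rC q.1) ∘ ((fc_R' q.1)^† ⊗m idm (rC q.1))
  ∘ (massoc (rC q.1) (rC (dl q).1) (rC q.1))^† ∘ (idm (rC q.1) ⊗m t) ∘ (mrunit (rC q.1))^†).
have [d ed] := hd (mrunit (rD q.2) ∘ (idm (rD q.2) ⊗m (fc_R q.2)^†)
  ∘ massoc (rD q.2) (rD (dl q).2) (rD q.2) ∘ (v ⊗m idm (rD q.2)) ∘ (mlunit (rD q.2))^†).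
exists (c * d) => m.
rewrite -(Ru_rec (q' := q) (up t v m ∘ (unit3 m)^†)) up_unit_rot ec ed.
rewrite (linZ (lin_actm1 _ _)) (linZ (lin_actm3 _ _)) actm1 scalerA.
by rewrite (linZ (@Tm_lin _ _ _ _ _ _ _ _ _)) compZl Tm_id comp1m.
Qed.

Lemma low_unitZ (t : hom (rC (dl q).1 ⊗ rC q.1) (rC None))
  (v : hom (rD q.2 ⊗ rD (dl q).2) (rD None)) :
  exists c : R[i], forall m, unit3 m ∘ low t v m = c *: (Ru q m)^†.
Proof.
have [c hc] := up_unitZ t^† v^†; exists (conjc c) => m.
by rewrite -dagZ -hc dag_comp dagK.
Qed.

Local Notation t_ i := (tnth (dbas (bC None (rC (dl q).1 ⊗ rC q.1))) i).
Local Notation t'_ i := (tnth (dbas' (bC None (rC (dl q).1 ⊗ rC q.1))) i).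
Local Notation v_ j := (tnth (dbas (bD None (rD q.2 ⊗ rD (dl q).2))) j).
Local Notation v'_ j := (tnth (dbas' (bD None (rD q.2 ⊗ rD (dl q).2))) j).

(** The channels into the unit are multiples of the cup [Ru], whose squared norm [dp q] accounts for
    the factor. The coefficients are summed without counting the basis elements: [mu] and [nu] are
    the coordinates of the solutions of the conjugate equations, and expanding [Ru] itself in the
    channels gives [hmu]. *)
Lemma unit_component z w (V : lmodType R[i])
  (L : hom (Tob (dl q) (Tob q (rM z))) (rM z) ->
       hom (rM w) (Tob (dl q) (Tob q (rM w))) -> V) :
  (forall g, lin (L^~ g)) -> (forall f, lin (L f)) ->
  \sum_i \sum_j L (unit3 (rM z) ∘ low (t'_ i) (v'_ j) (rM z))
                  (up (t_ i) (v_ j) (rM w) ∘ (unit3 (rM w))^†)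
  = ((dp q)%:C)^-1 *: L (Ru q (rM z))^† (Ru q (rM w)).
Proof.
move=> hL hL'.
have [c hc] := fin_all_exists (fun ij => up_unitZ (t_ (fst ij)) (v_ (snd ij))).
have [c' hc'] := fin_all_exists (fun ij => low_unitZ (t'_ (fst ij)) (v'_ (snd ij))).
pose mu i := scalar (t'_ i ∘ fc_R q.1).
pose nu j := scalar (v'_ j ∘ fc_R' q.2).
have h1C := irr_simple (fc_irr cC) None.
have h1D := irr_simple (fc_irr cD) None.
have dp0 : (dp q)%:C != 0 by rewrite gt_eqF // ltcR dp_gt0.
have RuE m : Ru q m = @up (dl q) q None None (fc_R q.1) (fc_R' q.2) m ∘ (unit3 m)^†.
  by rewrite /Ru -lock lift3_coev.
have hs := irr_simple hr z.
have Ru0 : Ru q (rM z) != 0.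
  apply: contraNneq (simple_idm_neq0 hs) => R0.
  have := Ru_norm q (rM z); rewrite R0 compm0 => /eqP.
  by rewrite eq_sym scaler_eq0 (negPf dp0).
have hmu : \sum_i \sum_j mu i * nu j * c (i, j) = 1.
  have : (\sum_i \sum_j mu i * nu j * c (i, j)) *: Ru q (rM z) = Ru q (rM z).
    rewrite [RHS]RuE (dbas_expand h1C (bC None _) (fc_R q.1)).
    rewrite (lin_sum (lin_up1 _ _)) comp_suml scaler_suml; apply: eq_bigr => i _.
    rewrite (dbas_expand h1D (bD None _) (fc_R' q.2)).
    rewrite (lin_sum (lin_up2 _ _)) comp_suml scaler_suml; apply: eq_bigr => j _.
    rewrite (linZ (lin_up1 _ _)) (linZ (lin_up2 _ _)) !compZl.
    by rewrite (hc (i, j)) !scalerA.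
  move/eqP; rewrite -subr_eq0 -{2}(scale1r (Ru q (rM z))) -scalerBl scaler_eq0 (negPf Ru0) orbF.
  by rewrite subr_eq0 => /eqP.
have hc'E i j : c' (i, j) * (dp q)%:C = mu i * nu j.
  have : (c' (i, j) * (dp q)%:C) *: idm (rM z) = (mu i * nu j) *: idm (rM z).
    rewrite -scalerA -Ru_norm -compZl -(hc' (i, j)) RuE /low /up -!compA.
    rewrite (comp_tail (lift3_dag_comp _ _ _ _ _)) !dagK /=.
    rewrite (scalarE (t'_ i ∘ _) h1C) (scalarE (v'_ j ∘ _) h1D).
    rewrite (linZ (lin_actm1 _ _)) (linZ (lin_actm3 _ _)) actm1 scalerA.
    have [_ u2] := unit3_unitary (rM z).
    by rewrite compZl comp1m compZr u2.
  move/(congr1 (@scalar _ _ _)); rewrite !scalar_idZ //.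
transitivity (\sum_i \sum_j (c' (i, j) * c (i, j)) *: L (Ru q (rM z))^† (Ru q (rM w))).
  apply: eq_bigr => i _; apply: eq_bigr => j _.
  by rewrite (hc (i, j)) (hc' (i, j)) (linZ (hL _)) (linZ (hL' _)) scalerA.
transitivity ((\sum_i \sum_j c' (i, j) * c (i, j)) *: L (Ru q (rM z))^† (Ru q (rM w))).
  by rewrite scaler_suml; apply: eq_bigr => i _; rewrite scaler_suml.
congr (_ *: _); apply: (mulIf dp0); rewrite mulVf // -hmu mulr_suml.
apply: eq_bigr => i _; rewrite mulr_suml; apply: eq_bigr => j _.
by rewrite mulrAC hc'E.
Qed.

End UnitComponent.
End Channels.

(** * Linear maps out of W and the product *)

Section TubeAlgebra.
Variables (R : realType) (C D : monoidal_category R) (M : bimodule_category C D).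
Hypotheses (hC : finitely_semisimple C) (hD : finitely_semisimple D).
Variables (cC : fusion_choices C) (cD : fusion_choices D) (cM : module_choices M).
Local Notation IC := (fc_Irr cC).
Local Notation ID := (fc_Irr cD).
Local Notation IM := (mc_Irr cM).
Local Notation rC := (fc_rep (f := cC)).
Local Notation rD := (fc_rep (f := cD)).
Local Notation rM := (mc_rep (m := cM)).
Local Notation bC := (fc_bases (f := cC)).
Local Notation bD := (fc_bases (f := cD)).
Local Notation hs := (irr_simple (mc_irr cM)).

Implicit Types (a : IC) (b : ID) (p q : IC * ID) (m n : M) (x z u w i : IM).

Lemma kronxx x : kron x x = idm (rM x).
Proof. by rewrite /kron; case: eqP => // e; rewrite (eq_irrelevance e erefl). Qed.

Lemma kron0 x y : x != y -> kron x y = 0 :> hom (rM x) (rM y).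
Proof. by rewrite /kron; case: eqP. Qed.

Lemma sum_kron (V : lmodType R[i]) x (F : forall y, hom (rM x) (rM y) -> V) :
  (forall y, lin (F y)) -> \sum_y F y (kron x y) = F x (idm _).
Proof.
move=> hF; rewrite (bigD1 x) //= kronxx big1 ?addr0 // => y yx.
by rewrite kron0 ?(lin0 (hF y)) // eq_sym.
Qed.

Lemma sum_kron' (V : lmodType R[i]) x (F : forall y, hom (rM y) (rM x) -> V) :
  (forall y, lin (F y)) -> \sum_y F y (kron y x) = F x (idm _).
Proof.
move=> hF; rewrite (bigD1 x) //= kronxx big1 ?addr0 // => y yx.
by rewrite kron0 ?(lin0 (hF y)).
Qed.

(** A linear map out of W is a family of bilinear maps on its summands; [Wlin] is the map induced by
    such a family. *)
Definition wfam (V : Type) := forall a b x z u w,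
  hom (rM x) (Tob (a, b) (rM z)) -> hom (Tob (a, b) (rM u)) (rM w) -> V.

Definition wbil (V : lmodType R[i]) (F : wfam V) : Prop := forall a b x z u w,
  (forall g, lin (fun f => F a b x z u w f g)) /\ (forall f, lin (F a b x z u w f)).

Local Notation WT := (W cC cD cM).

Section Linear.
Variables (V : lmodType R[i]) (F : wfam V).

Lemma Wlin_lin : lin (Wlin F : WT -> V).
Proof. exact: lin_ffun. Qed.

Lemma Wlin_bas beta : Wlin F (Wbas beta) = tube_case F beta.
Proof.
rewrite /Wlin (bigD1 beta) //= big1 ?addr0 => [|beta' bb].
  by rewrite ffunE eqxx scale1r.
by rewrite ffunE (negPf bb) scale0r.
Qed.

Hypothesis hF : wbil F.

(** Bilinearity frees evaluation from the bases in which W is realized. *)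
Lemma Wlin_pure a b x z u w (f : hom (rM x) (Tob (a, b) (rM z)))
  (g : hom (Tob (a, b) (rM u)) (rM w)) : Wlin F (pure f g) = F f g.
Proof.
have [h1 h2] := hF a b x z u w.
rewrite /pure (lin_sum Wlin_lin).
rewrite [in RHS](coord_basis (dbas_basis (bas3 x a z b)) (memvf f)) (lin_sum (h1 _)).
apply: eq_bigr => i _; rewrite (lin_sum Wlin_lin) (linZ (h1 _)).
rewrite [in RHS](coord_basis (dbas'_basis (bas3 w a u b)) (memvf g)) (lin_sum (h2 _)).
rewrite scaler_sumr; apply: eq_bigr => j _.
by rewrite (linZ Wlin_lin) Wlin_bas (linZ (h2 _)) scalerA /= -!tnth_nth.
Qed.

End Linear.

Lemma eq_Wlin (V : lmodType R[i]) (F F' : wfam V) (v : WT) :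
  (forall a b x z u w f g, F a b x z u w f g = F' a b x z u w f g) ->
  Wlin F v = Wlin F' v.
Proof.
move=> h; apply: eq_bigr => -[[[[[[a b] x] z] u] w] ij] _; congr (_ *: _).
exact: h.
Qed.

Lemma Wlin_comp (V V' : lmodType R[i]) (L : V -> V') (F : wfam V) (v : WT) : lin L ->
  L (Wlin F v) = Wlin (fun a b x z u w f g => L (F a b x z u w f g)) v.
Proof.
move=> hL; rewrite /Wlin (lin_sum hL); apply: eq_bigr => beta _.
by rewrite (linZ hL); case: beta => -[[[[[a b] x] z] u] w] ij.
Qed.

Lemma Wlin_sum (V : lmodType R[i]) (J : finType) (F : J -> wfam V) (v : WT) :
  Wlin (fun a b x z u w f g => \sum_j F j a b x z u w f g) v = \sum_j Wlin (F j) v.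
Proof.
rewrite /Wlin exchange_big; apply: eq_bigr => -[[[[[[a b] x] z] u] w] ij] _ /=.
by rewrite -scaler_sumr.
Qed.

Lemma Wlin_fam (U V : lmodType R[i]) (F : U -> wfam V) (v : WT) :
  (forall a b x z u w f g, lin (fun c => F c a b x z u w f g)) ->
  lin (fun c => Wlin (F c) v).
Proof.
move=> h; apply: lin_bigsum => -[[[[[[a b] x] z] u] w] ij] _ /=.
by apply: lin_scale; exact: h.
Qed.

Lemma pure_bil : wbil (fun a b x z u w f g => pure f g : WT).
Proof.
move=> a b x z u w; split=> e; do 2![apply: lin_bigsum => ? _]; apply: lin_scalel.
  by apply: lin_mulr => c f f'; rewrite linearP.
by apply: lin_mull => c f f'; rewrite linearP.
Qed.

Lemma sum_delta2 (V : lmodType R[i]) (m n : nat) (c : 'I_m -> R[i]) (c' : 'I_n -> R[i])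
  (v : 'I_m -> 'I_n -> V) (i : 'I_m) (j : 'I_n) :
  (forall k, c k = (k == i)%:R) -> (forall k, c' k = (k == j)%:R) ->
  \sum_k \sum_l (c k * c' l) *: v k l = v i j.
Proof.
move=> hc hc'; rewrite (bigD1 i) //= (bigD1 j) //= hc hc' !eqxx mulr1 scale1r.
rewrite big1 ?addr0 => [|l lj]; last by rewrite hc' (negPf lj) mulr0 scale0r.
rewrite big1 ?addr0 // => k ki; rewrite big1 // => l _.
by rewrite hc (negPf ki) mul0r scale0r.
Qed.

Lemma coord_dbas k y (B : dual_bases (rM k) y) (i j : 'I_(mult B)) :
  coord (dbas B) j (tnth (dbas B) i) = (j == i)%:R.
Proof. by rewrite (dbas_coordE (hs k)) dbas_dual (scalar_idZ _ (hs k)). Qed.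

Lemma coord_dbas' k y (B : dual_bases (rM k) y) (i j : 'I_(mult B)) :
  coord (dbas' B) j (tnth (dbas' B) i) = (j == i)%:R.
Proof. by rewrite (dbas'_coordE (hs k)) dbas_dual (scalar_idZ _ (hs k)) eq_sym. Qed.

Lemma WbasE a b x z u w ij :
  Wbas (existT (tube_mult (cM := cM)) (a, b, x, z, u, w) ij)
  = pure (tnth (dbas (bas3 x a z b)) ij.1) (tnth (dbas' (bas3 w a u b)) ij.2).
Proof.
have := @sum_delta2 (W cC cD cM) _ _ _ _ (fun k l => Wbas (existT (tube_mult (cM := cM)) (a, b, x, z, u, w) (k, l)))
  ij.1 ij.2 (@coord_dbas _ _ (bas3 x a z b) ij.1) (@coord_dbas' _ _ (bas3 w a u b) ij.2).
by case: ij => i j h; rewrite /pure h.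
Qed.

Lemma Wlin_id (v : WT) : Wlin (fun a b x z u w f g => pure f g : WT) v = v.
Proof.
apply/ffunP => beta; rewrite /Wlin sum_ffunE.
rewrite (eq_bigr (fun beta' => v beta' * (beta == beta')%:R)).
  rewrite (bigD1 beta) //= eqxx mulr1 big1 ?addr0 // => b' bb.
  by rewrite eq_sym (negPf bb) mulr0.
move=> -[[[[[[a b] x] z] u] w] ij] _; rewrite ffunE /= -WbasE.
by rewrite ffunE.
Qed.

Lemma Wlin_unique (V : lmodType R[i]) (L : WT -> V) (v : WT) : lin L ->
  L v = Wlin (fun a b x z u w f g => L (pure f g)) v.
Proof. by move=> hL; rewrite -{1}(Wlin_id v) (Wlin_comp _ _ hL). Qed.

Section Product.
Variables (a : IC) (b : ID) (a' : IC) (b' : ID).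

Lemma pure_mulE x z u w (f : hom (rM x) (Tob (a, b) (rM z)))
  (g : hom (Tob (a, b) (rM u)) (rM w)) x' z' u' w'
  (f' : hom (rM x') (Tob (a', b') (rM z'))) (g' : hom (Tob (a', b') (rM u')) (rM w')) :
  pure_mul f g f' g' = tsum (p := (a, b)) (q := (a', b')) (fun kC kD t t' v v' =>
    pure (low (p := (a, b)) (q := (a', b')) t' v' (rM z') ∘ Tm (a, b) (f' ∘ kron z x') ∘ f)
         (g ∘ Tm (a, b) (kron w' u ∘ g') ∘ up (p := (a, b)) (q := (a', b')) t v (rM u')) : WT).
Proof.
rewrite tsumE; do 4![apply: eq_bigr => ? _]; congr pure.
  by rewrite -lowE assoc3E.
by rewrite /up -lift3E assoc3E -!compA.
Qed.

End Product.

Lemma pure_mul_bil a' b' x' z' u' w' (f' : hom (rM x') (Tob (a', b') (rM z')))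
  (g' : hom (Tob (a', b') (rM u')) (rM w')) :
  wbil (fun a b x z u w f g => pure_mul f g f' g').
Proof.
move=> a b x z u w; split=> [g|f] c e e'; rewrite !pure_mulE.
  move: c e e'; apply: lin_tsum => k s t t' v v'.
  exact: (lin_comp ((pure_bil _ _ _ _ _ _).1 _) (lin_compr _)).
move: c e e'; apply: lin_tsum => k s t t' v v'.
exact: (lin_comp ((pure_bil _ _ _ _ _ _).2 _) (lin_comp (lin_compl _) (lin_compl _))).
Qed.

Lemma Wmul_pure a b x z u w (f : hom (rM x) (Tob (a, b) (rM z)))
  (g : hom (Tob (a, b) (rM u)) (rM w)) (v : WT) :
  Wmul (pure f g) v
  = Wlin (fun a' b' x' z' u' w' f' g' => pure_mul f g f' g') v.
Proof.
rewrite /Wmul Wlin_pure // => a1 b1 x1 z1 u1 w1.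
split=> e; apply: Wlin_fam => a' b' x' z' u' w' f' g'.
  by have [h1 _] := pure_mul_bil f' g' a1 b1 x1 z1 u1 w1.
by have [_ h2] := pure_mul_bil f' g' a1 b1 x1 z1 u1 w1.
Qed.

Lemma Wmul_linl (v' : WT) : lin (fun v : WT => Wmul v v').
Proof. exact: Wlin_lin. Qed.

Lemma Wmul_linr (v : WT) : lin (Wmul v).
Proof.
by apply: Wlin_fam => a b x z u w f g; exact: Wlin_lin.
Qed.

(* id_x ⊗ id_u, in the component a = b = 1. *)
Definition punit x u : WT := @pure _ _ _ _ _ _ cM None None x x u u (unit3 (rM x))^† (unit3 (rM u)).

Lemma unit3_Tm m n (h : hom m n) :
  unit3 n ∘ Tm (None : IC, None : ID) h = h ∘ unit3 m.
Proof. exact: unit3_nat. Qed.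

Lemma unit3_Tm_dag m n (h : hom m n) :
  Tm (None : IC, None : ID) h ∘ (unit3 m)^† = (unit3 n)^† ∘ h.
Proof. by rewrite unit3_nat_dag. Qed.

Lemma WoneE : Wone cC cD cM = \sum_x \sum_u punit x u.
Proof. by rewrite /Wone /punit; do 2!apply: eq_bigr => ? _; rewrite !unit3E. Qed.

(** Left multiplication by id ⊗ id projects onto the summands with x = x0 and w = u0. The unitors
    carry the channels of 1 ⊗ a and b ⊗ 1 to those of the simple objects a and b, whose canonical
    element is id ⊗ id. *)
Lemma Wmul_punit x0 u0 (v : WT) :
  Wmul (punit x0 u0) v
  = Wlin (fun a b x z u w f g => pure (f ∘ kron x0 x) (kron w u0 ∘ g) : WT) v.
Proof.
rewrite /punit Wmul_pure; apply: eq_Wlin => a b x z u w f g.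
rewrite pure_mulE.
transitivity (tsum (p := (None, None)) (q := (a, b)) (fun kC kD t t' v v' =>
    pure (actm (t' ∘ (mlunit (rC a))^†) (idm (rM z)) (v' ∘ (mrunit (rD b))^†) ∘ (f ∘ kron x0 x))
         (kron w u0 ∘ g ∘ actm (mlunit (rC a) ∘ t) (idm (rM u)) (mrunit (rD b) ∘ v)) : WT)).
  apply: eq_tsum => kC kD t t' s s'; congr pure.
    rewrite -compA unit3_Tm_dag.
    rewrite [LHS]compA; congr (_ ∘ _); apply: dag_inj.
    rewrite dag_comp dagK /low dagK.
    have -> := unit3_lift3 (a := rC a) (b := rD b) t'^† s'^† (rM z).
    by rewrite actm_dag !dag_comp !dagK dag1.
  rewrite unit3_Tm.
  rewrite -(compA (kron w u0 ∘ g)); congr (_ ∘ _).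
  exact: (unit3_lift3 (a := rC a) (b := rD b) t s (rM u)).
rewrite /tsum.
pose BD (kC : IC) (t : hom (rC kC) (rC a)) (t' : hom (rC a) (rC kC)) (kD : ID)
   (s : hom (rD kD) (rD b)) (s' : hom (rD b) (rD kD)) : WT :=
  @pure _ _ _ _ _ _ cM kC kD x0 z u u0 (actm t' (idm (rM z)) s' ∘ (f ∘ kron x0 x))
       (kron w u0 ∘ g ∘ actm t (idm (rM u)) s).
have BDbil kC t t' kD : bilin (BD kC t t' kD).
  split=> e.
    exact: (lin_comp ((pure_bil _ _ _ _ _ _).2 _) (lin_comp (lin_compr _) (lin_actm3 _ _))).
  exact: (lin_comp ((pure_bil _ _ _ _ _ _).1 _) (lin_comp (lin_compl _) (lin_actm3 _ _))).
pose BC (kC : IC) (t : hom (rC kC) (rC a)) (t' : hom (rC a) (rC kC)) : WT :=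
  BD kC t t' b (idm _) (idm _).
have BCbil kC : bilin (BC kC).
  split=> e.
    exact: (lin_comp ((pure_bil _ _ _ _ _ _).2 _) (lin_comp (lin_compr _) (lin_actm1 _ _))).
  exact: (lin_comp ((pure_bil _ _ _ _ _ _).1 _) (lin_comp (lin_compl _) (lin_actm1 _ _))).
have [_ m2] := mlunit_unitary (rC a); have [_ r2] := mrunit_unitary (rD b).
have m1 : (mlunit (rC a)) ∘ (mlunit (rC a))^† = idm _ by [].
transitivity (can bC (y := munit C ⊗ rC a) (fun kC t t' =>
    BC kC (mlunit (rC a) ∘ t) (t' ∘ (mlunit (rC a))^†))).
  apply: eq_can => kC t t'; rewrite /BC -(can_rep hD (fc_irr cD) bD (BDbil kC _ _)).
  rewrite (can_iso hD (fc_irr cD) bD (a := mrunit (rD b)) (a' := (mrunit (rD b))^†)) //.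
rewrite -(can_iso hC (fc_irr cC) bC BCbil m2) (can_rep hC (fc_irr cC) bC BCbil).
by rewrite /BC /BD !actm1 comp1m compm1.
Qed.

End TubeAlgebra.

(** * The coproduct, the counital maps and invariance of J *)

Section HaarIntegral.
Variables (R : realType) (C D : monoidal_category R) (M : bimodule_category C D).
Hypotheses (hC : finitely_semisimple C) (hD : finitely_semisimple D).
Hypothesis hM : finitely_semisimple M.
Variables (cC : fusion_choices C) (cD : fusion_choices D) (cM : module_choices M).
Local Notation IC := (fc_Irr cC).
Local Notation ID := (fc_Irr cD).
Local Notation IM := (mc_Irr cM).
Local Notation rM := (mc_rep (m := cM)).
Local Notation bM := (mc_bases (m := cM)).
Local Notation hr := (mc_irr cM).

Implicit Types (a : IC) (b : ID) (p q : IC * ID) (m n : M) (x z u w i : IM).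

Local Notation WT := (W cC cD cM).

Section Coproduct.
Variables (V : lmodType R[i]) (B : WT -> WT -> V).
Hypotheses (hB1 : forall v', lin (B^~ v')) (hB2 : forall v, lin (B v)).

Let L (om : WW cC cD cM) : V := \sum_p om p *: B (Wbas p.1) (Wbas p.2).

Lemma Wbas_expand (v : WT) : v = \sum_beta v beta *: Wbas beta.
Proof. exact: ffun_expand. Qed.

Let L_lin : lin L.
Proof. exact: lin_ffun. Qed.

Let L_tens v v' : L (Wtens v v') = B v v'.
Proof.
transitivity (\sum_b \sum_b' (v b * v' b') *: B (Wbas b) (Wbas b')).
  by rewrite pair_bigA; apply: eq_bigr => p _; rewrite ffunE.
rewrite [in RHS](Wbas_expand v) [in RHS](Wbas_expand v').
rewrite (lin_sum (hB1 _)); apply: eq_bigr => b _.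
rewrite (lin_sum (hB2 _)); apply: eq_bigr => b' _.
by rewrite (linZ (hB1 _)) (linZ (hB2 _)) scalerA.
Qed.

Lemma sweedlerE (v : WT) : sweedler B v = Wlin (fun a b x z u w f g =>
  \sum_i \sum_k \sum_e B (pure (tnth (dbas (bas3 k a i b)) e) g)
                         (pure f (tnth (dbas' (bas3 k a i b)) e))) v.
Proof.
rewrite /sweedler -/(L _) /Wcomul (Wlin_comp _ _ L_lin); apply: eq_Wlin => a b x z u w f g.
rewrite (lin_sum L_lin); apply: eq_bigr => i _.
rewrite (lin_sum L_lin); apply: eq_bigr => k _.
rewrite (lin_sum L_lin); apply: eq_bigr => e _.
exact: L_tens.
Qed.

(** At a = b = 1 the canonical element of 1 ⊗ i ⊗ 1 collapses through the unitors, so the two halves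
    of Δ(1) are linked by the index i alone. *)
Lemma sweedler_one : sweedler B (Wone cC cD cM)
  = \sum_x \sum_u \sum_i B (punit cC cD i u) (punit cC cD x i).
Proof.
rewrite WoneE sweedlerE (lin_sum (@Wlin_lin _ _ _ _ _ _ _ _ _)); apply: eq_bigr => x _.
rewrite (lin_sum (@Wlin_lin _ _ _ _ _ _ _ _ _)); apply: eq_bigr => u _.
rewrite /punit Wlin_pure; last first.
  move=> a b x1 z1 u1 w1; split=> e; do 3![apply: lin_bigsum => ? _].
    exact: (lin_comp (hB2 _) ((pure_bil _ _ _ _ _ _).1 _)).
  exact: (lin_comp (hB1 _) ((pure_bil _ _ _ _ _ _).2 _)).
apply: eq_bigr => i _.
pose F k (e : hom (rM k) (Tob (None : IC, None : ID) (rM i)))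
    (e' : hom (Tob (None : IC, None : ID) (rM i)) (rM k)) : V :=
  B (@pure _ _ _ _ _ _ cM None None k i u u e (unit3 (rM u)))
    (@pure _ _ _ _ _ _ cM None None x x i k (unit3 (rM x))^† e').
have hF k : bilin (F k).
  split=> e; first exact: (lin_comp (hB1 _) ((pure_bil _ _ _ _ _ _).1 _)).
  exact: (lin_comp (hB2 _) ((pure_bil _ _ _ _ _ _).2 _)).
have [u1 u2] := unit3_unitary (rM i).
transitivity (can bM F); first by [].
rewrite (can_iso hM hr bM hF u1) (can_rep hM hr bM (k := i)).
  by rewrite /F compm1 comp1m.
move=> l; split=> e.
  exact: (lin_comp ((hF l).1 _) (lin_compr _)).
exact: (lin_comp ((hF l).2 _) (lin_compl _)).
Qed.

End Coproduct.

Definition epsfam : wfam cC cD cM R[i]^o := fun a b x z u w f g =>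
  scalar (kron w x ∘ g ∘ Tm (a, b) (kron z u) ∘ f).

Lemma epsfam_bil : wbil epsfam.
Proof.
move=> a b x z u w; split=> e.
  exact: (lin_comp (@lin_scalar _ _ _) (lin_compr _)).
exact: (lin_comp (@lin_scalar _ _ _) (lin_comp (lin_compl _) (lin_comp (lin_compl _) (lin_compr _)))).
Qed.

Lemma Weps_pure a b x z u w (f : hom (rM x) (Tob (a, b) (rM z)))
  (g : hom (Tob (a, b) (rM u)) (rM w)) : Weps (pure f g : WT) = epsfam f g.
Proof. exact: (Wlin_pure epsfam_bil). Qed.

(* The coefficient of 1^(2) = Σ_x id_x ⊗ id_i in ε_L(f ⊗ g). *)
Definition epsL (i : IM) : wfam cC cD cM R[i]^o := fun a b x z u w f g =>
  scalar (kron w i ∘ g ∘ Tm (a, b) (kron z u) ∘ f ∘ kron i x).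

Lemma Weps_lin : lin (fun v : WT => (Weps v : R[i]^o)).
Proof. exact: Wlin_lin. Qed.

Lemma Weps_LE (v : WT) :
  Weps_L v = \sum_i Wlin (epsL i) v *: \sum_x punit cC cD x i.
Proof.
have h1 (v' : WT) : lin (fun v1 : WT => Weps (Wmul v1 v) *: v').
  by apply: lin_scalel; exact: (lin_comp Weps_lin (Wmul_linl _)).
have h2 (v1 : WT) : lin (fun v' : WT => Weps (Wmul v1 v) *: v').
  by apply: lin_scale; exact: lin_id.
rewrite /Weps_L (sweedler_one h1 h2) {h1 h2}.
rewrite (sum_regroup (fun i u => Weps (Wmul (punit cC cD i u) v)) (fun x i => punit cC cD x i)).
apply: eq_bigr => i _; congr (_ *: _).
transitivity (\sum_u Wlin (fun a b x z u0 w f g =>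
   scalar (kron u i ∘ kron w u ∘ g ∘ Tm (a, b) (kron z u0) ∘ f ∘ kron i x) : R[i]^o) v).
  apply: eq_bigr => u _; rewrite Wmul_punit // (Wlin_comp _ _ Weps_lin).
  apply: eq_Wlin => a b x1 z1 u1 w1 f g; rewrite Weps_pure /epsfam.
  by rewrite -!compA.
rewrite -Wlin_sum; apply: eq_Wlin => a b x1 z1 u1 w1 f g; rewrite /epsL.
rewrite (sum_kron (F := fun y h => scalar (kron y i ∘ h ∘ g ∘ Tm (a, b) (kron z1 u1) ∘ f ∘ kron i x1) : R[i]^o)).
  by rewrite compm1.
move=> y; apply: (lin_comp (@lin_scalar _ _ _)); do 4![apply: (lin_comp (lin_compl _))].
exact: lin_compr.
Qed.

Lemma pure_mul_bil_r a b x z u w (f : hom (rM x) (Tob (a, b) (rM z)))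
  (g : hom (Tob (a, b) (rM u)) (rM w)) :
  wbil (fun a' b' x' z' u' w' f' g' => pure_mul f g f' g' : WT).
Proof.
move=> a' b' x' z' u' w'; split=> [g'|f'] c e e'; rewrite !pure_mulE.
  move: c e e'; apply: lin_tsum => kC kD t t' v v'.
  apply: (lin_comp ((pure_bil _ _ _ _ _ _).1 _)); apply: (lin_comp (lin_compl _)).
  apply: (lin_comp (lin_compr _)); apply: (lin_comp (@Tm_lin _ _ _ _ _ _ _ _ _)).
  exact: lin_compl.
move: c e e'; apply: lin_tsum => kC kD t t' v v'.
apply: (lin_comp ((pure_bil _ _ _ _ _ _).2 _)); apply: (lin_comp (lin_compl _)).
apply: (lin_comp (lin_compr _)); apply: (lin_comp (@Tm_lin _ _ _ _ _ _ _ _ _)).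
exact: lin_compr.
Qed.

Definition epsR (x0 i : IM) : wfam cC cD cM R[i]^o := fun a b x z u w f g =>
  scalar (kron w x ∘ g ∘ Tm (a, b) (kron i u ∘ kron x0 i ∘ kron z x0) ∘ f).

(** The counit composes the two tensor factors of W, so the maps [up] and [low] of the product meet
    and sum to the identity. *)
Lemma Weps_mul_punit (v : WT) x0 i :
  Weps (Wmul v (punit cC cD x0 i)) = Wlin (epsR x0 i) v.
Proof.
rewrite (Wlin_unique v (L := fun v => Weps (Wmul v (punit cC cD x0 i)) : R[i]^o)); last first.
  exact: (lin_comp Weps_lin (Wmul_linl _)).
apply: eq_Wlin => a b x z u w f g; rewrite Wmul_pure /punit Wlin_pure; last exact: pure_mul_bil_r.
rewrite pure_mulE (tsum_lin _ Weps_lin).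
transitivity (tsum (p := (a, b)) (q := (None, None)) (fun kC kD t t' v v' =>
    scalar (kron w x ∘ g ∘ Tm (a, b) (kron i u ∘ unit3 (rM i))
     ∘ Tm (a, b) (Tm (None : IC, None : ID) (kron x0 i))
     ∘ (up (p := (a, b)) (q := (None, None)) t v (rM x0)
        ∘ low (p := (a, b)) (q := (None, None)) t' v' (rM x0))
     ∘ Tm (a, b) ((unit3 (rM x0))^† ∘ kron z x0) ∘ f) : R[i]^o)).
  apply: eq_tsum => kC kD t t' v1 v2; rewrite Weps_pure /epsfam; congr scalar.
  have un := up_nat (p := (a, b)) (q := (None, None)) t v1 (kron x0 i).
  by rewrite -!compA (comp_tail un) -!compA.
pose A := kron w x ∘ g ∘ Tm (a, b) (kron i u ∘ unit3 (rM i))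
     ∘ Tm (a, b) (Tm (None : IC, None : ID) (kron x0 i)).
pose E := Tm (a, b) ((unit3 (rM x0))^† ∘ kron z x0) ∘ f.
have hl : lin (fun h => scalar (A ∘ h ∘ E) : R[i]^o).
  apply: (lin_comp (@lin_scalar _ _ _)); apply: (lin_comp (lin_compl _)); exact: lin_compr.
transitivity (scalar (A ∘ tsum (p := (a, b)) (q := (None : IC, None : ID))
   (fun kC kD t t' v v' => (up t v (rM x0) ∘ low t' v' (rM x0))) ∘ E)).
  rewrite [RHS](tsum_lin _ hl); apply: eq_tsum => kC kD t t' v1 v2.
  by rewrite /A /E -!compA.
rewrite tsum_complete // compm1 /A /E /epsR; congr scalar.
have [_ u2] := unit3_unitary (rM x0).
rewrite -!compA; congr (_ ∘ (_ ∘ _)); rewrite !compA -!Tm_comp; congr (Tm _ _ ∘ _).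
by rewrite -!compA (comp_tail (unit3_Tm _ _ _)) -!compA (compKl _ u2).
Qed.

Lemma Weps_RE (v : WT) :
  Weps_R v = \sum_x \sum_u \sum_i Wlin (epsR x i) v *: punit cC cD i u.
Proof.
have h1 (v2 : WT) : lin (fun v1 : WT => Weps (Wmul v v2) *: v1).
  by apply: lin_scale; exact: lin_id.
have h2 (v1 : WT) : lin (fun v2 : WT => Weps (Wmul v v2) *: v1).
  by apply: lin_scalel; exact: (lin_comp Weps_lin (Wmul_linr _)).
rewrite /Weps_R (sweedler_one h1 h2).
by do 3![apply: eq_bigr => ? _]; rewrite Weps_mul_punit.
Qed.

Section Haar.
Variable J : WT.
Hypothesis hJ : haar_integral J.

(* Left invariance of J, tested on a bilinear family. *)
Lemma Wlin_inv (V : lmodType R[i]) (B : wfam cC cD cM V) (hB : wbil B) a b x z u w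
  (f : hom (rM x) (Tob (a, b) (rM z))) (g : hom (Tob (a, b) (rM u)) (rM w)) :
  Wlin (fun a' b' x' z' u' w' f' g' =>
    tsum (p := (a, b)) (q := (a', b')) (fun kC kD t t' v v' =>
    B kC kD x z' u' w
      (low (p := (a, b)) (q := (a', b')) t' v' (rM z') ∘ Tm (a, b) (f' ∘ kron z x') ∘ f)
      (g ∘ Tm (a, b) (kron w' u ∘ g') ∘ up (p := (a, b)) (q := (a', b')) t v (rM u')))) J
  = \sum_i epsL i f g *: Wlin (fun a' b' x' z' u' w' f' g' =>
      B a' b' x' z' u' i f' (kron w' i ∘ g')) J.
Proof.
have [inv _ _ _] := hJ; have := congr1 (Wlin B) (inv (pure f g)).
rewrite Wmul_pure (Wlin_comp _ _ (Wlin_lin B)) => h; etransitivity; last first.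
  etransitivity; first exact: h.
  rewrite Weps_LE (lin_sum (Wmul_linl J)) (lin_sum (Wlin_lin B)).
  apply: eq_bigr => i _; rewrite (linZ (Wmul_linl J)) (linZ (Wlin_lin B)).
  rewrite Wlin_pure; last first.
    move=> a1 b1 x1 z1 u1 w1; split=> e; apply: (lin_comp (@lin_scalar _ _ _)).
      exact: (lin_comp (lin_compl _) (lin_compr _)).
    by do 3![apply: (lin_comp (lin_compl _))]; exact: lin_compr.
  congr (_ *: _); rewrite (lin_sum (Wmul_linl J)).
  rewrite (eq_bigr _ (fun x0 _ => Wmul_punit hC hD x0 i J)) -Wlin_sum (Wlin_comp _ _ (Wlin_lin B)).
  apply: eq_Wlin => a' b' x' z' u' w' f' g'.
  rewrite (lin_sum (Wlin_lin B)).
  have hl y : lin (fun h => B a' b' y z' u' i (f' ∘ h) (kron w' i ∘ g')).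
    exact: (lin_comp ((hB _ _ _ _ _ _).1 _) (lin_compr _)).
  rewrite -[X in _ = B _ _ _ _ _ _ X _]compm1 -(sum_kron' hl).
  by apply: eq_bigr => y _; rewrite Wlin_pure.
apply: eq_Wlin => a' b' x' z' u' w' f' g'.
rewrite pure_mulE (tsum_lin _ (Wlin_lin B)); apply: eq_tsum => kC kD t t' v v'.
by rewrite Wlin_pure.
Qed.

End Haar.
End HaarIntegral.

(** * The Haar integral *)

Section HaarExplicit.
Variables (R : realType) (C D : monoidal_category R) (M : bimodule_category C D).
Hypotheses (hC : finitely_semisimple C) (hD : finitely_semisimple D).
Hypothesis hM : finitely_semisimple M.
Variables (cC : fusion_choices C) (cD : fusion_choices D) (cM : module_choices M).
Local Notation IC := (fc_Irr cC).
Local Notation ID := (fc_Irr cD).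
Local Notation IM := (mc_Irr cM).
Local Notation rC := (fc_rep (f := cC)).
Local Notation rD := (fc_rep (f := cD)).
Local Notation rM := (mc_rep (m := cM)).
Local Notation bC := (fc_bases (f := cC)).
Local Notation bD := (fc_bases (f := cD)).
Local Notation hs := (irr_simple (mc_irr cM)).

Implicit Types (a : IC) (b : ID) (p q : IC * ID) (m n : M) (x z u w i : IM).

Local Notation WT := (W cC cD cM).
Variable d : IM -> R.
Hypothesis hd : forall x, 0 < d x.
Hypothesis hdL : left_dimension cC d.
Hypothesis hdR : right_dimension cD d.
Variable J : WT.
Hypothesis hJ : haar_integral J.

(** The functional supported in the component a = b = 1 that reads off the coefficient of each id_x
    ⊗ id_u: there Hom(x, 1 ⊗ z ⊗ 1) is zero or a line spanned by the unitor. The other components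
    are sent to 0 by matching on [None]. *)
Definition unitfam : wfam cC cD cM R[i]^o := fun a b =>
  match a, b return forall x z u w, hom (rM x) (Tob (a, b) (rM z)) ->
     hom (Tob (a, b) (rM u)) (rM w) -> R[i]^o with
  | None, None => fun x z u w f g =>
      scalar (kron z x ∘ unit3 (rM z) ∘ f) * scalar (g ∘ (unit3 (rM u))^† ∘ kron w u)
  | _, _ => fun _ _ _ _ _ _ => 0
  end.

Lemma unitfam_bil : wbil unitfam.
Proof.
move=> [a|] [b|] x z u w; split=> e; try exact: lin_zero.
  apply: lin_mulr; exact: (lin_comp (@lin_scalar _ _ _) (lin_compr _)).
apply: lin_mull; apply: (lin_comp (@lin_scalar _ _ _)).
exact: (lin_comp (lin_compl _) (lin_compl _)).
Qed.

(** The total coefficient in J, over all x, of id_x ⊗ id_i; these are the scalars j_i. *)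
Definition jc (i : IM) : R[i] :=
  Wlin (fun a' b' x' z' u' w' f' g' => unitfam f' (kron w' i ∘ g')) J.

Local Notation E a b x z j := (tnth (dbas (bas3 x a z b)) j).
Local Notation E' a b x z j := (tnth (dbas' (bas3 x a z b)) j).

Section UnitComponent.
Variables (q p : IC * ID) (x z w u : IM).
Variables (f : hom (rM x) (Tob (dl q) (Tob p (rM z)))) (g : hom (Tob (dl q) (Tob p (rM u))) (rM w)).

Lemma tsum_unitfam : tsum (p := dl q) (q := p) (fun kC kD t t' v v' =>
    unitfam (low (p := dl q) (q := p) t' v' (rM z) ∘ f) (g ∘ up (p := dl q) (q := p) t v (rM u)))
  = \sum_i \sum_j
     scalar (kron z x ∘ (unit3 (rM z) ∘ low (p := dl q) (q := p)
               (tnth (dbas' (bC None (rC (dl q).1 ⊗ rC p.1))) i)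
               (tnth (dbas' (bD None (rD p.2 ⊗ rD (dl q).2))) j) (rM z)) ∘ f) *
     scalar (g ∘ (up (p := dl q) (q := p)
               (tnth (dbas (bC None (rC (dl q).1 ⊗ rC p.1))) i)
               (tnth (dbas (bD None (rD p.2 ⊗ rD (dl q).2))) j) (rM u) ∘ (unit3 (rM u))^†) ∘ kron w u).
Proof.
rewrite tsumE (bigD1 None) //= [X in _ + X]big1 ?addr0 => [|[a|] //]; last first.
  by move=> _; do 3![rewrite big1 // => ? _].
rewrite (bigD1 None) //= [X in _ + X]big1 ?addr0 => [|[b|] //]; last first.
  by move=> _; do 2![rewrite big1 // => ? _].
apply: eq_bigr => i _; apply: eq_bigr => j _.
by rewrite /unitfam !compA.
Qed.

Lemma tsum_unitfam0 : q != p -> tsum (p := dl q) (q := p) (fun kC kD t t' v v' =>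
    unitfam (low (p := dl q) (q := p) t' v' (rM z) ∘ f) (g ∘ up (p := dl q) (q := p) t v (rM u))) = 0.
Proof.
move=> qp; rewrite tsum_unitfam; do 2![rewrite big1 // => ? _].
by rewrite up_unit0 // compm0 comp0m scalar0 mulr0.
Qed.

End UnitComponent.

Lemma tsum_unitfam1 q x z w u
  (f : hom (rM x) (Tob (dl q) (Tob q (rM z)))) (g : hom (Tob (dl q) (Tob q (rM u))) (rM w)) :
  tsum (p := dl q) (q := q) (fun kC kD t t' v v' =>
    unitfam (low (p := dl q) (q := q) t' v' (rM z) ∘ f) (g ∘ up (p := dl q) (q := q) t v (rM u)))
  = ((dp q)%:C)^-1 * (scalar (kron z x ∘ (Ru q (rM z))^† ∘ f) *
      scalar (g ∘ Ru q (rM u) ∘ kron w u)).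
Proof.
rewrite tsum_unitfam.
pose L (h : hom (Tob (dl q) (Tob q (rM z))) (rM z)) (h' : hom (rM u) (Tob (dl q) (Tob q (rM u)))) : R[i]^o :=
  scalar (kron z x ∘ h ∘ f) * scalar (g ∘ h' ∘ kron w u).
have hL1 e : lin (L^~ e).
  apply: lin_mulr; apply: (lin_comp (@lin_scalar _ _ _)).
  exact: (lin_comp (lin_compl _) (lin_compr _)).
have hL2 e : lin (L e).
  apply: lin_mull; apply: (lin_comp (@lin_scalar _ _ _)).
  exact: (lin_comp (lin_compl _) (lin_compr _)).
exact: (unit_component hL1 hL2).
Qed.

Section Coordinate.
Variables (a : IC) (b : ID) (x z u w : IM).
Variables (j : 'I_(mult (bas3 x a z b))) (l : 'I_(mult (bas3 w a u b))).
Let q : IC * ID := (a, b).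
(** Bent dual basis elements. Multiplied on the left of e_j ⊗ e'_l, they produce closed loops in the
    unit component; on other basis elements that component vanishes. *)
Let f : hom (rM z) (Tob (dl q) (rM x)) := Tm (dl q) (E' a b x z j) ∘ Ru q (rM z).
Let g : hom (Tob (dl q) (rM w)) (rM u) := (Ru q (rM u))^† ∘ Tm (dl q) (E a b w u l).

Let val : wfam cC cD cM R[i]^o := fun a' b' x' z' u' w' f' g' =>
  tsum (p := dl q) (q := (a', b')) (fun kC kD t t' v v' =>
    @unitfam kC kD z z' u' u
      (low (p := dl q) (q := (a', b')) t' v' (rM z') ∘ Tm (dl q) (f' ∘ kron x x') ∘ f)
      (g ∘ Tm (dl q) (kron w' w ∘ g') ∘ up (p := dl q) (q := (a', b')) t v (rM u'))).

Let val0 a' b' x' z' u' w' f' g' : q != (a', b') -> @val a' b' x' z' u' w' f' g' = 0.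
Proof.
move=> h; rewrite -(tsum_unitfam0 (Tm (dl q) (f' ∘ kron x x') ∘ f) (g ∘ Tm (dl q) (kron w' w ∘ g')) h).
by apply: eq_tsum => kC kD t t' v v'; rewrite compA.
Qed.

Let val1 x' z' u' w' f' g' : @val a b x' z' u' w' f' g' = ((dp q)%:C)^-1 *
  (scalar (kron z' z ∘ (Ru q (rM z'))^† ∘ (Tm (dl q) (f' ∘ kron x x') ∘ f)) *
   scalar (g ∘ Tm (dl q) (kron w' w ∘ g') ∘ Ru q (rM u') ∘ kron u u')).
Proof.
rewrite -(tsum_unitfam1 (Tm (dl q) (f' ∘ kron x x') ∘ f) (g ∘ Tm (dl q) (kron w' w ∘ g'))).
by apply: eq_tsum => kC kD t t' v v'; rewrite -(compA (low _ _ _)).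
Qed.

(** The two scalars are partial traces, one for each tensor factor, and [sph] evaluates both; the
    remaining factor is the inverse norm of the cup from [unit_component]. *)
Let val_bas j' l' : @val a b x z u w (E a b x z j') (E' a b w u l')
  = ((dp q)%:C)^-1 * ((d x / d z)%:C * (j' == j)%:R * ((d w / d u)%:C * (l' == l)%:R)).
Proof.
rewrite val1 !kronxx !compm1 !comp1m; congr (_ * (_ * _)).
  rewrite /f compA -!compA (compA (Tm _ _)) -Tm_comp compA.
  have := sph (p := q) hM hd hdL hdR (E a b x z j') (E' a b x z j).
  rewrite dbas_dual scalar_idZ; last exact: hs.
  by move=> ->; rewrite scalar_idZ 1?eq_sym; last exact: hs.
rewrite /g -!compA (compA (Tm _ _)) -Tm_comp compA.
have := sph (p := q) hM hd hdL hdR (E a b w u l) (E' a b w u l').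
rewrite dbas_dual scalar_idZ; last exact: hs.
by move=> ->; rewrite scalar_idZ //; exact: hs.
Qed.

(** Left invariance read through the unit functional: the product with f ⊗ g isolates a single
    coordinate, while ε_L(f ⊗ g) J involves J only through the j_i. *)
Lemma haar_coord_lhs :
  J (existT (tube_mult (cM := cM)) (a, b, x, z, u, w) (j, l))
    * (((dp q)%:C)^-1 * ((d x / d z)%:C * (d w / d u)%:C))
  = \sum_i @epsL _ _ _ _ cC cD cM i (dl q).1 (dl q).2 _ _ _ _ f g * jc i.
Proof.
have := Wlin_inv hC hD hM hJ unitfam_bil (a := (dl q).1) (b := (dl q).2) f g.
move=> <-; transitivity (Wlin val J) => //.
rewrite /Wlin (bigD1 (existT (tube_mult (cM := cM)) (a, b, x, z, u, w) (j, l))) //=.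
rewrite [X in _ + X]big1 ?addr0; first by rewrite val_bas !eqxx !mulr1.
move=> -[[[[[[a' b'] x'] z'] u'] w'] [j' l']] /= bb.
have [ab|ab] := eqVneq q (a', b'); last by rewrite val0 // scaler0.
case: ab => aa' bb'; subst a' b'; rewrite -[val _ _]/(@val a b x' z' u' w' _ _).
have [zz|zz] := eqVneq z' z; last first.
  by rewrite val1 (kron0 zz) !comp0m scalar0 mul0r mulr0 scaler0.
have [xx|xx] := eqVneq x x'; last first.
  by rewrite val1 (kron0 xx) compm0 (lin0 (@Tm_lin _ _ _ _ _ _ _ _ _)) comp0m !compm0 scalar0 mul0r mulr0 scaler0.
have [uu|uu] := eqVneq u u'; last first.
  by rewrite val1 (kron0 uu) !compm0 scalar0 !mulr0 scaler0.
have [ww|ww] := eqVneq w' w; last first.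
  by rewrite val1 (kron0 ww) comp0m (lin0 (@Tm_lin _ _ _ _ _ _ _ _ _)) compm0 !comp0m scalar0 !mulr0 scaler0.
subst x' z' u' w'; rewrite val_bas.
have [jj|jj] := eqVneq j' j; last by rewrite mulr0 !mul0r mulr0 scaler0.
have [ll|ll] := eqVneq l' l; last by rewrite !mulr0 scaler0.
by rewrite jj ll eqxx in bb.
Qed.

Lemma haar_weight_neq0 : ((dp q)%:C)^-1 * ((d x / d z)%:C * (d w / d u)%:C) != 0.
Proof.
by rewrite !mulf_neq0 ?invr_neq0 // gt_eqF // ltcR ?dp_gt0 // divr_gt0.
Qed.

(** The coefficient of ε_L at the bent pair carries the deltas u = i = z and x = w. *)
Lemma haar_coord0 : (u != z) || (w != x) ->
  J (existT (tube_mult (cM := cM)) (a, b, x, z, u, w) (j, l)) = 0.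
Proof.
move=> h; apply: (mulIf haar_weight_neq0); rewrite haar_coord_lhs mul0r big1 // => i _.
rewrite /epsL; case/orP: h => [uz|wx].
  have [ui|ui] := eqVneq u i; last by rewrite (kron0 ui) !comp0m scalar0 mul0r.
  by rewrite [kron i z]kron0 ?compm0 ?scalar0 ?mul0r // -ui.
rewrite [kron x w]kron0 1?eq_sym // (lin0 (@Tm_lin _ _ _ _ _ _ _ _ _)).
by rewrite compm0 !comp0m scalar0 mul0r.
Qed.

End Coordinate.

(** One of the two traces d_x / d_z on the left cancels against the trace in ε_L on the right; the
    other one, and the inverse of d_a d_b, move across and form the weight. *)
Lemma haar_coord1 a b x z (j l : 'I_(mult (bas3 x a z b))) :
  J (existT (tube_mult (cM := cM)) (a, b, x, z, z, x) (j, l))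
  = (jc z * (dp (a, b) * (d z / d x))%:C) * (j == l)%:R.
Proof.
apply: (mulIf (haar_weight_neq0 a b x z z x)); rewrite haar_coord_lhs.
rewrite (bigD1 z) //= [X in _ + X]big1 ?addr0 => [|i iz]; last first.
  by rewrite /epsL (kron0 iz) !compm0 scalar0 mul0r.
rewrite /epsL !kronxx comp1m compm1 Tm_id compm1.
rewrite -!compA (compA (Tm _ _)) -Tm_comp compA.
have := sph (p := (a, b)) hM hd hdL hdR (E a b x z l) (E' a b x z j).
rewrite dbas_dual scalar_idZ; last exact: hs.
move=> ->; rewrite scalar_idZ; last exact: hs.
have dn (c : R) : 0 < c -> c%:C != 0 by move=> c0; rewrite gt_eqF // ltcR.
move: (dp (a, b)) (dp_gt0 (a, b)) => A A0; rewrite !rmorphM /= !fmorphV /=.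
have h1 := dn _ A0; have h2 := dn _ (hd x); have h3 := dn _ (hd z).
by field; rewrite h1 h2 h3.
Qed.

Lemma sum_tube_label (V : nmodType) (G : tube_label cC cD cM -> V) :
  \sum_t G t = \sum_a \sum_b \sum_x \sum_z \sum_u \sum_w G (a, b, x, z, u, w).
Proof.
rewrite !pair_bigA; apply: eq_bigr => -[[[[[a b] x] z] u] w] _.
by [].
Qed.

(* J = Σ j_z d_a d_b (d_z / d_x) Σ_j e_j ⊗ e'_j, summed over a, b, x, z. *)
Lemma Wlin_haar (V : lmodType R[i]) (F : wfam cC cD cM V) :
  Wlin F J = \sum_a \sum_b \sum_x \sum_z \sum_j
    (jc z * (dp (a, b) * (d z / d x))%:C) *: F a b x z z x (E a b x z j) (E' a b x z j).
Proof.
transitivity (\sum_(t : tube_label cC cD cM) \sum_(jl : tube_mult t)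
   J (existT (tube_mult (cM := cM)) t jl) *: tube_case F (existT (tube_mult (cM := cM)) t jl)).
  rewrite sig_big_dep; apply: eq_bigr => -[t jl] _; by [].
rewrite sum_tube_label; apply: eq_bigr => a _; apply: eq_bigr => b _.
apply: eq_bigr => x _; apply: eq_bigr => z _.
rewrite (bigD1 z) //= [X in _ + X]big1 ?addr0 => [|u uz]; last first.
  by rewrite big1 // => w _; rewrite big1 // => -[j l] _; rewrite haar_coord0 ?uz ?scale0r.
rewrite (bigD1 x) //= [X in _ + X]big1 ?addr0 => [|w wx]; last first.
  by rewrite big1 // => -[j l] _; rewrite haar_coord0 ?wx ?orbT ?scale0r.
transitivity (\sum_j \sum_l
   J (existT (tube_mult (cM := cM)) (a, b, x, z, z, x) (j, l)) *:
   F a b x z z x (E a b x z j) (E' a b x z l)).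
  by rewrite pair_bigA; apply: eq_bigr => -[j l] _.
apply: eq_bigr => j _; rewrite (bigD1 j) //= big1 ?addr0 => [|l lj].
  by rewrite haar_coord1 eqxx mulr1.
by rewrite haar_coord1 eq_sym (negPf lj) mulr0 scale0r.
Qed.

Lemma sum_pick (c : IM -> R[i]) i :
  \sum_k c k *: \sum_x ((k == i) && (x == k))%:R = c i :> R[i]^o.
Proof.
rewrite (bigD1 i) //= [X in _ + X]big1 ?addr0 => [|k ki]; last first.
  by rewrite (negPf ki) big1 ?scaler0.
rewrite (bigD1 i) //= !eqxx big1 ?addr0 => [|x xi]; first exact: mulr1.
by rewrite (negPf xi).
Qed.

(* ε_L(J) = 1 in coordinates. *)
Lemma haar_normL i : \sum_(a : IC) \sum_(b : ID) \sum_z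
  (jc z * (dp (a, b) * (d z / d i))%:C) * (mult (bas3 i a z b))%:R = 1.
Proof.
have [_ _ hL _] := hJ.
(* The counit restricted to w = i takes the value 1 on the unit and extracts the i-th coefficient of
   ε_L(J). *)
pose T : wfam cC cD cM R[i]^o := fun a b x z u w f g =>
  if w == i then epsfam f g else 0.
have Tb : wbil T.
  move=> a b x z u w; have [h1 h2] := @epsfam_bil _ _ _ _ cC cD cM a b x z u w.
  by split=> e; rewrite /T; case: (w == i); try exact: lin_zero.
have Tp x k : Wlin T (punit cC cD x k) = ((k == i) && (x == k))%:R.
  rewrite /punit Wlin_pure // /T; case: (k == i) => //=.
  rewrite /epsfam -!compA unit3_Tm_dag (compA (unit3 _)).
  have [_ u2] := unit3_unitary (rM k); rewrite u2 comp1m.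
  have [<-|xk] := eqVneq x k; first by rewrite kronxx comp1m (scalar1 (hs x)).
  by rewrite (kron0 xk) compm0 scalar0.
have e1 : Wlin T (Wone cC cD cM) = 1.
  rewrite WoneE (lin_sum2 _ (Wlin_lin T)) exchange_big /= -[RHS](sum_pick (fun=> 1) i).
  apply: eq_bigr => k _; rewrite scale1r; apply: eq_bigr => x _; exact: Tp.
have e2 : Wlin T (Weps_L J) = Wlin (epsL i) J.
  rewrite Weps_LE // (lin_sumZ _ _ (Wlin_lin T)) -[RHS](sum_pick (fun k => Wlin (epsL k) J) i).
  by apply: eq_bigr => k _; congr (_ *: _); apply: eq_bigr => x _; exact: Tp.
have h : Wlin (epsL i) J = 1 by rewrite -e2 hL e1.
rewrite -[RHS]h Wlin_haar.
apply: eq_bigr => a _; apply: eq_bigr => b _.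
rewrite [RHS](bigD1 i) //= [X in _ + X]big1 ?addr0 => [|x xi]; last first.
  rewrite big1 // => z _; rewrite big1 // => j _.
  by rewrite /epsL (kron0 xi) -!compA comp0m scalar0 scaler0.
apply: eq_bigr => z _.
transitivity (\sum_(j < mult (bas3 i a z b)) jc z * (dp (a, b) * (d z / d i))%:C).
  by rewrite sumr_const card_ord mulr_natr.
apply: eq_bigr => j _.
rewrite /epsL !kronxx comp1m compm1 Tm_id compm1 dbas_dual eqxx scale1r.
by rewrite (scalar1 (hs i)) /GRing.scale /= mulr1.
Qed.

(** The coefficients of the id_i ⊗ id_u in ε_R(J) involve only the terms of J with z = i, all
    proportional to j_i. Were j_i zero, ε_R(J) could not be 1. *)
Lemma jc_neq0 i : jc i != 0.
Proof.
apply/eqP => ji; have [_ _ _ hR] := hJ.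
pose T : wfam cC cD cM R[i]^o := fun a b x z u w f g =>
  if x == i then epsfam f g else 0.
have Tb : wbil T.
  move=> a b x z u w; have [h1 h2] := @epsfam_bil _ _ _ _ cC cD cM a b x z u w.
  by split=> e; rewrite /T; case: (x == i); try exact: lin_zero.
have Tp x k : Wlin T (punit cC cD x k) = ((x == i) && (x == k))%:R.
  rewrite /punit Wlin_pure // /T; case: (x == i) => //=.
  rewrite /epsfam -!compA unit3_Tm_dag (compA (unit3 _)).
  have [_ u2] := unit3_unitary (rM k); rewrite u2 comp1m.
  have [<-|xk] := eqVneq x k; first by rewrite kronxx comp1m (scalar1 (hs x)).
  by rewrite (kron0 xk) compm0 scalar0.
have T1 : Wlin T (Wone cC cD cM) = 1.
  rewrite WoneE (lin_sum2 _ (Wlin_lin T)) -[RHS](sum_pick (fun=> 1) i).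
  apply: eq_bigr => x _; rewrite scale1r; apply: eq_bigr => k _.
  by rewrite Tp [x == k]eq_sym.
have : (1 : R[i]) != 0 by exact: oner_neq0.
rewrite -T1 -hR => /negP; apply; apply/eqP; rewrite Weps_RE // (lin_sum2 _ (Wlin_lin T)).
apply: big1 => x0 _; apply: big1 => u0 _.
rewrite (lin_sum (Wlin_lin T)); apply: big1 => i0 _.
rewrite (linZ (Wlin_lin T)) Tp.
have [e0|n0] := eqVneq i0 i; last by rewrite scaler0.
subst i0; rewrite Wlin_haar big1 ?scale0r // => a _; rewrite big1 // => b _.
rewrite big1 // => x _; rewrite big1 // => z _; rewrite big1 // => j _.
have [e1|n1] := eqVneq i z; first by subst z; rewrite ji mul0r scale0r.
rewrite /epsR (kron0 n1) !comp0m (lin0 (@Tm_lin _ _ _ _ _ _ _ _ _)).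
by rewrite compm0 comp0m scalar0 scaler0.
Qed.

End HaarExplicit.

(** * Averaging over the Haar integral *)

Section Restriction.
Variables (R : realType) (C D : monoidal_category R) (M : bimodule_category C D).
Variables (cC : fusion_choices C) (cD : fusion_choices D) (cM : module_choices M).
Local Notation IC := (fc_Irr cC).
Local Notation ID := (fc_Irr cD).
Local Notation IM := (mc_Irr cM).
Local Notation rC := (fc_rep (f := cC)).
Local Notation rD := (fc_rep (f := cD)).
Local Notation rM := (mc_rep (m := cM)).

Implicit Types (a : IC) (b : ID) (p q : IC * ID) (m n : M) (x z u w i : IM).

Section OneFunctor.
Variable F : bimodule_functor M.

Definition strT p m : hom (Tob p (F m)) (F (Tob p m)) := str3 F (rC p.1) m (rD p.2).
Definition isT p m : hom (F (Tob p m)) (Tob p (F m)) :=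
  isoinv (str3_iso F (rC p.1) m (rD p.2)).

Lemma strTK p m : isT p m ∘ strT p m = idm _.
Proof. exact: isoinvK. Qed.

Lemma isTK p m : strT p m ∘ isT p m = idm _.
Proof. exact: isoinvVK. Qed.

Lemma strT_nat p m n (h : hom m n) :
  strT p n ∘ Tm p (bf_mor F h) = bf_mor F (Tm p h) ∘ strT p m.
Proof. exact: str3_nat. Qed.

Lemma isT_nat p m n (h : hom m n) :
  isT p n ∘ bf_mor F (Tm p h) = Tm p (bf_mor F h) ∘ isT p m.
Proof. apply: (inverse_nat (isTK p m) (strTK p n)); exact: strT_nat. Qed.

Lemma strT_up p q (kC : IC) (kD : ID) (t : hom (rC kC) (rC p.1 ⊗ rC q.1))
  (v : hom (rD kD) (rD q.2 ⊗ rD p.2)) m :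
  bf_mor F (up t v m) ∘ strT (kC, kD) m
  = strT p (Tob q m) ∘ Tm p (strT q m) ∘ up t v (F m).
Proof. exact: str3_lift3. Qed.

Lemma strT_low p q (kC : IC) (kD : ID) (t : hom (rC p.1 ⊗ rC q.1) (rC kC))
  (v : hom (rD q.2 ⊗ rD p.2) (rD kD)) m :
  bf_mor F (low t v m) ∘ (strT p (Tob q m) ∘ Tm p (strT q m))
  = strT (kC, kD) m ∘ low t v (F m).
Proof.
rewrite -!lowE bf_mor_comp.
have [u1 _] := bf_mor_unitary F (assoc3_unitary (rC p.1) (rC q.1) m (rD q.2) (rD p.2)).
have [_ u2] := assoc3_unitary (rC p.1) (rC q.1) (F m) (rD q.2) (rD p.2).
have := inverse_nat u2 u1 (str3_assoc F (rC p.1) (rC q.1) m (rD q.2) (rD p.2)).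
rewrite -compA => ->; rewrite compA.
by rewrite -str3_nat bf_mor_id -compA.
Qed.

Lemma isT_low p q (kC : IC) (kD : ID) (t : hom (rC p.1 ⊗ rC q.1) (rC kC))
  (v : hom (rD q.2 ⊗ rD p.2) (rD kD)) m :
  isT (kC, kD) m ∘ bf_mor F (low t v m)
  = low t v (F m) ∘ (Tm p (isT q m) ∘ isT p (Tob q m)).
Proof.
have e1 : strT p (Tob q m) ∘ Tm p (strT q m) ∘ (Tm p (isT q m) ∘ isT p (Tob q m)) = idm _.
  rewrite -!compA (compA (Tm p _) (Tm p _)) -Tm_comp isTK Tm_id comp1m; exact: isTK.
rewrite -[bf_mor F _ in LHS]compm1 -e1 (compA (bf_mor F _)) strT_low.
by rewrite -!compA (compKl _ (strTK _ _)).
Qed.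

Lemma strT_Ru' q m : isT q (Tob (dl q) m) ∘ bf_mor F (Ru' q m)
  = Tm q (strT (dl q) m) ∘ Ru' q (F m).
Proof. by rewrite /Ru' -!lock str3_coev -!compA (compKl _ (strTK q _)). Qed.

Lemma strT_Ru q m : bf_mor F (Ru q m)
  = strT (dl q) (Tob q m) ∘ Tm (dl q) (strT q m) ∘ Ru q (F m).
Proof. by rewrite /Ru -!lock str3_coev. Qed.

(** This is not the adjoint of the law for cups, since F need not respect daggers. The cap is
    instead a [low] map into the unit channel, to which [strT_low] applies. *)
Lemma strT_Ru'_dag q m :
  bf_mor F (Ru' q m)^† ∘ strT q (Tob (dl q) m) ∘ Tm q (strT (dl q) m) = (Ru' q (F m))^†.
Proof.
have E n : (Ru' q n)^† = unit3 n ∘ low (p := q) (q := dl q) (k := None) (s := None)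
    (fc_R' q.1)^† (fc_R q.2)^† n.
  by rewrite /Ru' -lock lift3_coev dag_comp dagK /low !dagK.
rewrite !E bf_mor_comp -!compA (strT_low (kC := None) (kD := None)) compA; congr (_ ∘ _).
exact: str3_unit.
Qed.

Lemma strT_Ru_dag q m :
  bf_mor F (Ru q m)^† ∘ strT (dl q) (Tob q m) ∘ Tm (dl q) (strT q m) = (Ru q (F m))^†.
Proof.
have E n : (Ru q n)^† = unit3 n ∘ low (p := dl q) (q := q) (k := None) (s := None)
    (fc_R q.1)^† (fc_R' q.2)^† n.
  by rewrite /Ru -lock lift3_coev dag_comp dagK /low !dagK.
rewrite !E bf_mor_comp -!compA (strT_low (kC := None) (kD := None)) compA; congr (_ ∘ _).
exact: str3_unit.
Qed.

End OneFunctor.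

(* Families of maps F(k) -> G(k), k simple, that are natural for the actions of
   simple pairs: the restrictions of bimodule natural transformations. *)
Definition simple_nat (F G : bimodule_functor M) (t : forall x, hom (F (rM x)) (G (rM x))) :=
  forall p x z (phi : hom (rM x) (Tob p (rM z))),
    strT G p (rM z) ∘ Tm p (t z) ∘ isT F p (rM z) ∘ bf_mor F phi = bf_mor G phi ∘ t x.

Section Average.
Variable d : IM -> R.
Variables F G : bimodule_functor M.

(** The action of f ⊗ g on maps F z → G u; the action of W on V^G is the case of the identity
    functor F. *)
Definition sandwich p x z w u (f : hom (rM x) (Tob p (rM z))) (t : hom (F (rM z)) (G (rM u)))
   (g : hom (Tob p (rM u)) (rM w)) : hom (F (rM x)) (G (rM w)) :=
  bf_mor G g ∘ strT G p (rM u) ∘ Tm p t ∘ isT F p (rM z) ∘ bf_mor F f.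

(** The action of J with the factors j_i removed, so that only known weights remain. *)
Definition average (t : forall x, hom (F (rM x)) (G (rM x))) k : hom (F (rM k)) (G (rM k)) :=
  \sum_(a : IC) \sum_(b : ID) \sum_i (dp (a, b) * (d i / d k))%:C *:
    \sum_j sandwich (p := (a, b)) (tnth (dbas (bas3 k a i b)) j) (t i)
                    (tnth (dbas' (bas3 k a i b)) j).

Lemma lin_sandwich1 p x z w u (t : hom (F (rM z)) (G (rM u))) (g : hom (Tob p (rM u)) (rM w)) :
  lin (fun f : hom (rM x) (Tob p (rM z)) => sandwich f t g).
Proof. exact: (lin_comp (lin_compr _) (@lin_bf_mor _ _ _ _ _ _ _)). Qed.

Lemma lin_sandwich2 p x z w u (f : hom (rM x) (Tob p (rM z))) (g : hom (Tob p (rM u)) (rM w)) :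
  lin (fun t : hom (F (rM z)) (G (rM u)) => sandwich f t g).
Proof.
apply: (lin_comp (lin_compl _)); apply: (lin_comp (lin_compl _)).
exact: (lin_comp (lin_compr _) (@Tm_lin _ _ _ _ _ _ _ _ _)).
Qed.

Lemma lin_sandwich3 p x z w u (f : hom (rM x) (Tob p (rM z))) (t : hom (F (rM z)) (G (rM u))) :
  lin (fun g : hom (Tob p (rM u)) (rM w) => sandwich f t g).
Proof.
do 4![apply: (lin_comp (lin_compl _))]; exact: lin_bf_mor.
Qed.

Lemma sandwich_comp p x z w u x' w' (f : hom (rM x) (Tob p (rM z)))
  (t : hom (F (rM z)) (G (rM u))) (g : hom (Tob p (rM u)) (rM w))
  (h : hom (rM x') (rM x)) (h' : hom (rM w) (rM w')) :
  sandwich (f ∘ h) t (h' ∘ g) = bf_mor G h' ∘ sandwich f t g ∘ bf_mor F h.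
Proof. by rewrite /sandwich !bf_mor_comp -!compA. Qed.

Lemma lin_average k (U : lmodType R[i]) (t : U -> forall x, hom (F (rM x)) (G (rM x))) :
  (forall x, lin (t ^~ x)) -> lin (fun c => average (t c) k).
Proof.
move=> h; do 3![apply: lin_bigsum => ? _]; apply: lin_scale.
by apply: lin_bigsum => ? _; exact: (lin_comp (lin_sandwich2 _ _) (h _)).
Qed.

End Average.
End Restriction.

Section AverageNatural.
Variables (R : realType) (C D : monoidal_category R) (M : bimodule_category C D).
Hypotheses (hC : finitely_semisimple C) (hD : finitely_semisimple D).
Hypothesis hM : finitely_semisimple M.
Variables (cC : fusion_choices C) (cD : fusion_choices D) (cM : module_choices M).
Local Notation IC := (fc_Irr cC).
Local Notation ID := (fc_Irr cD).
Local Notation IM := (mc_Irr cM).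
Local Notation rM := (mc_rep (m := cM)).
Local Notation bM := (mc_bases (m := cM)).
Local Notation hr := (mc_irr cM).
Local Notation hs := (irr_simple (mc_irr cM)).

Implicit Types (a : IC) (b : ID) (p q : IC * ID) (m n : M) (x z u w i : IM).

Variable d : IM -> R.
Hypothesis hd : forall x, 0 < d x.
Hypothesis hdL : left_dimension cC d.
Hypothesis hdR : right_dimension cD d.
Variable J : W cC cD cM.
Hypothesis hJ : haar_integral J.
Local Notation jc := (jc J).
Local Notation avg := (average cC cD d).
Local Notation snat := (simple_nat cC cD).
Variables F G : bimodule_functor M.

Lemma jc_unit i : jc i != 0.
Proof. exact: (jc_neq0 hC hD hM hd hdL hdR hJ). Qed.

Lemma irr_separate n m (h h' : hom m n) :
  (forall x (g : hom n (rM x)), g ∘ h = g ∘ h') -> h = h'.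
Proof.
move=> e; rewrite -(comp1m h) -(comp1m h') -(irr_complete hM hr bM n) !comp_suml.
apply: eq_bigr => x _; rewrite !comp_suml; apply: eq_bigr => j _.
by rewrite -!compA e.
Qed.

Section Fixed.
Variable t : forall x, hom (F (rM x)) (G (rM x)).
Variables (x w : IM).

(** Dividing by the nonzero j_x turns the action of J on t' into the average of t. In [B] below the
    deltas pin the outer objects to x and w. *)
Let t' x := (jc x)^-1 *: t x.

Let B : wfam cC cD cM (hom (F (rM x)) (G (rM w))) := fun a b x1 z1 u1 w1 f g =>
  sandwich (f ∘ kron x x1) (t' u1 ∘ bf_mor F (kron z1 u1)) (kron w1 w ∘ g).

Let B_bil : wbil B.
Proof.
move=> a b x1 z1 u1 w1; split=> e.
  exact: (lin_comp (lin_sandwich1 _ _) (lin_compl _)).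
exact: (lin_comp (lin_sandwich3 _ _) (lin_compr _)).
Qed.

Lemma average_sum k : avg t k = \sum_(a : IC) \sum_(b : ID) \sum_i
  \sum_j (dp (a, b) * (d i / d k))%:C *:
    sandwich (p := (a, b)) (tnth (dbas (bas3 k a i b)) j) (t i)
             (tnth (dbas' (bas3 k a i b)) j).
Proof.
by do 3![apply: eq_bigr => ? _]; rewrite scaler_sumr.
Qed.

(** The maps [up] and [low] slide through the structure maps of F and G and sum to the identity,
    leaving the average at z inside a ⊗ - ⊗ b. *)
Lemma average_lhs p z (phi : hom (rM x) (Tob p (rM z))) (psi : hom (Tob p (rM z)) (rM w)) :
  Wlin (fun a' b' x' z' u' w' f' g' =>
    tsum (p := p) (q := (a', b')) (fun kC kD t t' v v' =>
    @B kC kD x z' u' w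
      (low (p := p) (q := (a', b')) t' v' (rM z') ∘ Tm p (f' ∘ kron z x') ∘ phi)
      (psi ∘ Tm p (kron w' z ∘ g') ∘ up (p := p) (q := (a', b')) t v (rM u')))) J
  = bf_mor G psi ∘ (strT G p (rM z) ∘ Tm p (avg t z) ∘ isT F p (rM z) ∘ bf_mor F phi).
Proof.
have tsumE a' b' x' z' (f' : hom (rM x') (Tob (a', b') (rM z'))) g' :
   jc z' *: tsum (p := p) (q := (a', b')) (fun kC kD t t' v v' =>
    @B kC kD x z' z' w
      (low (p := p) (q := (a', b')) t' v' (rM z') ∘ Tm p (f' ∘ kron z x') ∘ phi)
      (psi ∘ Tm p (kron x' z ∘ g') ∘ up (p := p) (q := (a', b')) t v (rM z')))
  = bf_mor G psi ∘ (strT G p (rM z) ∘ Tm p (sandwich (f' ∘ kron z x') (t z') (kron x' z ∘ g'))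
      ∘ isT F p (rM z) ∘ bf_mor F phi).
  rewrite (tsum_lin _ (lin_scale (jc z') (@lin_id _ _))).
  pose q := (a', b').
  pose A := bf_mor G psi ∘ strT G p (rM z) ∘ Tm p (bf_mor G (kron x' z ∘ g'))
     ∘ Tm p (strT G q (rM z')) ∘ Tm p (Tm q (t z')).
  pose E := Tm p (isT F q (rM z')) ∘ Tm p (bf_mor F (f' ∘ kron z x')) ∘ isT F p (rM z) ∘ bf_mor F phi.
  transitivity (tsum (p := p) (q := q) (fun kC kD t t' v v' => A ∘ (up t v _ ∘ low t' v' _) ∘ E)).
    apply: eq_tsum => kC kD t1 t1' v1 v1'.
    rewrite /B !kronxx bf_mor_id compm1 comp1m compm1 /t' (linZ (lin_sandwich2 _ _)) scalerA.
    rewrite mulfV ?scale1r ?jc_unit //.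
    rewrite /sandwich !bf_mor_comp.
    have e1 : bf_mor G (up t1 v1 (rM z')) ∘ strT G (kC, kD) (rM z')
      = strT G p (Tob q (rM z')) ∘ Tm p (strT G q (rM z')) ∘ up t1 v1 _ by exact: strT_up.
    have e2 : isT F (kC, kD) (rM z') ∘ bf_mor F (low t1' v1' (rM z'))
      = low t1' v1' _ ∘ (Tm p (isT F q (rM z')) ∘ isT F p (Tob q (rM z'))) by exact: isT_low.
    have e3 : up t1 v1 (G (rM z')) ∘ Tm (kC, kD) (t z') = Tm p (Tm q (t z')) ∘ up t1 v1 (F (rM z')).
      by rewrite up_nat.
    rewrite /A /E -!compA (comp_tail e1) -!compA (comp_tail e3) -!compA (comp_tail e2) -!compA.
    by rewrite (comp_tail (isT_nat F p _)) (comp_tail (esym (strT_nat G p _))) -!compA.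
  have hl : lin (fun h => A ∘ h ∘ E) by apply: (lin_comp (lin_compl _)); exact: lin_compr.
  have := tsum_lin (p := p) (q := q) (fun kC kD t1 t1' v1 v1' =>
    up (p := p) (q := q) t1 v1 (F (rM z')) ∘ low (p := p) (q := q) t1' v1' (F (rM z'))) hl.
  move=> <-; rewrite tsum_complete // compm1 /A /E /sandwich !Tm_comp -!compA.
  by [].
rewrite (Wlin_haar hC hD hM hd hdL hdR hJ).
pose L h := bf_mor G psi ∘ (strT G p (rM z) ∘ Tm p h ∘ isT F p (rM z) ∘ bf_mor F phi).
have hL : lin L.
  apply: (lin_comp (lin_compr _)); do 2![apply: (lin_comp (lin_compl _))].
  exact: (lin_comp (lin_compr _) (@Tm_lin _ _ _ _ _ _ _ _ _)).
rewrite -/(L _) average_sum (lin_sum hL); apply: eq_bigr => a _.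
rewrite (lin_sum hL); apply: eq_bigr => b _.
rewrite (bigD1 z) //= [X in _ + X]big1 ?addr0 => [|x' xz]; last first.
  rewrite big1 // => z' _; rewrite big1 // => j _.
  rewrite mulrC -scalerA tsumE -/(L _) [kron z x']kron0 1?eq_sym // compm0.
  by rewrite (lin0 (lin_sandwich1 _ _)) (lin0 hL) scaler0.
rewrite (lin_sum hL); apply: eq_bigr => z' _; rewrite (lin_sum hL); apply: eq_bigr => j _.
by rewrite mulrC -scalerA tsumE -/(L _) kronxx compm1 comp1m (linZ hL).
Qed.

(** The coefficients of ε_L(phi ⊗ psi) depend only on psi ∘ phi, which is a scalar for x = w and
    zero otherwise. *)
Lemma average_rhs p z (phi : hom (rM x) (Tob p (rM z))) (psi : hom (Tob p (rM z)) (rM w)) :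
  \sum_i @epsL _ _ _ _ cC cD cM i p.1 p.2 _ _ _ _ phi psi *:
    Wlin (fun a' b' x' z' u' w' f' g' => @B a' b' x' z' u' i f' (kron w' i ∘ g')) J
  = bf_mor G (psi ∘ phi) ∘ avg t x.
Proof.
have WE i : Wlin (fun a' b' x' z' u' w' f' g' => @B a' b' x' z' u' i f' (kron w' i ∘ g')) J
    = bf_mor G (kron i w ∘ kron x i) ∘ avg t x.
  rewrite (Wlin_haar hC hD hM hd hdL hdR hJ) average_sum comp_sumr; apply: eq_bigr => a _.
  rewrite comp_sumr; apply: eq_bigr => b _.
  rewrite (bigD1 x) //= [X in _ + X]big1 ?addr0 => [|x' xx]; last first.
    rewrite big1 // => z' _; rewrite big1 // => j _.
    rewrite /B [kron x x']kron0 1?eq_sym // compm0.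
    by rewrite (lin0 (lin_sandwich1 _ _)) scaler0.
  rewrite comp_sumr; apply: eq_bigr => z' _; rewrite comp_sumr; apply: eq_bigr => j _.
  rewrite compZr mulrC -scalerA; congr (_ *: _).
  rewrite /B !kronxx bf_mor_id compm1 compm1 /t' (linZ (lin_sandwich2 _ _)) scalerA.
  rewrite mulfV ?scale1r ?jc_unit // compA -[X in sandwich X]compm1 sandwich_comp.
  by rewrite bf_mor_id compm1.
under eq_bigr => i _ do rewrite WE -compZl -(linZ (@lin_bf_mor _ _ _ _ G _ _)).
rewrite -comp_suml -(lin_sum (@lin_bf_mor _ _ _ _ G _ _)); congr (bf_mor G _ ∘ _).
have [xw|xw] := eqVneq x w.
  subst w; rewrite (bigD1 x) //= big1 ?addr0 => [|i ix].
    rewrite kronxx comp1m /epsL !kronxx comp1m compm1 Tm_id compm1.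
    by rewrite -scalarE //; exact: hs.
  by rewrite (kron0 ix) comp0m scaler0.
rewrite (irr_hom0 hr (psi ∘ phi) xw) big1 // => i _.
have [xi|xi] := eqVneq x i; last by rewrite [kron x i]kron0 // compm0 scaler0.
by rewrite [kron i w]kron0 ?comp0m ?scaler0 // -xi.
Qed.

Lemma average_inv p z (phi : hom (rM x) (Tob p (rM z))) (psi : hom (Tob p (rM z)) (rM w)) :
  bf_mor G psi ∘ (strT G p (rM z) ∘ Tm p (avg t z) ∘ isT F p (rM z) ∘ bf_mor F phi)
  = bf_mor G (psi ∘ phi) ∘ avg t x.
Proof.
rewrite -average_lhs -average_rhs.
exact: (Wlin_inv hC hD hM hJ B_bil (a := p.1) (b := p.2) phi psi).
Qed.

End Fixed.

(** Invariance gives naturality after composition with G psi for psi into a simple object; by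
    completeness such maps separate morphisms into G(a ⊗ z ⊗ b). *)
Theorem average_nat (t : forall x, hom (F (rM x)) (G (rM x))) : snat (avg t).
Proof.
move=> p x z phi; set h := LHS; set h' := RHS.
have e w (g : hom (Tob p (rM z)) (rM w)) : bf_mor G g ∘ h = bf_mor G g ∘ h'.
  by rewrite /h average_inv bf_mor_comp -compA.
rewrite -(comp1m h) -(comp1m h') -(bf_mor_id G) -(irr_complete hM hr bM (Tob p (rM z))).
rewrite (lin_sum (@lin_bf_mor _ _ _ _ G _ _)) !comp_suml; apply: eq_bigr => w _.
rewrite (lin_sum (@lin_bf_mor _ _ _ _ G _ _)) !comp_suml; apply: eq_bigr => j _.
by rewrite bf_mor_comp -!compA e.
Qed.

End AverageNatural.

(** * Schur's lemma for bimodule functors *)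

Section SimpleNat.
Variables (R : realType) (C D : monoidal_category R) (M : bimodule_category C D).
Hypotheses (hC : finitely_semisimple C) (hD : finitely_semisimple D).
Hypothesis hM : finitely_semisimple M.
Variables (cC : fusion_choices C) (cD : fusion_choices D) (cM : module_choices M).
Local Notation IC := (fc_Irr cC).
Local Notation ID := (fc_Irr cD).
Local Notation IM := (mc_Irr cM).
Local Notation rC := (fc_rep (f := cC)).
Local Notation rD := (fc_rep (f := cD)).
Local Notation rM := (mc_rep (m := cM)).
Local Notation bM := (mc_bases (m := cM)).
Local Notation bC := (fc_bases (f := cC)).
Local Notation bD := (fc_bases (f := cD)).
Local Notation hr := (mc_irr cM).
Local Notation hs := (irr_simple (mc_irr cM)).

Implicit Types (a : IC) (b : ID) (p q : IC * ID) (m n : M) (x z u w i : IM).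

Local Notation snat := (simple_nat cC cD).
Implicit Types F G H : bimodule_functor M.

Lemma strT_dconj F p m : strT (dconj F) p m = (isT F p m)^†.
Proof.
apply: dag_inj; rewrite dagK.
have [h1 _] := dconj_str F (rC p.1) m (rD p.2).
by rewrite -[LHS]compm1 -(isTK F p m) compA h1 comp1m.
Qed.

Lemma isT_dconj F p m : isT (dconj F) p m = (strT F p m)^†.
Proof.
have h : (strT F p m)^† ∘ strT (dconj F) p m = idm _.
  by rewrite strT_dconj -dag_comp strTK dag1.
by rewrite -[LHS]comp1m -h -compA isTK compm1.
Qed.

Lemma irr_comm F G (t : forall x, hom (F (rM x)) (G (rM x))) x k (h : hom (rM x) (rM k)) :
  bf_mor G h ∘ t x = t k ∘ bf_mor F h.
Proof.
have [e|n] := eqVneq x k; last first.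
  rewrite (irr_hom0 hr h n) (lin0 (@lin_bf_mor _ _ _ _ F _ _)) (lin0 (@lin_bf_mor _ _ _ _ G _ _)).
  by rewrite comp0m compm0.
subst k; rewrite (scalarE h (hs x)).
rewrite (linZ (@lin_bf_mor _ _ _ _ F _ _)) (linZ (@lin_bf_mor _ _ _ _ G _ _)) !bf_mor_id.
by rewrite compZl compZr comp1m compm1.
Qed.

Section Extension.
Variables F G : bimodule_functor M.
Variable t : forall x, hom (F (rM x)) (G (rM x)).

(** Extension to all objects along a decomposition into simple ones; using the canonical element
    makes it natural without compatible choices of decompositions. *)
Definition ext m : hom (F m) (G m) :=
  can bM (fun k (f : hom (rM k) m) (g : hom m (rM k)) => bf_mor G f ∘ t k ∘ bf_mor F g).

Lemma ext_in m x (f : hom (rM x) m) : ext m ∘ bf_mor F f = bf_mor G f ∘ t x.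
Proof.
rewrite -[in RHS](comp1m f) -[in RHS](irr_complete hM hr bM m) [in RHS]comp_suml.
rewrite (lin_sum (@lin_bf_mor _ _ _ _ G _ _)) /ext /can !comp_suml; apply: eq_bigr => k _.
rewrite [in RHS]comp_suml (lin_sum (@lin_bf_mor _ _ _ _ G _ _)) !comp_suml; apply: eq_bigr => j _.
by rewrite -[in RHS]compA bf_mor_comp -[in RHS]compA irr_comm -!compA -bf_mor_comp.
Qed.

Lemma bf_complete m : idm (F m) = \sum_k \sum_j
  bf_mor F (tnth (dbas (bM k m)) j) ∘ bf_mor F (tnth (dbas' (bM k m)) j).
Proof.
rewrite -bf_mor_id -(irr_complete hM hr bM m) (lin_sum (@lin_bf_mor _ _ _ _ F _ _)).
apply: eq_bigr => k _; rewrite (lin_sum (@lin_bf_mor _ _ _ _ F _ _)).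
by apply: eq_bigr => j _; rewrite bf_mor_comp.
Qed.

Lemma bf_eq m (n : M) (h h' : hom (F m) n) :
  (forall x (f : hom (rM x) m), h ∘ bf_mor F f = h' ∘ bf_mor F f) -> h = h'.
Proof.
move=> e; rewrite -(compm1 h) -(compm1 h') bf_complete !comp_sumr; apply: eq_bigr => k _.
by rewrite !comp_sumr; apply: eq_bigr => j _; rewrite !compA e.
Qed.

Lemma ext_nat m n (h : hom m n) : ext n ∘ bf_mor F h = bf_mor G h ∘ ext m.
Proof.
apply: bf_eq => x f; rewrite -!compA ext_in -bf_mor_comp ext_in compA.
by rewrite bf_mor_comp.
Qed.

Lemma ext_simple x : ext (rM x) = t x.
Proof. by rewrite -[LHS]compm1 -bf_mor_id ext_in bf_mor_id comp1m. Qed.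

Hypothesis ht : snat t.

Lemma ext_strT p m : ext (Tob p m) ∘ strT F p m = strT G p m ∘ Tm p (ext m).
Proof.
have simple_case z : ext (Tob p (rM z)) = strT G p (rM z) ∘ Tm p (t z) ∘ isT F p (rM z).
  by apply: bf_eq => x f; rewrite ext_in ht.
suff h : ext (Tob p m) ∘ strT F p m ∘ Tm p (idm (F m)) = strT G p m ∘ Tm p (ext m) ∘ Tm p (idm (F m)).
  by rewrite !Tm_id !compm1 in h.
rewrite bf_complete (lin_sum (@Tm_lin _ _ _ _ _ _ _ _ _)) !comp_sumr; apply: eq_bigr => k _.
rewrite (lin_sum (@Tm_lin _ _ _ _ _ _ _ _ _)) !comp_sumr; apply: eq_bigr => j _.
set e := tnth (dbas _) j; rewrite Tm_comp !compA; congr (_ ∘ _).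
rewrite -(compA (ext _)) strT_nat compA ext_nat simple_case -!compA strTK compm1.
by rewrite -Tm_comp ext_in Tm_comp compA -strT_nat -!compA.
Qed.

Lemma ext_str3 a m b :
  ext (act (rC a) m (rD b)) ∘ str3 F (rC a) m (rD b)
  = str3 G (rC a) m (rD b) ∘ actm (idm (rC a)) (ext m) (idm (rD b)).
Proof. exact: (ext_strT (a, b)). Qed.

(** Simple pairs suffice: c and e are resolved into simple objects, in which the structure maps are
    natural. *)
Lemma ext_str3_gen (c : C) m (e : D) :
  ext (act c m e) ∘ str3 F c m e = str3 G c m e ∘ actm (idm c) (ext m) (idm e).
Proof.
rewrite -[LHS]compm1 -[RHS]compm1 -actm1.
rewrite -[X in actm X (idm (F m)) _](irr_complete hC (fc_irr cC) bC c).
rewrite (lin_sum (lin_actm1 _ _)) !comp_sumr; apply: eq_bigr => a _.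
rewrite (lin_sum (lin_actm1 _ _)) !comp_sumr; apply: eq_bigr => i _.
rewrite -[X in actm _ (idm (F m)) X](irr_complete hD (fc_irr cD) bD e).
rewrite (lin_sum (lin_actm3 _ _)) !comp_sumr; apply: eq_bigr => b _.
rewrite (lin_sum (lin_actm3 _ _)) !comp_sumr; apply: eq_bigr => j _.
set f := tnth (dbas (bC a c)) i; set f' := tnth (dbas' (bC a c)) i.
set g := tnth (dbas (bD b e)) j; set g' := tnth (dbas' (bD b e)) j.
have -> : actm (f ∘ f') (idm (F m)) (g ∘ g') = actm f (idm (F m)) g ∘ actm f' (idm (F m)) g'.
  by rewrite actmE comp1m.
rewrite !compA; congr (_ ∘ _).
rewrite -(compA (ext _)) -(bf_mor_id F m) str3_nat compA ext_nat -compA ext_str3 bf_mor_id.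
have -> : str3 G c m e ∘ actm (idm c) (ext m) (idm e) ∘ actm f (idm (F m)) g
   = str3 G c m e ∘ actm f (bf_mor G (idm m)) g ∘ actm (idm (rC a)) (ext m) (idm (rD b)).
  by rewrite -!compA !actmE bf_mor_id !comp1m !compm1.
by rewrite str3_nat -!compA.
Qed.

(** Acting by the unit on the other side recovers the one-sided structure map, so naturality for
    two-sided actions yields both one-sided laws. *)
Lemma bf_lE (E : bimodule_functor M) (c : C) m :
  bf_l E c m = bf_mor E (runit (lact c m)) ∘ str3 E c m (munit D) ∘ (runit (lact c (E m)))^†.
Proof.
have [_ r2] := runit_unitary (lact c (E m)).
rewrite -str3E /bf_str compA bf_r_unit runit_nat -!compA r2.
by rewrite compm1.
Qed.

Lemma bf_rE (E : bimodule_functor M) m (e : D) :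
  bf_r E m e = bf_mor E (ractm (lunit m) (idm e)) ∘ str3 E (munit C) m e
    ∘ ractm (lunit (E m))^† (idm e).
Proof.
have [_ r2] := lunit_unitary (E m).
rewrite -str3E /bf_str compA -bf_r_nat -!compA -!ractm_compl.
by rewrite (comp_tail (bf_l_unit _ _)) r2 ractm1 compm1.
Qed.

Theorem ext_bimodule_nat : bimodule_nat ext.
Proof.
split.
- by move=> m m' h; exact: ext_nat.
- move=> c m; rewrite !bf_lE !compA ext_nat -!compA; congr (_ ∘ _).
  rewrite (comp_tail (ext_str3_gen _ _ _)) -!compA; congr (_ ∘ _).
  apply: esym; apply: (unitary_nat_dag (runit_unitary _) (runit_unitary _)).
  exact: runit_nat.
- move=> m e; rewrite !bf_rE !compA ext_nat -!compA; congr (_ ∘ _).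
  rewrite (comp_tail (ext_str3_gen _ _ _)) -!compA; congr (_ ∘ _).
  rewrite /actm -!ractm_compl; congr ractm.
  apply: esym; apply: (unitary_nat_dag (lunit_unitary _) (lunit_unitary _)).
  exact: lunit_nat.
Qed.

(** [simple_nat] concerns maps into a ⊗ z ⊗ b. For maps out of it one passes through the component
    of the extension at a ⊗ z ⊗ b, which need not be simple. *)
Lemma snat_right p x z (psi : hom (Tob p (rM z)) (rM x)) :
  bf_mor G psi ∘ strT G p (rM z) ∘ Tm p (t z) ∘ isT F p (rM z) = t x ∘ bf_mor F psi.
Proof.
have e : strT G p (rM z) ∘ Tm p (t z) = ext _ ∘ strT F p (rM z).
  by rewrite -[in LHS](ext_simple z) ext_strT.
by rewrite -(compA (bf_mor G psi)) e -!compA isTK compm1 -ext_nat ext_simple.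
Qed.

End Extension.

Lemma bimodule_nat_str3 F G (eta : forall m, hom (F m) (G m)) : bimodule_nat eta ->
  forall (c : C) m (e : D), eta (act c m e) ∘ str3 F c m e
    = str3 G c m e ∘ actm (idm c) (eta m) (idm e).
Proof.
case=> _ hl hrr c m e; rewrite -!str3E /bf_str compA hrr -!compA -!ractm_compl.
by rewrite hl ractm_compl.
Qed.

Lemma snat_restrict F G (eta : forall m, hom (F m) (G m)) : bimodule_nat eta ->
  snat (fun x => eta (rM x)).
Proof.
move=> h p x z phi; have [hn _ _] := h.
have e : strT G p (rM z) ∘ Tm p (eta (rM z)) = eta _ ∘ strT F p (rM z).
  by rewrite (bimodule_nat_str3 h).
by rewrite e -(compA (eta _)) isTK compm1 hn.
Qed.

Lemma snat_comp F G H (t : forall x, hom (G (rM x)) (H (rM x)))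
  (s : forall x, hom (F (rM x)) (G (rM x))) :
  snat t -> snat s -> snat (fun x => t x ∘ s x).
Proof.
move=> ht hs' p x z phi; rewrite compA -ht -!compA -hs' Tm_comp -!compA.
by rewrite (compKl _ (strTK G p _)).
Qed.

Lemma snat_inv F G (t : forall x, hom (F (rM x)) (G (rM x)))
  (s : forall x, hom (G (rM x)) (F (rM x))) :
  (forall x, s x ∘ t x = idm _) -> (forall x, t x ∘ s x = idm _) -> snat t -> snat s.
Proof.
move=> st ts ht p x z phi.
have := congr1 (fun h => strT F p (rM z) ∘ Tm p (s z) ∘ isT G p (rM z) ∘ h ∘ s x) (ht p x z phi).
rewrite /= -!compA ts compm1 => <-.
rewrite (compKl _ (strTK G p _)) (compA (Tm p (s z))) -Tm_comp st Tm_id comp1m.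
by rewrite (compKl _ (isTK F p _)).
Qed.

(** Adjoints exchange maps into and out of a ⊗ z ⊗ b, so the hypothesis is used in the form
    [snat_right]; source and target become dagger conjugates. *)
Lemma snat_dag F G (t : forall x, hom (F (rM x)) (G (rM x))) :
  snat t -> snat (F := dconj G) (G := dconj F) (fun x => (t x)^†).
Proof.
move=> ht p x z phi; apply: dag_inj; rewrite !dconj_mor strT_dconj isT_dconj.
rewrite !dag_comp !dagK -(snat_right ht) Tm_dag dagK -!compA.
by [].
Qed.

Lemma snat_scale F (t : forall x, hom (F (rM x)) (F (rM x))) : simple_functor F -> snat t ->
  exists c : R[i], forall x, t x = c *: idm (F (rM x)).
Proof.
case=> _ h ht; have [c hc] := h _ (ext_bimodule_nat ht).
by exists c => x; rewrite -hc ext_simple.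
Qed.

Lemma snat_iso F G (t : forall x, hom (F (rM x)) (G (rM x)))
  (s : forall x, hom (G (rM x)) (F (rM x))) :
  (forall x, s x ∘ t x = idm _) -> (forall x, t x ∘ s x = idm _) -> snat t ->
  bimodule_functor_iso F G.
Proof.
move=> st ts ht; exists (ext t); split; first exact: ext_bimodule_nat.
move=> m; exists (ext s m); split; apply: bf_eq => x f.
  by rewrite -compA ext_in compA ext_in -compA st compm1 comp1m.
by rewrite -compA ext_in compA ext_in -compA ts compm1 comp1m.
Qed.

End SimpleNat.

(** * Positive endomorphisms *)

Section Positivity.
Variable R : realType.

Variable X : cstar_category R.

(** Left multiplication by h is an injective endomorphism of the finite-dimensional space End(x), so
    it reaches the identity; the right inverse so obtained is a left inverse by injectivity
    again. *)
Lemma injective_invertible (x : X) (h : hom x x) :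
  (forall f : hom x x, h ∘ f = 0 -> f = 0) -> exists h', h' ∘ h = idm x /\ h ∘ h' = idm x.
Proof.
move=> hi; pose comp_lin := GRing.isLinear.Build R[i] (hom x x) (hom x x) _ (comp h) (@comp_linearr R X x x x ^~ h).
pose Lh : {linear hom x x -> hom x x} := HB.pack (comp h) comp_lin.
pose L : 'End(hom x x) := linfun Lh.
have LE f : L f = h ∘ f by rewrite lfunE.
have hB f g : h ∘ (f - g) = h ∘ f - h ∘ g by rewrite -(scaleN1r g) compDr compZr scaleN1r.
have L0 : lker L == 0%VS.
  apply/lker0P => f g; rewrite !LE => e; apply/eqP; rewrite -subr_eq0; apply/eqP/hi.
  by rewrite hB e subrr.
have e : h ∘ (L^-1%VF (idm x)) = idm x.
  by rewrite -LE lker0_lfunVK.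
exists (L^-1%VF (idm x)); split=> //.
apply/eqP; rewrite -subr_eq0; apply/eqP/hi.
by rewrite hB compA e comp1m compm1 subrr.
Qed.

Definition positive (x : X) (h : hom x x) := exists y (f : hom x y), h = f^† ∘ f.

Hypothesis hX : finitely_semisimple X.

Lemma positiveD x (h h' : hom x x) : positive h -> positive h' -> positive (h + h').
Proof.
case=> y [f ->] [z [g ->]]; have [s [a [b [_ _ e]]]] := dag_sum2 hX f g.
by exists s, (a ∘ f + b ∘ g).
Qed.

Lemma positive_sum (I : Type) (s : seq I) (P : pred I) x (h : I -> hom x x) :
  (forall i, positive (h i)) -> positive (\sum_(i <- s | P i) h i).
Proof.
move=> hp; elim/big_rec: _ => [|i h' _ hh']; last exact: positiveD.
by exists x, 0; rewrite compm0.
Qed.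

Lemma positive_scale x (h : hom x x) (c : R) : 0 <= c -> positive h -> positive (c%:C *: h).
Proof.
move=> c0 [y [f ->]]; exists y, ((Num.sqrt c)%:C *: f).
by rewrite dagZ compZl compZr scalerA conjc_real -rmorphM -expr2 sqr_sqrtr.
Qed.

Lemma positive_sum0 (I : finType) x (h : I -> hom x x) :
  (forall i, positive (h i)) -> \sum_i h i = 0 -> forall i, h i = 0.
Proof.
move=> hp e i; move: e; rewrite (bigD1 i) //=.
have [y [f ->]] := hp i; have [z [g ->]] := positive_sum (index_enum I) (fun j => j != i) hp.
by case/(dag_definite_sum2 hX) => -> _; rewrite compm0.
Qed.

End Positivity.

Section Schur.
Variables (R : realType) (C D : monoidal_category R) (M : bimodule_category C D).
Hypotheses (hC : finitely_semisimple C) (hD : finitely_semisimple D).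
Hypothesis hM : finitely_semisimple M.
Variables (cC : fusion_choices C) (cD : fusion_choices D) (cM : module_choices M).
Local Notation IC := (fc_Irr cC).
Local Notation ID := (fc_Irr cD).
Local Notation IM := (mc_Irr cM).
Local Notation rM := (mc_rep (m := cM)).
Local Notation bM := (mc_bases (m := cM)).
Local Notation hr := (mc_irr cM).
Local Notation hs := (irr_simple (mc_irr cM)).

Implicit Types (a : IC) (b : ID) (p q : IC * ID) (m n : M) (x z u w i : IM).

Local Notation snat := (simple_nat cC cD).
Implicit Types F G H : bimodule_functor M.
Variable d : IM -> R.
Hypothesis hd : forall x, 0 < d x.
Hypothesis hdL : left_dimension cC d.
Hypothesis hdR : right_dimension cD d.
Variable J : W cC cD cM.
Hypothesis hJ : haar_integral J.

Lemma kron_dag k l : (kron k l : hom (rM k) (rM l))^† = kron l k.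
Proof.
have [e|n] := eqVneq k l; first by subst l; rewrite kronxx dag1.
by rewrite !kron0 ?dag0 // eq_sym.
Qed.

Lemma kronK k l (f : hom (rM k) (rM l)) : kron k l ∘ (kron l k ∘ f) = f.
Proof.
have [e|n] := eqVneq k l; first by subst l; rewrite kronxx !comp1m.
by rewrite (irr_hom0 hr f n) !compm0.
Qed.

Section Theta.
Variable F : bimodule_functor M.

(* Averaging identities yields a map from F to its dagger conjugate which is a
   sum of terms h^† h, hence invertible although F need not preserve daggers. *)
Definition theta : forall x, hom (F (rM x)) (dconj F (rM x)) :=
  @average _ _ _ _ cC cD cM d F (dconj F) (fun x => idm (F (rM x))).

Lemma theta_nat : snat theta.
Proof. exact: (average_nat hC hD hM hd hdL hdR hJ). Qed.

Lemma sandwich_dconj p k z (f : hom (rM k) (Tob p (rM z))) :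
  @sandwich _ _ _ _ _ _ _ F (dconj F) p k z k z f (idm (F (rM z))) f^†
  = (isT F p (rM z) ∘ bf_mor F f)^† ∘ (isT F p (rM z) ∘ bf_mor F f).
Proof.
by rewrite /sandwich Tm_id compm1 dconj_mor strT_dconj dagK dag_comp !compA.
Qed.

(** In general e'_j is not the adjoint of e_j, so the terms on the left need not be positive one by
    one. Basis independence replaces them by an orthogonal resolution, whose terms have the form h^†
    h; [kron k (kap i)] keeps the summands of type k. *)
Lemma channel_sum (k : IM) p z (n : nat) (kap : 'I_n -> IM) (u : forall i : 'I_n, hom (rM (kap i)) (Tob p (rM z))) :
  \sum_i u i ∘ (u i)^† = idm _ ->
  \sum_j @sandwich _ _ _ _ _ _ _ F (dconj F) p k z k z (tnth (dbas (bM k (Tob p (rM z)))) j)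
     (idm (F (rM z))) (tnth (dbas' (bM k (Tob p (rM z)))) j)
  = \sum_i (isT F p (rM z) ∘ bf_mor F (u i ∘ kron k (kap i)))^† ∘
       (isT F p (rM z) ∘ bf_mor F (u i ∘ kron k (kap i))).
Proof.
move=> hu.
pose B l (f : hom (rM l) (Tob p (rM z))) (g : hom (Tob p (rM z)) (rM l)) :=
  @sandwich _ _ _ _ _ _ _ F (dconj F) p k z k z (f ∘ kron k l) (idm (F (rM z))) (kron l k ∘ g).
have hB l : bilin (@B l).
  split=> e; first exact: (lin_comp (lin_sandwich1 _ _) (lin_compl _)).
  exact: (lin_comp (lin_sandwich3 _ _) (lin_compr _)).
transitivity (can bM B).
  rewrite /can (bigD1 k) //= [X in _ + X]big1 ?addr0 => [|l lk].
    by apply: eq_bigr => j _; rewrite /B kronxx compm1 comp1m.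
  have k0 : kron k l = 0 :> hom (rM k) (rM l) by rewrite kron0 1?eq_sym.
  by apply: big1 => j _; rewrite /B k0 compm0 (lin0 (lin_sandwich1 _ _)).
rewrite (can_family hM hr bM hB hu); apply: eq_bigr => i _.
by rewrite /B -sandwich_dconj dag_comp kron_dag.
Qed.

Lemma weight_gt0 p i k : 0 < dp p * (d i / d k) :> R.
Proof. by rewrite mulr_gt0 ?dp_gt0 // divr_gt0. Qed.

Lemma theta_sum k : theta k = \sum_(t : IC * ID * IM) (dp t.1 * (d t.2 / d k))%:C *:
  \sum_j @sandwich _ _ _ _ _ _ _ F (dconj F) t.1 k t.2 k t.2
    (tnth (dbas (bM k (Tob t.1 (rM t.2)))) j) (idm (F (rM t.2)))
    (tnth (dbas' (bM k (Tob t.1 (rM t.2)))) j).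
Proof.
rewrite /theta /average pair_bigA /= pair_bigA /=.
by apply: eq_bigr; case=> [[a b] i] _.
Qed.

Lemma channel_positive m k (h : hom m (F (rM k))) (t : IC * ID * IM) : positive (h^† ∘ ((dp t.1 * (d t.2 / d k))%:C *:
  \sum_j @sandwich _ _ _ _ _ _ _ F (dconj F) t.1 k t.2 k t.2
    (tnth (dbas (bM k (Tob t.1 (rM t.2)))) j) (idm (F (rM t.2)))
    (tnth (dbas' (bM k (Tob t.1 (rM t.2)))) j)) ∘ h).
Proof.
rewrite compZr compZl; apply: positive_scale; first by rewrite ltW ?weight_gt0.
have [n [kap [u [_ _ hu]]]] := irr_decomp hM hr (Tob t.1 (rM t.2)).
rewrite (channel_sum k hu) comp_sumr comp_suml; apply: (positive_sum hM) => i.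
by exists (Tob t.1 (F (rM t.2))), (isT F t.1 (rM t.2) ∘ bf_mor F (u i ∘ kron k (kap i)) ∘ h);
  rewrite (dag_comp _ h) !compA.
Qed.

(** A vanishing sum of positive terms vanishes termwise. The term a = b = 1, i = k already
    determines h, because it contains F of the unit isomorphism of k. *)
Lemma theta_definite m k (h : hom m (F (rM k))) : h^† ∘ theta k ∘ h = 0 -> h = 0.
Proof.
move=> e; pose p0 : IC * ID := (None, None).
have [n [kap [u [_ _ hu]]]] := irr_decomp hM hr (Tob p0 (rM k)).
have hz (i : 'I_n) : isT F p0 (rM k) ∘ bf_mor F (u i ∘ kron k (kap i)) ∘ h = 0.
  apply: dag_definite; move: i.
  apply: (@positive_sum0 R M hM _ m (fun i : 'I_n => (isT F p0 (rM k)
      ∘ bf_mor F (u i ∘ kron k (kap i)) ∘ h)^† ∘ (isT F p0 (rM k)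
      ∘ bf_mor F (u i ∘ kron k (kap i)) ∘ h))).
    by move=> i; eexists; eexists; reflexivity.
  move: e; rewrite theta_sum comp_sumr comp_suml.
  move/(positive_sum0 hM) => /(_ (channel_positive (k := k) h)) /(_ (p0, k)) /=.
  rewrite compZr compZl => /eqP; rewrite scaler_eq0 => /orP[/eqP w0|/eqP].
    by have := weight_gt0 p0 k k; rewrite -ltcR w0 ltxx.
  rewrite (channel_sum k hu) comp_sumr comp_suml => e; rewrite -[RHS]e; apply: eq_bigr => i _.
  by rewrite dag_comp !compA.
have hz' (i : 'I_n) : bf_mor F (u i ∘ kron k (kap i)) ∘ h = 0.
  have := congr1 (comp (strT F p0 (rM k))) (hz i).
  by rewrite !compA isTK comp1m compm0.
have [_ U] := unit3_unitary (rM k).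
suff hv : bf_mor F (unit3 (rM k))^† ∘ h = 0.
  by rewrite -(comp1m h) -(bf_mor_id F) -[in LHS]U bf_mor_comp -compA hv compm0.
rewrite -[(unit3 _)^†]comp1m -hu comp_suml (lin_sum (@lin_bf_mor _ _ _ _ F _ _)) comp_suml.
apply: big1 => i _; set v := _ ∘ (unit3 _)^†.
have -> : v = (u i ∘ kron k (kap i)) ∘ (kron (kap i) k ∘ ((u i)^† ∘ (unit3 (rM k))^†)).
  by rewrite /v -!compA kronK.
rewrite (scalarE (kron (kap i) k ∘ _) (hs k)) compZr compm1.
by rewrite (linZ (@lin_bf_mor _ _ _ _ F _ _)) compZl hz' scaler0.
Qed.

Lemma theta_inv : exists t' : forall x, hom (dconj F (rM x)) (F (rM x)),
  [/\ forall x, t' x ∘ theta x = idm _, forall x, theta x ∘ t' x = idm _ & snat t'].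
Proof.
have h x : exists t' : hom (F (rM x)) (F (rM x)), t' ∘ theta x = idm _ /\ theta x ∘ t' = idm _.
  apply: (@injective_invertible _ M (F (rM x)) (theta x)) => f e; apply: (@theta_definite _ x).
  by rewrite -compA e compm0.
have [t' ht'] := fin_all_exists h; exists t'.
have h1 x : t' x ∘ theta x = idm _ by case: (ht' x).
have h2 x : theta x ∘ t' x = idm _ by case: (ht' x).
by split=> //; exact: (snat_inv (F := F) (G := dconj F) h1 h2 theta_nat).
Qed.

End Theta.

(** [xi] is the adjoint of s for the positive forms theta of F and G. The composites of s and [xi]
    are scalars, equal to each other, and nonzero because s^† theta s = 0 would force s = 0. *)
Lemma snat_simple F G (s : forall x, hom (F (rM x)) (G (rM x))) :
  simple_functor F -> simple_functor G -> snat s -> (exists x, s x != 0) ->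
  bimodule_functor_iso F G.
Proof.
move=> hF hG hsn [x0 s0].
have [tF [tF1 tF2 tFn]] := theta_inv F.
pose xi x : hom (G (rM x)) (F (rM x)) := tF x ∘ ((s x)^† ∘ theta G x).
have xin : snat xi.
  by apply: (snat_comp tFn); apply: (snat_comp (G := dconj G)) (theta_nat G); exact: snat_dag.
have [c hc] := snat_scale hC hD hM hF (snat_comp xin hsn).
have [c' hc'] := snat_scale hC hD hM hG (snat_comp hsn xin).
have c0 : c != 0.
  apply: contra s0 => /eqP c0; apply/eqP; apply: (@theta_definite G _ x0).
  have := congr1 (comp (theta F x0)) (hc x0).
  by rewrite /xi -!compA (compKl _ (tF2 x0)) c0 scale0r compm0.
have cc' : c = c'.
  apply/eqP; rewrite -subr_eq0; apply/negPn; apply: contra s0 => n.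
  have e : c *: s x0 = c' *: s x0.
    by rewrite -[s x0 in LHS]compm1 -compZr -hc compA hc' compZl comp1m.
  have /eqP : (c - c') *: s x0 = 0 by rewrite scalerBl e subrr.
  by rewrite scaler_eq0 (negbTE n).
apply: (@snat_iso _ _ _ _ hC hD hM cC cD cM F G s (fun x => c^-1 *: xi x)) => // x.
  by rewrite compZl hc scalerA mulVf // scale1r.
by rewrite compZr hc' -cc' scalerA mulVf // scale1r.
Qed.

(** An isomorphism η : F → G and theta : F → F' turn a map F' → G into an endomorphism of F, which
    is a scalar. The line is therefore spanned by η composed with the inverse of theta. *)
Lemma snat_dconj_line F G : simple_functor F -> simple_functor G -> bimodule_functor_iso F G ->
  exists t0 : forall x, hom (dconj F (rM x)) (G (rM x)),
    [/\ snat t0, exists x, t0 x != 0 &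
     forall t : forall x, hom (dconj F (rM x)) (G (rM x)), snat t ->
       exists c : R[i], forall x, t x = c *: t0 x].
Proof.
move=> hF hG [eta [hn hiso]].
have [tF [tF1 tF2 tFn]] := theta_inv F.
have zn : snat (fun x => eta (rM x)) := snat_restrict hn.
have h (x : IM) : exists z : hom (G (rM x)) (F (rM x)),
    z ∘ eta (rM x) = idm _ /\ eta (rM x) ∘ z = idm _ by exact: hiso.
have [z hz] := fin_all_exists h.
have z1 x : z x ∘ eta (rM x) = idm _ by case: (hz x).
have z2 x : eta (rM x) ∘ z x = idm _ by case: (hz x).
have zn' := snat_inv z1 z2 zn.
exists (fun x => eta (rM x) ∘ tF x); split.
- exact: snat_comp zn tFn.
- have [m hm] := hF.1; case: (pickP (fun x => eta (rM x) ∘ tF x != 0)) => [x|t0]; first by exists x.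
  case: hm; rewrite /is_zero_obj (bf_complete hM cM F m); apply: big1 => x _; apply: big1 => j _.
  have F0 : idm (F (rM x)) = 0.
    have /eqP e := negbFE (t0 x).
    by rewrite -(tF1 x) -[tF x]comp1m -(z1 x) -(compA (z x)) e compm0 comp0m.
  by rewrite -[X in _ ∘ X]comp1m F0 comp0m compm0.
- move=> t ht; have [c hc] := snat_scale hC hD hM hF (snat_comp zn' (snat_comp ht (theta_nat F))).
  exists c => x; have := congr1 (fun h => eta (rM x) ∘ h ∘ tF x) (hc x).
  by rewrite /= !compA z2 comp1m -compA tF2 compm1 compZr compm1 compZl.
Qed.

End Schur.

(** * Rotation of bases *)

Section Rotation.
Variables (R : realType) (C D : monoidal_category R) (M : bimodule_category C D).
Hypotheses (hC : finitely_semisimple C) (hD : finitely_semisimple D).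
Hypothesis hM : finitely_semisimple M.
Variables (cC : fusion_choices C) (cD : fusion_choices D) (cM : module_choices M).
Local Notation IC := (fc_Irr cC).
Local Notation ID := (fc_Irr cD).
Local Notation IM := (mc_Irr cM).
Local Notation rM := (mc_rep (m := cM)).
Local Notation bM := (mc_bases (m := cM)).
Local Notation hr := (mc_irr cM).
Local Notation hs := (irr_simple (mc_irr cM)).

Implicit Types (a : IC) (b : ID) (p q : IC * ID) (m n : M) (x z u w i : IM).

Implicit Types F G H : bimodule_functor M.
Variable d : IM -> R.
Hypothesis hd : forall x, 0 < d x.
Hypothesis hdL : left_dimension cC d.
Hypothesis hdR : right_dimension cD d.
Variable J : W cC cD cM.
Hypothesis hJ : haar_integral J.
Local Notation jc := (jc J).
(* Frobenius reciprocity Hom(k, a ⊗ i ⊗ b) ≅ Hom(a' ⊗ k ⊗ b', i) on dual bases. *)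
Section RotateBasis.
Variables (q : IC * ID) (k i : IM).
Implicit Types (v : hom (rM i) (Tob (dl q) (rM k))) (g : hom (Tob (dl q) (rM k)) (rM i)).

Definition rot_in g : hom (rM k) (Tob q (rM i)) := Tm q g ∘ Ru' q (rM k).
Definition rot_out v : hom (Tob q (rM i)) (rM k) := (Ru' q (rM k))^† ∘ Tm q v.

Lemma rot_pair v g :
  rot_out v ∘ rot_in g = ((d i / d k)%:C * scalar (g ∘ v)) *: idm _.
Proof.
rewrite -(sph' hM hd hdL hdR) /rot_out /rot_in -!compA; congr (_ ∘ _).
by rewrite compA Tm_comp.
Qed.

Lemma rot_in_surj (e : hom (rM k) (Tob q (rM i))) :
  e = rot_in ((Ru q (rM i))^† ∘ Tm (dl q) e).
Proof.
rewrite /rot_in Tm_comp -compA Ru'_nat compA.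
have := congr1 (@dag _ _ _ _) (Ru_zig q (rM i)).
by rewrite dag_comp dagK Tm_dag dag1 => ->; rewrite comp1m.
Qed.

(** Rotated dual bases pair to d_i / d_k instead of 1 ([rot_pair]), and the factor on the left
    compensates for this. *)
Lemma rotate_bases (V : lmodType R[i]) (B : hom (rM k) (Tob q (rM i)) -> hom (Tob q (rM i)) (rM k) -> V) :
  bilin B ->
  (d i / d k)%:C *: \sum_j B (tnth (dbas (bM k (Tob q (rM i)))) j)
                             (tnth (dbas' (bM k (Tob q (rM i)))) j)
  = \sum_j B (rot_in (tnth (dbas' (bM i (Tob (dl q) (rM k)))) j))
             (rot_out (tnth (dbas (bM i (Tob (dl q) (rM k)))) j)).
Proof.
move=> [h1 h2].
have lin_in : lin rot_in by apply: (lin_comp (lin_compl _)); exact: Tm_lin.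
set e := fun j => tnth (dbas (bM k (Tob q (rM i)))) j.
set v := fun s => tnth (dbas (bM i (Tob (dl q) (rM k)))) s.
set v' := fun s => tnth (dbas' (bM i (Tob (dl q) (rM k)))) s.
have expand j : (d i / d k)%:C *: e j = \sum_s scalar (rot_out (v s) ∘ e j) *: rot_in (v' s).
  rewrite {1}(rot_in_surj (e j)); set e1 := _ ∘ Tm (dl q) (e j).
  rewrite [in LHS](dbas'_expand (hs i) (bM i (Tob (dl q) (rM k))) e1).
  rewrite (lin_sum lin_in) scaler_sumr; apply: eq_bigr => s _.
  rewrite (linZ lin_in) scalerA; congr (_ *: _).
  by rewrite {1}(rot_in_surj (e j)) rot_pair (scalar_idZ _ (hs k)).
rewrite scaler_sumr.
under eq_bigr => j _ do rewrite -(linZ (h1 _)) expand (lin_sum (h1 _)).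
rewrite exchange_big; apply: eq_bigr => s _ /=.
rewrite [in RHS](dbas'_expand (hs k) (bM k (Tob q (rM i))) (rot_out (v s))) (lin_sum (h2 _)).
by apply: eq_bigr => j _; rewrite (linZ (h1 _)) (linZ (h2 _)).
Qed.

(** Evaluating the previous identity on the pairing of f and h to [scalar (h ∘ f)] counts basis
    elements on both sides. *)
Lemma mult_rot : mult (bM k (Tob q (rM i))) = mult (bM i (Tob (dl q) (rM k))).
Proof.
have hB : bilin (fun (f : hom (rM k) (Tob q (rM i))) (h : hom (Tob q (rM i)) (rM k)) => (scalar (h ∘ f) : R[i]^o)).
  split=> e; first exact: lin_comp (@lin_scalar _ _ _) (lin_compr _).
  exact: lin_comp (@lin_scalar _ _ _) (lin_compl _).
have := rotate_bases hB.
under eq_bigr => j _ do rewrite dbas_dual eqxx scale1r (scalar1 (hs k)).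
under [in RHS]eq_bigr => j _ do rewrite rot_pair dbas_dual eqxx scale1r (scalar1 (hs i)) mulr1 (scalar_idZ _ (hs k)).
rewrite !sumr_const !card_ord => e.
have /(mulfI (x := (d i / d k)%:C)) h : (d i / d k)%:C * (mult (bM k (Tob q (rM i))))%:R
  = (d i / d k)%:C * (mult (bM i (Tob (dl q) (rM k))))%:R :> R[i].
  by rewrite -[RHS]mulr_natr in e *.
by apply/eqP; rewrite -(eqr_nat R[i]); apply/eqP/h; rewrite fmorph_eq0 gt_eqF // divr_gt0.
Qed.
End RotateBasis.

Definition weight m : hom m m := can bM (fun k (f : hom (rM k) m) g => jc k *: (f ∘ g)).

Lemma irr_separater m n (h h' : hom m n) :
  (forall x (f : hom (rM x) m), h ∘ f = h' ∘ f) -> h = h'.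
Proof.
move=> e; rewrite -(compm1 h) -(compm1 h') -(irr_complete hM hr bM m) !comp_sumr.
apply: eq_bigr => k _; rewrite !comp_sumr; apply: eq_bigr => j _.
by rewrite !compA e.
Qed.

Lemma weight_in m x (f : hom (rM x) m) : weight m ∘ f = jc x *: f.
Proof.
rewrite -[f in RHS]comp1m -[in RHS](irr_complete hM hr bM m) [in RHS]comp_suml [in RHS]scaler_sumr.
rewrite /weight /can comp_suml; apply: eq_bigr => k _.
rewrite !comp_suml scaler_sumr; apply: eq_bigr => j _.
rewrite compZl -!compA; have [e|n] := eqVneq k x; first by subst k.
have xk : x != k by rewrite eq_sym.
rewrite (irr_hom0 hr (tnth (dbas' (bM k m)) j ∘ f) xk) compm0.
by rewrite !scaler0.
Qed.

Lemma weight_nat m n (h : hom m n) : weight n ∘ h = h ∘ weight m.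
Proof.
by apply: irr_separater => x f; rewrite -!compA !weight_in compZr.
Qed.

(** By sphericality the partial trace of the weight is the sum over z of j_z (d_z / d_k) dim Hom(z,
    a' ⊗ k ⊗ b'), with a', b' the duals. Rotating the multiplicities turns the total into the
    identity obtained from ε_L(J) = 1. *)
Lemma weight_rot k : \sum_(a : IC) \sum_(b : ID) (dp (a, b))%:C *:
  ((Ru' (a, b) (rM k))^† ∘ Tm (a, b) (weight (Tob (dl (a, b)) (rM k))) ∘ Ru' (a, b) (rM k)) = idm (rM k).
Proof.
rewrite -[RHS]scale1r -(haar_normL hC hD hM hd hdL hdR hJ k) scaler_suml; apply: eq_bigr => a _.
rewrite scaler_suml; apply: eq_bigr => b _.
rewrite scaler_suml /weight /can (lin_sum (@Tm_lin _ _ _ _ _ _ _ _ _)) comp_sumr comp_suml scaler_sumr.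
apply: eq_bigr => z _.
rewrite (lin_sum (@Tm_lin _ _ _ _ _ _ _ _ _)) comp_sumr comp_suml scaler_sumr.
under eq_bigr => j _ do rewrite (linZ (@Tm_lin _ _ _ _ _ _ _ _ _)) compZr compZl
  (sph' hM hd hdL hdR) dbas_dual eqxx scale1r (scalar1 (hs z)) mulr1 !scalerA.
rewrite sumr_const card_ord -(mult_rot (a, b) k z) -scaler_nat scalerA; congr (_ *: _).
move: (dp (a, b)) => r; rewrite mulrC [_ (r * _)]rmorphM -/(jc z); move: (jc z) => c; rewrite [in RHS]mulrA [c * _]mulrC.
by [].
Qed.

Lemma weight_avg n : \sum_(a : IC) \sum_(b : ID) (dp (a, b))%:C *:
  ((Ru' (a, b) n)^† ∘ Tm (a, b) (weight (Tob (dl (a, b)) n)) ∘ Ru' (a, b) n) = idm n.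
Proof.
apply: irr_separater => k f; rewrite comp1m -[RHS]compm1 -weight_rot comp_suml comp_sumr.
apply: eq_bigr => a _; rewrite comp_suml comp_sumr; apply: eq_bigr => b _.
rewrite compZl compZr; congr (_ *: _).
rewrite -!compA -Ru'_nat !compA; congr (_ ∘ _).
rewrite -!compA -Tm_comp weight_nat Tm_comp !compA; congr (_ ∘ _).
apply: dag_inj; rewrite !dag_comp !dagK !Tm_dag; exact: Ru'_nat.
Qed.

Section AverageWeight.
Variable H : bimodule_functor M.

(** Rotation turns the sum over i into a completeness relation for the dual pair acting on k. The
    structure maps of H then cancel by naturality of the weight, and its partial trace over H k is
    left. *)
Lemma average_weight k :
  @average _ _ _ _ cC cD cM d H H (fun x => weight (H (rM x))) k = idm (H (rM k)).
Proof.
rewrite -[RHS]weight_avg /average; apply: eq_bigr => a _; apply: eq_bigr => b _.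
pose q : IC * ID := (a, b).
have sum_in : bf_mor H (Ru' q (rM k))^† ∘ strT H q (Tob (dl q) (rM k))
  ∘ Tm q (\sum_i \sum_j bf_mor H (tnth (dbas (bM i (Tob (dl q) (rM k)))) j) ∘ weight (H (rM i)) ∘
     bf_mor H (tnth (dbas' (bM i (Tob (dl q) (rM k)))) j))
  ∘ isT H q (Tob (dl q) (rM k)) ∘ bf_mor H (Ru' q (rM k))
  = (Ru' q (H (rM k)))^† ∘ Tm q (weight (Tob (dl q) (H (rM k)))) ∘ Ru' q (H (rM k)).
  have -> : \sum_i \sum_j bf_mor H (tnth (dbas (bM i (Tob (dl q) (rM k)))) j) ∘ weight (H (rM i)) ∘
     bf_mor H (tnth (dbas' (bM i (Tob (dl q) (rM k)))) j) = weight (H (Tob (dl q) (rM k))).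
    rewrite -[RHS]compm1 (bf_complete hM cM) comp_sumr; apply: eq_bigr => i _.
    by rewrite comp_sumr; apply: eq_bigr => j _; rewrite compA weight_nat.
  rewrite -compA strT_Ru' -(strT_Ru'_dag H) -!compA; do 2!congr (_ ∘ _).
  by rewrite !compA -!Tm_comp weight_nat.
rewrite -[X in _ = _ *: X]sum_in (lin_sum (@Tm_lin _ _ _ _ _ _ _ _ _)) comp_sumr !comp_suml scaler_sumr.
apply: eq_bigr => i _; rewrite rmorphM -scalerA; congr (_ *: _).
rewrite (@rotate_bases q k i _ (fun f g => @sandwich _ _ _ _ _ _ _ H H q k i k i f (weight (H (rM i))) g)).
  rewrite (lin_sum (@Tm_lin _ _ _ _ _ _ _ _ _)) comp_sumr !comp_suml; apply: eq_bigr => j _.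
  rewrite /sandwich /rot_in /rot_out !bf_mor_comp !Tm_comp -!compA; congr (_ ∘ _).
  rewrite (compA (isT H q _)) isT_nat -!compA. by rewrite [LHS]compA -strT_nat -compA.
by split=> e; [exact: lin_sandwich1 | exact: lin_sandwich3].
Qed.
End AverageWeight.
End Rotation.

(** * Characters *)

Section Characters.
Variables (R : realType) (C D : monoidal_category R) (M : bimodule_category C D).
Hypothesis hM : finitely_semisimple M.
Variables (cC : fusion_choices C) (cD : fusion_choices D) (cM : module_choices M).
Local Notation IC := (fc_Irr cC).
Local Notation ID := (fc_Irr cD).
Local Notation IM := (mc_Irr cM).
Local Notation rM := (mc_rep (m := cM)).
Local Notation bM := (mc_bases (m := cM)).
Local Notation hr := (mc_irr cM).
Local Notation hs := (irr_simple (mc_irr cM)).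

Implicit Types (a : IC) (b : ID) (p q : IC * ID) (m n : M) (x z u w i : IM).

Implicit Types F G H : bimodule_functor M.
Local Notation WT := (W cC cD cM).
Variable d : IM -> R.
Hypothesis hd : forall x, 0 < d x.
Hypothesis hdL : left_dimension cC d.
Hypothesis hdR : right_dimension cD d.

(** Adjoints of dual bases are dual bases with the two roles exchanged, so they represent the same
    canonical element. *)
Lemma dag_bases (X : cstar_category R) (k y : X) (bas : dual_bases k y) (V : lmodType R[i])
  (B : hom k y -> hom y k -> V) : simple k -> bilin B ->
  \sum_j B (tnth (dbas' bas) j)^† (tnth (dbas bas) j)^†
  = \sum_j B (tnth (dbas bas) j) (tnth (dbas' bas) j).
Proof.
move=> hk [h1 h2].
under eq_bigr => j _ do rewrite {1}(dbas_expand hk bas (tnth (dbas' bas) j)^†) (lin_sum (h1 _)).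
rewrite exchange_big; apply: eq_bigr => s _ /=.
under eq_bigr => j _ do rewrite (linZ (h1 _)) -(linZ (h2 _)).
rewrite -(lin_sum (h2 _)); congr (B _ _); apply: dag_inj.
rewrite [RHS](dbas_expand hk bas) dag_sum; apply: eq_bigr => j _.
by rewrite dagZ dagK -(scalar_dag _ hk) dag_comp dagK.
Qed.

(* The comparison between a ⊗ m ⊗ b and its double dual; it is unitary because d is
   spherical, and makes (S (f ⊗ g))^* = (twist g^†) ⊗ (f^† twist^†). *)
Definition twist p m : hom (Tob p m) (Tob (dl (dl p)) m) :=
  locked (Tm (dl (dl p)) (Ru p m)^† ∘ Ru (dl p) (Tob p m)).

Lemma Ru_nat_dag p m n (h : hom m n) :
  (Ru p n)^† ∘ Tm (dl p) (Tm p h) = h ∘ (Ru p m)^†.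
Proof. by apply: dag_inj; rewrite !dag_comp !dagK !Tm_dag Ru_nat. Qed.

Lemma twist_nat p m n (h : hom m n) :
  twist p n ∘ Tm p h = Tm (dl (dl p)) h ∘ twist p m.
Proof.
rewrite /twist -!lock -compA -Ru_nat !compA; congr (_ ∘ _).
by rewrite -!Tm_comp Ru_nat_dag.
Qed.

Lemma twist_str F p m :
  bf_mor F (twist p m)^† ∘ strT F (dl (dl p)) m = strT F p m ∘ (twist p (F m))^†.
Proof.
rewrite /twist -!lock !dag_comp !Tm_dag !dagK bf_mor_comp -compA -strT_nat strT_Ru.
by rewrite !Tm_comp !compA strT_Ru_dag Ru_nat_dag.
Qed.

(** Tested between simple objects, twist^† twist takes the partial traces over p and over its dual
    in succession; their factors d_x / d_z and d_z / d_x cancel. Naturality of the twist extends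
    this to all m. *)
Lemma twist_isometry p m : (twist p m)^† ∘ twist p m = idm _.
Proof.
have simple_case z : (twist p (rM z))^† ∘ twist p (rM z) = idm _.
  apply: (irr_separater hM (cM := cM)) => x e; apply: (irr_separate hM (cM := cM)) => x' g.
  have [n|n] := eqVneq x x'; last first.
    by rewrite (irr_hom0 hr (g ∘ _) n) (irr_hom0 hr (g ∘ (_ ∘ e)) n).
  subst x'; rewrite comp1m.
  have he : twist p (rM z) ∘ e = Tm (dl (dl p)) ((Ru p (rM z))^† ∘ Tm (dl p) e) ∘ Ru (dl p) (rM x).
    by rewrite /twist -!lock -compA -Ru_nat Tm_comp -!compA.
  have hg : g ∘ (twist p (rM z))^† = (Ru (dl p) (rM x))^† ∘ Tm (dl (dl p)) (Tm (dl p) g ∘ Ru p (rM z)).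
    by rewrite /twist -!lock dag_comp Tm_dag dagK compA -Ru_nat_dag Tm_comp -!compA.
  rewrite -compA he (compA g) hg -compA (compA (Tm _ _) (Tm _ _)) -Tm_comp compA.
  rewrite (sph hM hd hdL hdR).
  have -> : (Ru p (rM z))^† ∘ Tm (dl p) e ∘ (Tm (dl p) g ∘ Ru p (rM z))
     = (Ru p (rM z))^† ∘ Tm (dl p) (e ∘ g) ∘ Ru p (rM z) by rewrite Tm_comp !compA.
  rewrite (sph hM hd hdL hdR) (scalar_idZ _ (hs z)) mulrA -rmorphM mulrA divfK ?gt_eqF //.
  rewrite divff ?gt_eqF // rmorph1 mul1r -(scalarE _ (hs x)). by [].
suff h : (twist p m)^† ∘ twist p m ∘ Tm p (idm m) = Tm p (idm m) by rewrite Tm_id compm1 in h.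
rewrite -(irr_complete hM hr bM m) (lin_sum (@Tm_lin _ _ _ _ _ _ _ _ _)) comp_sumr; apply: eq_bigr => k _.
rewrite (lin_sum (@Tm_lin _ _ _ _ _ _ _ _ _)) comp_sumr; apply: eq_bigr => j _.
rewrite Tm_comp compA; congr (_ ∘ _); rewrite -compA twist_nat.
have -> : (twist p m)^† ∘ (Tm (dl (dl p)) (tnth (dbas (bM k m)) j) ∘ twist p (rM k))
  = Tm p (tnth (dbas (bM k m)) j) ∘ (twist p (rM k))^† ∘ twist p (rM k).
  rewrite compA; congr (_ ∘ _).
  by apply: dag_inj; rewrite !dag_comp !dagK !Tm_dag twist_nat.
by rewrite -compA simple_case compm1.
Qed.

Lemma hat_inE a b u w (g : hom (Tob (a, b) (rM u)) (rM w)) :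
  hat_in g = Tm (dl (a, b)) g ∘ Ru (a, b) (rM u).
Proof. by rewrite /hat_in /Ru -lock /coev assoc3E unit3E !compA. Qed.

Lemma hat_outE a b x z (f : hom (rM x) (Tob (a, b) (rM z))) :
  hat_out f = (Ru (a, b) (rM z))^† ∘ Tm (dl (a, b)) f.
Proof.
rewrite /hat_out /Ru -lock /coev assoc3E unit3E !dag_comp dagK actm_dag dag1 !compA.
by [].
Qed.

Section OneFunctor.
Variable G : bimodule_functor M.

(** The trace of f ⊗ g on V^G: it sends the block Hom(z, G u) to Hom(x, G w), so only the deltas z =
    x and u = w leave diagonal entries. *)
Definition chi : wfam cC cD cM R[i]^o := fun a b x z u w f g =>
  \sum_j scalar (tnth (dbas' (bM x (G (rM w)))) j ∘ (bf_mor G g ∘ strT G (a, b) (rM u)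
    ∘ Tm (a, b) (bf_mor G (kron w u) ∘ tnth (dbas (bM x (G (rM w)))) j ∘ kron z x) ∘ f)).

Lemma chi_bil : wbil chi.
Proof.
move=> a b x z u w; split=> e; apply: lin_bigsum => j _; apply: (lin_comp (@lin_scalar _ _ _)).
  exact: (lin_comp (lin_compr _) (lin_compr _)).
apply: (lin_comp (lin_compr _)); do 3![apply: (lin_comp (lin_compl _))].
exact: lin_bf_mor.
Qed.

Lemma tube_characterE (v : WT) : tube_character G v = Wlin chi v.
Proof.
pose act_on gamma : WT -> tube_module cM G := fun v => Wact v (mod_bas gamma).
have actE gamma : act_on gamma v = Wlin (fun a b x z u w f g =>
    pure_act f g (tnth (dbas (bM (tag gamma).1 (G (rM (tag gamma).2)))) (tagged gamma))) v.
  rewrite /act_on /Wact; apply: eq_Wlin => a b x z u w f g.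
  rewrite (bigD1 gamma) //= big1 ?addr0 => [|gamma' n].
    by rewrite ffunE eqxx scale1r.
  by rewrite ffunE (negPf n) scale0r.
have ev gamma : lin (fun m : tube_module cM G => m gamma).
  by move=> c m m'; rewrite !ffunE.
transitivity (\sum_gamma (act_on gamma v) gamma); first by [].
under eq_bigr => gamma _ do rewrite actE (Wlin_comp _ _ (ev gamma)).
rewrite -Wlin_sum; apply: eq_Wlin => a b x z u w f g.
under eq_bigr => gamma _ do rewrite /pure_act /mod_elt (lin_sum (ev gamma)).
rewrite exchange_big; apply: eq_bigr => j _ /=.
set g0 := existT _ _ _; rewrite (bigD1 g0) //= big1 ?addr0 => [|gamma n]; last first.
  by rewrite !ffunE (negPf n) scaler0.
rewrite !ffunE eqxx [LHS]mulr1 (dbas_coordE (hs _)).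
by rewrite /strT -str3E.
Qed.

Lemma tube_character_pure a b x z u w (f : hom (rM x) (Tob (a, b) (rM z)))
  (g : hom (Tob (a, b) (rM u)) (rM w)) : tube_character G (pure f g : WT) = chi f g.
Proof. by rewrite tube_characterE (Wlin_pure chi_bil). Qed.

Lemma conjcD (c c' : R[i]) : conjc (c + c') = conjc c + conjc c'.
Proof. exact: rmorphD. Qed.

Lemma lin_conj_dag (X : cstar_category R) (x y : X) (L : hom x y -> R[i]^o) :
  lin L -> lin (fun f : hom y x => (conjc (L f^†) : R[i]^o)).
Proof.
by move=> hL k u v; rewrite dag_antilinear hL /GRing.scale /= conjcD conjcM conjcK.
Qed.

Lemma lin_hat_in a b u w : lin (@hat_in _ _ _ _ cC cD cM a b u w).
Proof.
have h : lin (fun g : hom (Tob (a, b) (rM u)) (rM w) => Tm (dl (a, b)) g ∘ Ru (a, b) (rM u)).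
  by apply: (lin_comp (lin_compl _)); exact: Tm_lin.
by move=> k g g'; rewrite !hat_inE h.
Qed.

Lemma lin_hat_out a b x z : lin (@hat_out _ _ _ _ cC cD cM a b x z).
Proof.
have h : lin (fun f : hom (rM x) (Tob (a, b) (rM z)) => (Ru (a, b) (rM z))^† ∘ Tm (dl (a, b)) f).
  by apply: (lin_comp (lin_compr _)); exact: Tm_lin.
by move=> k g g'; rewrite !hat_outE h.
Qed.

Definition star_chi : wfam cC cD cM R[i]^o := fun a b x z u w f g =>
  conjc ((d z / d x)%:C * chi (hat_in f^†) (hat_out g^†)).

Lemma star_chi_bil : wbil star_chi.
Proof.
move=> a b x z u w; have [h1 h2] := chi_bil (fc_dual a) (fc_dual b) z x w u; split=> e.
  apply: (lin_conj_dag (L := fun f => (_ * chi (hat_in f) _ : R[i]^o))); apply: lin_mull.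
  exact: (lin_comp (h1 _) (@lin_hat_in _ _ _ _)).
apply: (lin_conj_dag (L := fun f => (_ * chi _ (hat_out f) : R[i]^o))); apply: lin_mull.
exact: (lin_comp (h2 _) (@lin_hat_out _ _ _ _)).
Qed.

Lemma conj_Wstar (v : WT) : conjc (tube_character G (Wstar d v)) = Wlin star_chi v.
Proof.
have L : lin (fun v : WT => (tube_character G v : R[i]^o)).
  by move=> c v1 v2; rewrite !tube_characterE; exact: Wlin_lin.
rewrite /Wstar (lin_sum L) conjc_sum; apply: eq_bigr => -[[[[[[a b] x] z] u] w] ij] _.
by rewrite (linZ L) [_ *: _]/GRing.scale /= conjcM conjcK (linZ L) tube_character_pure.
Qed.

Lemma Wantip_bil : wbil (fun a b x z u w f g =>
  (d u / d w)%:C *: pure (hat_in g) (hat_out f) : WT).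
Proof.
move=> a b x z u w; have [h1 h2] := @pure_bil _ _ _ _ cC cD cM (fc_dual a) (fc_dual b) u w x z.
split=> e; apply: lin_scale.
  exact: (lin_comp (h2 _) (@lin_hat_out _ _ _ _)).
exact: (lin_comp (h1 _) (@lin_hat_in _ _ _ _)).
Qed.

Lemma dual_star_lin : lin (fun v : WT => (dual_star d (tube_character G) v : R[i]^o)).
Proof.
have h1 : lin (Wlin star_chi : WT -> R[i]^o) by exact: Wlin_lin.
have h2 : lin (Wantip d : WT -> WT) by exact: Wlin_lin.
have e v : dual_star d (tube_character G) v = Wlin star_chi (Wantip d v) by exact: conj_Wstar.
by move=> c v v'; rewrite (e (c *: v + v')) (e v) (e v') h2 h1.
Qed.

Lemma hat_in2 a b u w (g : hom (Tob (a, b) (rM u)) (rM w)) :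
  hat_in (hat_in g)^† = twist (a, b) (rM u) ∘ g^†.
Proof.
rewrite !hat_inE dag_comp Tm_dag Tm_comp -compA Ru_nat compA.
by rewrite /twist -lock.
Qed.

Lemma hat_out2 a b x z (f : hom (rM x) (Tob (a, b) (rM z))) :
  hat_out (hat_out f)^† = f^† ∘ (twist (a, b) (rM z))^†.
Proof.
have e : (twist (a, b) (rM z))^† = (Ru (dl (a, b)) (Tob (a, b) (rM z)))^† ∘ Tm (dl (dl (a, b))) (Ru (a, b) (rM z)).
  by rewrite /twist -!lock dag_comp Tm_dag dagK.
rewrite e !hat_outE dag_comp dagK (Tm_dag (dl (a, b)) f) Tm_comp compA.
by rewrite [X in X ∘ _](Ru_nat_dag (dl (a, b))) compA.

Qed.

(** The weights d_u / d_w of S and d_w / d_u of the star cancel. Bending twice leaves two twists,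
    which cancel by naturality and isometry, and complex conjugation turns the scalar into that of
    the adjoint composite, where G is replaced by its dagger conjugate. *)
Lemma dual_star_pure a b x z u w (f : hom (rM x) (Tob (a, b) (rM z)))
  (g : hom (Tob (a, b) (rM u)) (rM w)) :
  dual_star d (tube_character G) (pure f g : WT) =
  \sum_j scalar (g ∘ Tm (a, b) (kron w u ∘ tnth (dbas' (bM w (G (rM x)))) j ∘ bf_mor (dconj G) (kron z x))
    ∘ isT (dconj G) (a, b) (rM z) ∘ bf_mor (dconj G) f ∘ tnth (dbas (bM w (G (rM x)))) j).
Proof.
rewrite /dual_star conj_Wstar /Wantip (Wlin_pure Wantip_bil) (linZ (Wlin_lin _)) (Wlin_pure star_chi_bil).
rewrite /star_chi hat_in2 hat_out2 conjcM conjc_real [LHS]mulrA -rmorphM.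
rewrite mulrA divfK ?gt_eqF // divff ?gt_eqF // rmorph1 mul1r conjc_sum.
pose B (f1 : hom (rM w) (G (rM x))) (g1 : hom (G (rM x)) (rM w)) : R[i]^o :=
  scalar (g ∘ Tm (a, b) (kron w u ∘ g1 ∘ bf_mor (dconj G) (kron z x))
    ∘ isT (dconj G) (a, b) (rM z) ∘ bf_mor (dconj G) f ∘ f1).
have hB : bilin B.
  split=> e; apply: (lin_comp (@lin_scalar _ _ _)); first exact: lin_compr.
  do 3![apply: (lin_comp (lin_compl _))]; apply: (lin_comp (lin_compr _)).
  apply: (lin_comp (@Tm_lin _ _ _ _ _ _ _ _ _)).
  exact: (lin_comp (lin_compl _) (lin_compr _)).
rewrite -(dag_bases (bM w (G (rM x))) (hs w) hB); apply: eq_bigr => j _.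
rewrite -(scalar_dag _ (hs w)) /B; congr scalar.
set h := bf_mor G (kron x z) ∘ _ ∘ _.
have e : bf_mor G (f^† ∘ (twist (a, b) (rM z))^†) ∘ strT G (dl (dl (a, b))) (rM z)
   ∘ Tm (dl (dl (a, b))) h ∘ (twist (a, b) (rM u) ∘ g^†)
   = bf_mor G f^† ∘ strT G (a, b) (rM z) ∘ Tm (a, b) h ∘ g^†.
  rewrite !compA -(compA _ (Tm (dl (dl (a, b))) h)). rewrite -(twist_nat (a, b)) bf_mor_comp -(compA (bf_mor G _)) twist_str.
  by rewrite -!compA (compKl _ (twist_isometry _ _)).
rewrite e !dag_comp dagK Tm_dag !dag_comp !kron_dag isT_dconj !dconj_mor !compA !kron_dag.
by [].
Qed.
End OneFunctor.

End Characters.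

(** * The inner product of two characters *)

Section InnerProduct.
Variables (R : realType) (C D : monoidal_category R) (M : bimodule_category C D).
Hypotheses (hC : finitely_semisimple C) (hD : finitely_semisimple D).
Hypothesis hM : finitely_semisimple M.
Variables (cC : fusion_choices C) (cD : fusion_choices D) (cM : module_choices M).
Local Notation IC := (fc_Irr cC).
Local Notation ID := (fc_Irr cD).
Local Notation IM := (mc_Irr cM).
Local Notation rM := (mc_rep (m := cM)).
Local Notation bM := (mc_bases (m := cM)).
Local Notation hr := (mc_irr cM).
Local Notation hs := (irr_simple (mc_irr cM)).

Implicit Types (a : IC) (b : ID) (p q : IC * ID) (m n : M) (x z u w i : IM).

Implicit Types F G H : bimodule_functor M.
Local Notation WT := (W cC cD cM).
Variable d : IM -> R.
Hypothesis hd : forall x, 0 < d x.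
Hypothesis hdL : left_dimension cC d.
Hypothesis hdR : right_dimension cD d.
Variable J : W cC cD cM.
Hypothesis hJ : haar_integral J.
Local Notation jc := (jc J).
Local Notation snat := (simple_nat cC cD).
Variables F G : bimodule_functor M.
Local Notation dF := (dconj F).
Local Notation avgFG := (@average _ _ _ _ cC cD cM d dF G).

(** The family that is h at k and zero elsewhere, built with deltas so that h is never transported
    along an equality of indices. F and its dagger conjugate agree on objects, so h has the required
    type. *)
Definition supp k (h : hom (F (rM k)) (G (rM k))) : forall i, hom (dF (rM i)) (G (rM i)) :=
  fun i => bf_mor G (kron k i) ∘ h ∘ bf_mor dF (kron i k).

Lemma supp0 k (h : hom (F (rM k)) (G (rM k))) i : i != k -> supp h i = 0.
Proof.
by move=> n; rewrite /supp (kron0 (x := i)) // (lin0 (@lin_bf_mor _ _ _ _ _ _ _)) compm0.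
Qed.

Lemma suppE k (h : hom (F (rM k)) (G (rM k))) : supp h k = h.
Proof. by rewrite /supp !kronxx !bf_mor_id compm1 comp1m. Qed.

Local Notation mF x k := (mult (bM x (F (rM k)))).
Local Notation mG x k := (mult (bM x (G (rM k)))).

(* Throughout, s.1 indexes a basis of Hom(x, F k) and s.2 a basis of Hom(x, G k). *)
Definition rank1 x k (s : 'I_(mF x k) * 'I_(mG x k)) : hom (F (rM k)) (G (rM k)) :=
  tnth (dbas (bM x (G (rM k)))) s.2 ∘ tnth (dbas' (bM x (F (rM k)))) s.1.

Definition matrix_coef x k (s : 'I_(mF x k) * 'I_(mG x k)) (h : hom (F (rM k)) (G (rM k))) : R[i] :=
  scalar (tnth (dbas' (bM x (G (rM k)))) s.2 ∘ h ∘ tnth (dbas (bM x (F (rM k)))) s.1).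

Lemma matrix_coef_lin x k s : lin (@matrix_coef x k s : _ -> R[i]^o).
Proof.
apply: (lin_comp (@lin_scalar _ _ _)).
exact: (lin_comp (lin_compl _) (lin_compr _)).
Qed.

(** The maps [rank1 s] and the functionals [matrix_coef s] are dual to each other, so this is the
    trace, on the block of Hom(F k, G k) factoring through x, of one summand of the averaging
    operator, up to its weight. *)
Definition channel p x k i : R[i] := \sum_(s : 'I_(mF x k) * 'I_(mG x k)) \sum_e
  matrix_coef s (@sandwich _ _ _ _ _ _ _ dF G p k i k i (tnth (dbas (bM k (Tob p (rM i)))) e)
    (supp (rank1 s) i) (tnth (dbas' (bM k (Tob p (rM i)))) e) : hom (F (rM k)) (G (rM k))).

Lemma channel0 p x k i : i != k -> channel p x k i = 0.
Proof.
move=> n; rewrite /channel big1 // => s _; rewrite big1 // => e _.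
by rewrite supp0 // (lin0 (lin_sandwich2 _ _)) (lin0 (@matrix_coef_lin _ _ _)).
Qed.

Lemma average_channel x k : \sum_s matrix_coef s (avgFG (supp (@rank1 x k s)) k)
  = \sum_(a : IC) \sum_(b : ID) \sum_i (dp (a, b) * (d i / d k))%:C * channel (a, b) x k i.
Proof.
transitivity (\sum_s \sum_(a : IC) \sum_(b : ID) \sum_i \sum_e (dp (a, b) * (d i / d k))%:C *
  matrix_coef s (@sandwich _ _ _ _ _ _ _ dF G (a, b) k i k i (tnth (dbas (bM k (Tob (a, b) (rM i)))) e)
    (supp (@rank1 x k s) i) (tnth (dbas' (bM k (Tob (a, b) (rM i)))) e) : hom (F (rM k)) (G (rM k)))).
  apply: eq_bigr => s _; have L := @matrix_coef_lin x k s.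
  rewrite /average (lin_sum L); apply: eq_bigr => a _.
  rewrite (lin_sum L); apply: eq_bigr => b _.
  rewrite (lin_sum L); apply: eq_bigr => i _.
  by rewrite (linZ L) (lin_sum L) [LHS]mulr_sumr.
rewrite exchange_big; apply: eq_bigr => a _ /=.
rewrite exchange_big; apply: eq_bigr => b _ /=.
rewrite exchange_big; apply: eq_bigr => i _ /=.
rewrite /channel mulr_sumr; apply: eq_bigr => s _.
by rewrite mulr_sumr.
Qed.

Definition starF a b x z u w (f : hom (rM x) (Tob (a, b) (rM z)))
  (g : hom (Tob (a, b) (rM u)) (rM w)) : R[i] :=
  \sum_j scalar (g ∘ Tm (a, b) (kron w u ∘ tnth (dbas' (bM w (F (rM x)))) j ∘ bf_mor dF (kron z x))
    ∘ isT dF (a, b) (rM z) ∘ bf_mor dF f ∘ tnth (dbas (bM w (F (rM x)))) j).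

(** The bases of Hom(x, a ⊗ x ⊗ b) supplied by J resolve the identity between the factors of F and G
    and fuse them into one composite; the bases supplied by the coproduct become those of
    [sandwich]. *)
Lemma channel_product a b x z i k :
  \sum_j \sum_e starF (tnth (dbas (bM k (Tob (a, b) (rM i)))) e) (tnth (dbas' (bM x (Tob (a, b) (rM z)))) j)
    * chi G (tnth (dbas (bM x (Tob (a, b) (rM z)))) j) (tnth (dbas' (bM k (Tob (a, b) (rM i)))) e)
  = if z == x then channel (a, b) x k i else 0.
Proof.
have [->|n] := eqVneq z x; last first.
  apply: big1 => j _; apply: big1 => e _; rewrite /starF big1 ?mul0r // => s _.
  have k0 : kron x z = 0 :> hom (rM x) (rM z) by rewrite kron0 1?eq_sym.
  rewrite k0 !comp0m (lin0 (@Tm_lin _ _ _ _ _ _ _ _ _)) compm0 !comp0m; exact: scalar0.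
rewrite exchange_big.
under eq_bigr => e _ do under eq_bigr => j _ do rewrite /starF /chi big_distrlr pair_bigA /=.
under eq_bigr => e _ do rewrite exchange_big /=.
rewrite exchange_big; apply: eq_bigr => -[jb ja] _; apply: eq_bigr => e _ /=.
rewrite /matrix_coef /rank1 /sandwich /supp /=.
set e1 := tnth (dbas (bM k _)) e; set e2 := tnth _ e.
set al := tnth (dbas (bM x (G _))) ja; set al' := tnth _ ja.
set be := tnth (dbas (bM x (F _))) jb; set be' := tnth _ jb.
set g := bf_mor G e2 ∘ strT G (a, b) (rM i) ∘ Tm (a, b) (bf_mor G (kron k i) ∘ al ∘ kron x x).
set f := Tm (a, b) (kron x x ∘ be' ∘ bf_mor dF (kron i k)) ∘ isT dF (a, b) (rM i) ∘ bf_mor dF e1 ∘ be.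
transitivity (\sum_j scalar (al' ∘ g ∘ tnth (dbas (bM x (Tob (a, b) (rM x)))) j)
   * scalar (tnth (dbas' (bM x (Tob (a, b) (rM x)))) j ∘ f)).
  by apply: eq_bigr => j _; rewrite mulrC /g /f !compA.
rewrite -(scalar_sum_insert hr); congr scalar.
rewrite /f /g kronxx !compm1 !comp1m !Tm_comp !compA.
by [].
Qed.

Lemma tube_character_lin : lin (fun v : WT => (tube_character G v : R[i]^o)).
Proof.
have h : lin (Wlin (chi G) : WT -> R[i]^o) by exact: Wlin_lin.
have e (v : WT) : tube_character G v = Wlin (chi G) v by exact: tube_characterE.
by move=> c v v'; rewrite (e (c *: v + v')) (e v) (e v') h.
Qed.

(** J carries the weight d_z / d_x and the average d_i / d_k. Both are 1 on the terms that survive: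
    the character of F forces z = x, and [supp] forces i = k. *)
Lemma dual_innerE : dual_inner d J (tube_character F) (tube_character G)
  = \sum_x \sum_k jc x * \sum_s matrix_coef s (avgFG (supp (@rank1 x k s)) k).
Proof.
have h1 (v' : WT) : lin (fun v : WT => dual_star d (tube_character F) v * tube_character G v' : R[i]^o).
  by apply: lin_mulr; exact: dual_star_lin.
have h2 (v : WT) : lin (fun v' : WT => dual_star d (tube_character F) v * tube_character G v' : R[i]^o).
  by apply: lin_mull; exact: tube_character_lin.
rewrite /dual_inner /dual_mul (sweedlerE h1 h2).
transitivity (Wlin (V := R[i]^o) (fun a b x z u w (f : hom (rM x) (Tob (a, b) (rM z))) (g : hom (Tob (a, b) (rM u)) (rM w)) =>
  \sum_i \sum_k \sum_e starF (tnth (dbas (bM k (Tob (a, b) (rM i)))) e) g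
    * chi G f (tnth (dbas' (bM k (Tob (a, b) (rM i)))) e)) J).
  apply: eq_Wlin => a b x z u w f g; apply: eq_bigr => i _; apply: eq_bigr => k _.
  apply: eq_bigr => e _.
  by rewrite (dual_star_pure hM hd hdL hdR) tube_character_pure.
rewrite (Wlin_haar hC hD hM hd hdL hdR hJ).
transitivity (\sum_(a : IC) \sum_(b : ID) \sum_x \sum_k jc x * ((dp (a, b))%:C * channel (a, b) x k k)).
  apply: eq_bigr => a _; apply: eq_bigr => b _; apply: eq_bigr => x _.
  transitivity (\sum_z \sum_i \sum_k (jc z * (dp (a, b) * (d z / d x))%:C) *
      (if z == x then channel (a, b) x k i else 0)).
    apply: eq_bigr => z _; rewrite -scaler_sumr exchange_big /=.
    under eq_bigr => j _ do rewrite exchange_big /=.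
    rewrite [LHS]mulr_sumr exchange_big /=.
    rewrite [RHS]exchange_big; apply: eq_bigr => i _ /=.
    by rewrite mulr_sumr; apply: eq_bigr => k _; rewrite -channel_product.
  rewrite (bigD1 x) //= [X in _ + X]big1 ?addr0 => [|z n]; last first.
    by rewrite (negPf n) big1 // => i _; rewrite big1 // => k _; rewrite mulr0.
  rewrite exchange_big; apply: eq_bigr => k _ /=.
  rewrite (bigD1 k) //= [X in _ + X]big1 ?addr0 => [|i n]; last by rewrite channel0 // if_same mulr0.
  by rewrite eqxx divff ?gt_eqF // mulr1 mulrA.
transitivity (\sum_x \sum_(a : IC) \sum_(b : ID) \sum_k jc x * ((dp (a, b))%:C * channel (a, b) x k k)).
  under eq_bigr => a _ do rewrite exchange_big /=.
  by rewrite exchange_big.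
apply: eq_bigr => x _.
transitivity (\sum_k \sum_(a : IC) \sum_(b : ID) jc x * ((dp (a, b))%:C * channel (a, b) x k k)).
  under eq_bigr => a _ do rewrite exchange_big /=.
  by rewrite exchange_big.
apply: eq_bigr => k _; rewrite average_channel mulr_sumr; apply: eq_bigr => a _.
rewrite mulr_sumr; apply: eq_bigr => b _; congr (_ * _).
rewrite (bigD1 k) //= [X in _ + X]big1 ?addr0 => [|i n]; last by rewrite channel0 // mulr0.
by rewrite divff ?gt_eqF // mulr1.
Qed.

(** Composed with the invertible theta of F, a nonzero average would be a nonzero map F → G, hence
    an isomorphism. *)
Lemma average_nat0 (t : forall x, hom (dF (rM x)) (G (rM x))) :
  simple_functor F -> simple_functor G -> ~ bimodule_functor_iso F G -> forall k, avgFG t k = 0.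
Proof.
move=> hF hG FG k; apply/eqP/negPn/negP => n; apply: FG.
have tn := average_nat hC hD hM hd hdL hdR hJ t.
have [tF [tF1 tF2 _]] := theta_inv hC hD hM hd hdL hdR hJ F.
apply: (snat_simple hC hD hM hd hdL hdR hJ hF hG (snat_comp tn (theta_nat hC hD hM hd hdL hdR hJ F))).
exists k; apply: contra n => /eqP e.
by rewrite -[avgFG t k]compm1 -(tF2 k) compA e comp0m.
Qed.

Lemma sum_supp (h : forall x, hom (F (rM x)) (G (rM x))) y : \sum_k avgFG (supp (h k)) y = avgFG h y.
Proof.
rewrite /average exchange_big; apply: eq_bigr => a _ /=.
rewrite exchange_big; apply: eq_bigr => b _ /=.
rewrite exchange_big; apply: eq_bigr => i _ /=.
rewrite -scaler_sumr; congr (_ *: _); rewrite exchange_big; apply: eq_bigr => j _ /=.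
rewrite (bigD1 i) //= suppE big1 ?addr0 // => k n.
by rewrite supp0 1?eq_sym // (lin0 (lin_sandwich2 _ _)).
Qed.

(** For fixed x, expanding t applied to the basis of Hom(x, F k) shows that the inner sum is t times
    the projection onto the isotypic component of x. *)
Lemma weight_rank1 k (t : hom (F (rM k)) (G (rM k))) :
  \sum_x jc x *: \sum_s matrix_coef s t *: @rank1 x k s = t ∘ weight J (F (rM k)).
Proof.
rewrite /weight /can comp_sumr; apply: eq_bigr => x _.
rewrite [RHS]comp_sumr -(pair_bigA _ (fun jb ja => matrix_coef (jb, ja) t *: @rank1 x k (jb, ja))) /=.
rewrite scaler_sumr; apply: eq_bigr => jb _; rewrite compZr; congr (_ *: _).
rewrite compA [in RHS](dbas_expand (hs x) (bM x (G (rM k))) (t ∘ _)) comp_suml.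
by apply: eq_bigr => ja _; rewrite compZl /matrix_coef /= compA.
Qed.

(** Here t meets the maps out of a ⊗ i ⊗ b, so it is pulled out of the average by [snat_right]. *)
Lemma average_comp (t : forall x, hom (dF (rM x)) (G (rM x))) (w : forall x, hom (dF (rM x)) (dF (rM x))) y :
  snat t -> avgFG (fun x => t x ∘ w x) y = t y ∘ @average _ _ _ _ cC cD cM d dF dF w y.
Proof.
move=> ht; rewrite /average comp_sumr; apply: eq_bigr => a _.
rewrite comp_sumr; apply: eq_bigr => b _; rewrite comp_sumr; apply: eq_bigr => i _.
rewrite compZr comp_sumr; congr (_ *: _); apply: eq_bigr => j _.
set e := tnth _ j; set e' := tnth _ j.
rewrite /sandwich !compA -(snat_right hM ht) Tm_comp.
rewrite -!compA (compKl _ (strTK dF (a, b) (rM i))).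
by [].
Qed.

Lemma dual_inner_iso : simple_functor F -> simple_functor G -> bimodule_functor_iso F G ->
  dual_inner d J (tube_character F) (tube_character G) = 1.
Proof.
move=> hF hG FG; rewrite dual_innerE.
have [t0 [t0n [y t0y] t0u]] := snat_dconj_line hC hD hM hd hdL hdR hJ hF hG FG.
(* The coefficient along [t0] is read off at one object y where [t0] does not vanish. *)
pose L (h : hom (dF (rM y)) (G (rM y))) : R[i]^o := coord [tuple t0 y] ord0 h.
have Llin : lin L by move=> c u v; rewrite /L linearP.
have L1 : L (t0 y) = 1.
  have fr : free [tuple t0 y] by rewrite seq1_free.
  by have := coord_free ord0 ord0 fr; rewrite eqxx.
pose phi k (h : hom (F (rM k)) (G (rM k))) : R[i]^o := L (avgFG (supp h) y).
have phiE k h x : avgFG (supp h) x = @phi k h *: t0 x.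
  have [c hc] := t0u _ (average_nat hC hD hM hd hdL hdR hJ (F := dF) (G := G) (supp h)).
  by rewrite hc /phi hc (linZ Llin) L1 /GRing.scale /= mulr1.
have philin k : lin (@phi k).
  apply: (lin_comp Llin); apply: lin_average => x.
  exact: (lin_comp (lin_compl _) (lin_compr _)).
(* Each average is [phi] times [t0]. By linearity of [phi], the matrix coefficients of [t0]
   reassemble the rank one maps into [t0] composed with the weight. *)
transitivity (\sum_k @phi k (t0 k ∘ weight J (F (rM k)))).
  rewrite exchange_big; apply: eq_bigr => k _ /=.
  rewrite -weight_rank1 (lin_sum (@philin k)); apply: eq_bigr => x _.
  rewrite (linZ (@philin k)) (lin_sum (@philin k)) [RHS]/GRing.scale /=; congr (_ * _).
  apply: eq_bigr => s _; rewrite phiE (linZ (@matrix_coef_lin x k s)) (linZ (@philin k)).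
  exact: mulrC.
rewrite /phi -(lin_sum Llin) sum_supp (average_comp _ _ t0n).
by rewrite (average_weight hC hD hM hd hdL hdR hJ) compm1 L1.
Qed.

Lemma dual_inner_noniso : simple_functor F -> simple_functor G -> ~ bimodule_functor_iso F G ->
  dual_inner d J (tube_character F) (tube_character G) = 0.
Proof.
move=> hF hG FG; rewrite dual_innerE; apply: big1 => x _; apply: big1 => k _.
rewrite big1 ?mulr0 // => s _; rewrite average_nat0 //.
exact: (lin0 (@matrix_coef_lin x k s)).
Qed.

End InnerProduct.

Theorem theorem24 (R : realType) (C D : monoidal_category R)
  (M : bimodule_category C D)
  (hC : unitary_fusion C) (hD : unitary_fusion D)
  (hM : finitely_semisimple M) (hMi : indecomposable M)
  (cC : fusion_choices C) (cD : fusion_choices D) (cM : module_choices M)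
  (d : mc_Irr cM -> R) (hd : forall m, 0 < d m)
  (hdL : left_dimension cC d) (hdR : right_dimension cD d)
  (F G : bimodule_functor M) (hF : simple_functor F) (hG : simple_functor G)
  (J : W cC cD cM) (hJ : haar_integral J) :
  (bimodule_functor_iso F G ->
     dual_inner d J (tube_character F) (tube_character G) = 1) /\
  (~ bimodule_functor_iso F G ->
     dual_inner d J (tube_character F) (tube_character G) = 0).
Proof.
have [sC _ _] := hC; have [sD _ _] := hD.
split=> FG; [exact: (dual_inner_iso sC sD hM) | exact: (dual_inner_noniso sC sD hM)].
Qed.
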